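(* Suppose Assumptions 1--10 listed in the context hold (with $\alpha>1$ from Assumption 9 and $\beta>0$ from Assumption 10), let $\epsilon_n>0$ with $\epsilon_n\to0$, and suppose all nonzero eigenvalues of $M'=R_{XY}'R_{XY}'^{*}$ are distinct. Let $\psi_1,\dots,\psi_d$ and $\widehat\psi_1,\dots,\widehat\psi_d$ be the first $d$ (unit-norm) eigenfunctions of $M'$ and of $\widehat M'=\widehat R_{XY}'\widehat R_{XY}'^{*}$, respectively (those associated with the $d$ largest eigenvalues in decreasing order), and let $s_j'=\mathrm{sgn}\langle\widehat\psi_j,\psi_j\rangle_{\mathcal H_X}$. Put $\widehat\eta_j=(\widehat\Sigma_{XX}+\epsilon_nI)^{-1/2}\widehat\psi_j$ and $\eta_j=\Sigma_{XX}^{\dagger1/2}\psi_j$ for $j=1,\dots,d$. Then $$\|\widehat\eta_j-s_j'\eta_j\|_{\mathcal H_X}=O_p(r_n),\qquad j=1,\dots,d,$$ where $$r_n=n^{-1/2}\epsilon_n^{(\beta\wedge1)-1}+\epsilon_n^{\beta\wedge1}+n^{-1}\epsilon_n^{-(3\alpha+1)/(2\alpha)}+n^{-1/2}\epsilon_n^{-(\alpha+1)/(2\alpha)}$$ and $a\wedge b=\min(a,b)$.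
   Context: Setting. $(\Omega,\mathcal F,P)$ is a probability space; $\Omega_X\subseteq\mathbb R^p$, $\Omega_Y\subseteq\mathbb R^q$; $X:\Omega\to\Omega_X$, $Y:\Omega\to\Omega_Y$ are Borel random vectors with distributions $P_X,P_Y$. $\kappa_X,\kappa_Y$ are positive definite kernels on $\Omega_X\times\Omega_X$, $\Omega_Y\times\Omega_Y$ with reproducing kernel Hilbert spaces $\mathcal H_X,\mathcal H_Y$. For Hilbert space elements, $(u\otimes v)w=\langle v,w\rangle u$. Mean elements: $\mu_X=E\{\kappa_X(\cdot,X)\}$, $\mu_Y=E\{\kappa_Y(\cdot,Y)\}$. Covariance operators: $\Sigma_{XX}=E[\{\kappa_X(\cdot,X)-\mu_X\}\otimes\{\kappa_X(\cdot,X)-\mu_X\}]:\mathcal H_X\to\mathcal H_X$, $\Sigma_{XY}=E[\{\kappa_X(\cdot,X)-\mu_X\}\otimes\{\kappa_Y(\cdot,Y)-\mu_Y\}]:\mathcal H_Y\to\mathcal H_X$, $\Sigma_{YX}=\Sigma_{XY}^*$. For a bounded operator $A$, the Moore--Penrose inverse $A^\dagger:\mathrm{ran}(A)\to\ker(A)^\perp$ is the inverse of the restriction of $A$ to $\ker(A)^\perp$; $\Sigma_{XX}^{\dagger1/2}=(\Sigma_{XX}^{1/2})^\dagger$. $R_{XY}=\Sigma_{XX}^\dagger\Sigma_{XY}$ and $R_{XY}'=\Sigma_{XX}^{\dagger1/2}\Sigma_{XY}$, both $\mathcal H_Y\to\mathcal H_X$; $R_{XY}'^{*}=\Sigma_{YX}\Sigma_{XX}^{\dagger1/2}$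 is the adjoint of $R_{XY}'$ (extended by continuity). Sample. $(X_1,Y_1),\dots,(X_n,Y_n)$ are i.i.d. copies of $(X,Y)$; $E_n$ denotes the sample average. $\widehat\mu_X=E_n\{\kappa_X(\cdot,X)\}$, $\widehat\mu_Y=E_n\{\kappa_Y(\cdot,Y)\}$, $\widehat\Sigma_{XX}=E_n[\{\kappa_X(\cdot,X)-\widehat\mu_X\}\otimes\{\kappa_X(\cdot,X)-\widehat\mu_X\}]$, $\widehat\Sigma_{XY}=E_n[\{\kappa_X(\cdot,X)-\widehat\mu_X\}\otimes\{\kappa_Y(\cdot,Y)-\widehat\mu_Y\}]$, $\widehat R_{XY}'=(\widehat\Sigma_{XX}+\epsilon_nI)^{-1/2}\widehat\Sigma_{XY}$. Assumptions. 1. $\mathcal H_X$, $\mathcal H_Y$ are dense subsets of $L_2(P_X)$, $L_2(P_Y)$ modulo constants: for every $f\in L_2(P_X)$ there is $\{f_n\}\subset\mathcal H_X$ with $\mathrm{var}[f_n(X)-f(X)]\to0$, and similarly for $\mathcal H_Y$. 2. $\kappa_X$ and $\kappa_Y$ are bounded and continuous. 3. $\mathrm{ran}(\Sigma_{XY})\subseteq\mathrm{ran}(\Sigma_{XX})$. 4. $R_{XY}$ is a bounded operator. 5. The family of conditional distributions $\{P_{X|Y}(\cdot|y):y\in\Omega_Y\}$ is dominated by a $\sigma$-finite measure. 6. There exist $f_1,\dots,f_d\in\mathcal H_X$ such that $Y$ and $X$ are conditionally independent given $f_1(X),\dots,f_d(X)$, and $\sigma\{f_1(X),\dots,f_d(X)\}$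 is minimal: whenever $g_1,\dots,g_{d'}\in\mathcal H_X$ are such that $Y$ and $X$ are conditionally independent given $g_1(X),\dots,g_{d'}(X)$, then $\sigma\{f_1(X),\dots,f_d(X)\}\subseteq\sigma\{g_1(X),\dots,g_{d'}(X)\}$. 7. $R_{XY}$ has rank $d$. 8. $R_{XY}'$ has rank $d$. 9. The eigenvalues $\lambda_1\ge\lambda_2\ge\cdots$ of $\Sigma_{XX}$ satisfy $\lambda_j\asymp j^{-\alpha}$ for all $j\in\mathbb N$ for some $\alpha>1$ (i.e. $\lambda_j/j^{-\alpha}$ and $j^{-\alpha}/\lambda_j$ are bounded). 10. There are $\beta>0$ and a bounded linear operator $S_{XY}:\mathcal H_Y\to\mathcal H_X$ with $\Sigma_{XY}=\Sigma_{XX}^{1+\beta}S_{XY}$. *)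

(* Defs.v *)
From HB Require Import structures.
From mathcomp Require Import all_boot all_order all_algebra.
From mathcomp Require Import all_classical all_reals all_analysis.

Set Implicit Arguments.
Unset Strict Implicit.
Unset Printing Implicit Defensive.

Import Order.TTheory GRing.Theory Num.Theory.
Import numFieldNormedType.Exports.

Local Open Scope classical_set_scope.
Local Open Scope ring_scope.

Record hilbert (R : realType) := Hilbert {
  hilbert_sort :> completeNormedModType R;
  hilbert_dot : {dot hilbert_sort for idfun};
  hilbert_normE : forall u : hilbert_sort, hilbert_dot u u = `|u| ^+ 2 }.

Definition inner (R : realType) (H : hilbert R) (u v : H) : R :=
  hilbert_dot H u v.

(* Kernels and functions on a subset [D] of R^m are total Rocq functions, of
   which only the values on [D] matter. *)
Definition pd_kernel (R : realType) (m : nat) (D : set 'rV[R]_m)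
    (k : 'rV[R]_m -> 'rV[R]_m -> R) : Prop :=
  (forall x y, D x -> D y -> k x y = k y x) /\
  (forall (l : nat) (x : 'I_l -> 'rV[R]_m) (c : 'I_l -> R),
     (forall i, D (x i)) ->
     0 <= \sum_(i < l) \sum_(j < l) c i * c j * k (x i) (x j)).

(* The RKHS of [k], which is unique up to a unique isometry: [rkhs_eval]
   identifies its elements with functions on [D], and [rkhs_section x] is
   k(.,x). *)
Record rkhs (R : realType) (m : nat) (D : set 'rV[R]_m)
    (k : 'rV[R]_m -> 'rV[R]_m -> R) := RKHS {
  rkhs_space :> hilbert R;
  rkhs_eval : rkhs_space -> 'rV[R]_m -> R;
  rkhs_section : 'rV[R]_m -> rkhs_space;
  rkhs_eval_linear : forall (a : R) (f g : rkhs_space) x, D x ->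
    rkhs_eval (a *: f + g) x = a * rkhs_eval f x + rkhs_eval g x;
  rkhs_eval_inj : forall f g : rkhs_space,
    (forall x, D x -> rkhs_eval f x = rkhs_eval g x) -> f = g;
  rkhs_sectionE : forall x y, D x -> D y ->
    rkhs_eval (rkhs_section x) y = k y x;
  rkhs_reproducing : forall (f : rkhs_space) x, D x ->
    inner f (rkhs_section x) = rkhs_eval f x }.

(* Operators are plain functions.  Objects that are determined by a
   defining property are obtained by choice ([xget]), with a junk value 0
   when no such object exists. *)

Definition bounded_operator (R : realType) (H K : hilbert R) (A : H -> K) :
    Prop :=
  linear A /\ exists C : R, forall u, `|A u| <= C * `|u|.

Definition tensor (R : realType) (H K : hilbert R) (u : H) (v w : K) :=
  inner v w *: u : H.

Definition adjoint (R : realType) (H K : hilbert R) (A : H -> K) (v : K) : H :=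
  xget 0 [set w : H | forall u, inner (A u) v = inner u w].

Definition op_inv (R : realType) (H K : hilbert R) (A : H -> K) (v : K) : H :=
  xget 0 [set u : H | A u = v].

(* Moore-Penrose inverse; meaningful on [range A] only. *)
Definition mp_inv (R : realType) (H K : hilbert R) (A : H -> K) (v : K) : H :=
  xget 0 [set u : H | A u = v /\ forall z, A z = 0 -> inner u z = 0].

(* The unique positive square root of a bounded positive operator. *)
Definition op_sqrt (R : realType) (H : hilbert R) (A : H -> H) : H -> H :=
  xget (fun=> 0) [set B : H -> H |
    [/\ bounded_operator B,
        forall u v, inner (B u) v = inner u (B v),
        forall u, 0 <= inner (B u) u &
        forall u, B (B u) = A u]].

(* A = sum_j (lam j) e_j (x) e_j with the e_j orthonormal and lam j >= 0, i.e.
   [lam] lists, with multiplicity, the nonzero eigenvalues of the compact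
   positive operator [A] (and possibly zeros). *)
Definition spectral_decomposition (R : realType) (H : hilbert R) (A : H -> H)
    (lam : nat -> R) (e : nat -> H) : Prop :=
  [/\ forall i j, inner (e i) (e j) = (i == j)%:R,
      forall j, 0 <= lam j &
      forall u, \sum_(j < n) lam j *: tensor (e j) (e j) u @[n --> \oo] --> A u].

(* A ^ s = sum_j (lam j) ^ s e_j (x) e_j, for s > 0. *)
Definition op_pow (R : realType) (H : hilbert R) (A : H -> H) (s : R) :
    H -> H :=
  xget (fun=> 0) [set B : H -> H |
    exists lam e, spectral_decomposition A lam e /\
      forall u, \sum_(j < n) (lam j `^ s) *: tensor (e j) (e j) u
                  @[n --> \oo] --> B u].

Definition has_rank (R : realType) (H K : hilbert R) (A : H -> K) (d : nat) :
    Prop :=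
  exists b : 'I_d -> K,
    (forall c : 'I_d -> R, \sum_i c i *: b i = 0 -> forall i, c i = 0) /\
    range A = [set v | exists c : 'I_d -> R, v = \sum_i c i *: b i].

Definition eigenpair (R : realType) (H : hilbert R) (A : H -> H) (l : R)
    (u : H) : Prop :=
  u <> 0 /\ A u = l *: u.

(* Distinctness is meant with multiplicity: each nonzero eigenvalue has a
   one-dimensional eigenspace. *)
Definition distinct_nonzero_eigenvalues (R : realType) (H : hilbert R)
    (A : H -> H) : Prop :=
  forall (l : R) (u v : H), l != 0 -> eigenpair A l u -> eigenpair A l v ->
  exists c : R, v = c *: u.

(* [psi] is an orthonormal family of eigenvectors associated with the d
   largest eigenvalues, counted with multiplicity, in nonincreasing order. *)
Definition first_eigenfunctions (R : realType) (H : hilbert R) (A : H -> H)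
    (d : nat) (psi : 'I_d -> H) : Prop :=
  exists lam : 'I_d -> R,
    [/\ forall i j, inner (psi i) (psi j) = (i == j)%:R,
        forall j, A (psi j) = lam j *: psi j,
        forall i j : 'I_d, (i <= j)%N -> lam j <= lam i &
        forall (l : R) (u : H), eigenpair A l u ->
          (forall j, inner u (psi j) = 0) -> forall j, l <= lam j].

Definition borel (R : realType) (m : nat) :=
  g_sigma_algebraType (@open 'rV[R]_m).

Section probability_notions.
Context {d : measure_display} {T : measurableType d} {R : realType}.
Variable P : probability T R.

Definition random_vector (m : nat) (D : set 'rV[R]_m) (X : T -> 'rV[R]_m) :
    Prop :=
  measurable_fun [set: T] (X : T -> borel R m) /\ forall w, D (X w).

(* Expectation of a random element of a Hilbert space, in the weak sense:
   < E Z, u > = E < Z, u > for all u. *)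
Definition hexpectation (H : hilbert R) (Z : T -> H) : H :=
  xget 0 [set m : H | forall u : H,
    P.-integrable [set: T] (EFin \o (fun w => inner (Z w) u)) /\
    ('E_P[fun w => inner (Z w) u] = (inner m u)%:E)%E].

(* Expectation of a random operator, (E Z) u = E (Z u). *)
Definition op_expectation (H K : hilbert R) (Z : T -> H -> K) : H -> K :=
  fun u => hexpectation (fun w => Z w u).

Definition sigma_of (m : nat) (Z : 'I_m -> T -> R) : set_system T :=
  <<s [set A | exists i (B : set R), measurable B /\ A = Z i @^-1` B] >>.

(* [h] is a version of the conditional probability P(A | G). *)
Definition cond_prob (G : set_system T) (A : set T) (h : T -> R) : Prop :=
  [/\ forall B : set R, measurable B -> G (h @^-1` B),
      P.-integrable [set: T] (EFin \o h) &
      forall C, G C -> (\int[P]_(w in C) (h w)%:E = P (A `&` C))%E].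

(* X and Y are conditionally independent given G:
   P(X in A, Y in B | G) = P(X in A | G) P(Y in B | G) a.s. *)
Definition cond_indep (p q : nat) (X : T -> 'rV[R]_p) (Y : T -> 'rV[R]_q)
    (G : set_system T) : Prop :=
  forall (A : set (borel R p)) (B : set (borel R q)),
    measurable A -> measurable B ->
  exists hA hB : T -> R,
    [/\ cond_prob G (X @^-1` A) hA, cond_prob G (Y @^-1` B) hB &
        cond_prob G (X @^-1` A `&` Y @^-1` B) (hA \* hB)].

Definition iid_copies (p q : nat) (X : T -> 'rV[R]_p) (Y : T -> 'rV[R]_q)
    (Xs : nat -> T -> 'rV[R]_p) (Ys : nat -> T -> 'rV[R]_q) : Prop :=
  (forall i (C : set (borel R p * borel R q)), measurable C ->
     P [set w | C (Xs i w, Ys i w)] = P [set w | C (X w, Y w)]) /\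
  (forall n (C : 'I_n -> set (borel R p * borel R q)),
     (forall i, measurable (C i)) ->
     P [set w | forall i : 'I_n, C i (Xs i w, Ys i w)] =
     (\prod_(i < n) P [set w | C i (Xs i w, Ys i w)])%E).

(* Z_n = O_p(r_n).  The event {|Z_n| > C r_n} is only required to be contained
   in a measurable set of small probability, so that the definition also makes
   sense for nonmeasurable Z_n; for measurable Z_n it is the usual one. *)
Definition bigOp (Z : nat -> T -> R) (r : nat -> R) : Prop :=
  forall delta : R, 0 < delta ->
  exists2 C : R, 0 < C & \forall n \near \oo,
    exists A : set T, [/\ measurable A, (P A <= delta%:E)%E &
      [set w | C * r n < `|Z n w|] `<=` A].

Definition mean_element (m : nat) (D : set 'rV[R]_m)
    (k : 'rV[R]_m -> 'rV[R]_m -> R) (H : rkhs D k) (X : T -> 'rV[R]_m) : H :=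
  hexpectation (fun w => rkhs_section H (X w)).

Definition sample_mean_element (m : nat) (D : set 'rV[R]_m)
    (k : 'rV[R]_m -> 'rV[R]_m -> R) (H : rkhs D k) (n : nat)
    (x : nat -> 'rV[R]_m) : H :=
  n%:R^-1 *: \sum_(i < n) rkhs_section H (x i).

Section covariance.
Context {p q : nat} {DX : set 'rV[R]_p} {DY : set 'rV[R]_q}.
Context {kX : 'rV[R]_p -> 'rV[R]_p -> R} {kY : 'rV[R]_q -> 'rV[R]_q -> R}.
Variables (HX : rkhs DX kX) (HY : rkhs DY kY).

Definition cov_op (X : T -> 'rV[R]_p) (Y : T -> 'rV[R]_q) : HY -> HX :=
  op_expectation (fun w =>
    tensor (rkhs_section HX (X w) - mean_element HX X)
           (rkhs_section HY (Y w) - mean_element HY Y)).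

Definition sample_cov_op (n : nat) (x : nat -> 'rV[R]_p)
    (y : nat -> 'rV[R]_q) : HY -> HX :=
  fun g => n%:R^-1 *: \sum_(i < n)
    tensor (rkhs_section HX (x i) - sample_mean_element HX n x)
           (rkhs_section HY (y i) - sample_mean_element HY n y) g.

End covariance.

Definition dense_in_L2_mod_constants (m : nat) (D : set 'rV[R]_m)
    (k : 'rV[R]_m -> 'rV[R]_m -> R) (H : rkhs D k) (X : T -> 'rV[R]_m) :
    Prop :=
  forall f : 'rV[R]_m -> R,
    measurable_fun [set: borel R m] (f : borel R m -> R) ->
    P.-integrable [set: T] (EFin \o (fun w => f (X w) ^+ 2)) ->
  exists h : nat -> H,
    ('V_P[fun w => (rkhs_eval (h n) (X w) - f (X w))%R] @[n --> \oo] --> 0)%E.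

Definition bounded_continuous_kernel (m : nat) (D : set 'rV[R]_m)
    (k : 'rV[R]_m -> 'rV[R]_m -> R) : Prop :=
  (exists C : R, forall x y, D x -> D y -> `|k x y| <= C) /\
  {within D `*` D, continuous (fun z : 'rV[R]_m * 'rV[R]_m => k z.1 z.2)}.

Definition dominated_conditionals (p q : nat) (X : T -> 'rV[R]_p)
    (Y : T -> 'rV[R]_q) (DY : set 'rV[R]_q) : Prop :=
  exists (PXY : R.-pker (borel R q) ~> (borel R p))
         (nu : {sigma_finite_measure set (borel R p) -> \bar R}),
    (forall (A : set (borel R p)) (B : set (borel R q)),
       measurable A -> measurable B ->
       P (X @^-1` A `&` Y @^-1` B) = (\int[P]_(w in Y @^-1` B) PXY (Y w) A)%E) /\
    (forall y : borel R q, DY y -> PXY y `<< nu).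

Definition minimal_sufficient_predictors (p q : nat) (DX : set 'rV[R]_p)
    (kX : 'rV[R]_p -> 'rV[R]_p -> R) (HX : rkhs DX kX)
    (X : T -> 'rV[R]_p) (Y : T -> 'rV[R]_q) (dim : nat) : Prop :=
  let sigma m (f : 'I_m -> HX) :=
    sigma_of (fun i w => rkhs_eval (f i) (X w)) in
  exists f : 'I_dim -> HX,
    cond_indep X Y (sigma dim f) /\
    forall (dim' : nat) (g : 'I_dim' -> HX),
      cond_indep X Y (sigma dim' g) -> sigma dim f `<=` sigma dim' g.

End probability_notions.
Arguments cov_op {d T R} P {p q DX DY kX kY} HX HY X Y _.
Arguments sample_cov_op {R p q DX DY kX kY} HX HY n x y _.

(* lam_j is of exact order (j+1)^(-alpha); indices start at 0. *)
Definition polynomial_eigenvalue_decay (R : realType) (H : hilbert R)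
    (A : H -> H) (alpha : R) : Prop :=
  exists lam e, [/\ spectral_decomposition A lam e,
    forall j, lam j.+1 <= lam j,
    forall j, 0 < lam j &
    exists C : R, forall j,
      lam j / (j.+1%:R `^ (- alpha)) <= C /\
      (j.+1%:R `^ (- alpha)) / lam j <= C].

Definition rate (R : realType) (alpha beta : R) (eps : nat -> R) (n : nat) : R :=
  n%:R `^ (- (1 / 2)) * eps n `^ (Num.min beta 1 - 1)
  + eps n `^ (Num.min beta 1)
  + n%:R^-1 * eps n `^ (- ((3 * alpha + 1) / (2 * alpha)))
  + n%:R `^ (- (1 / 2)) * eps n `^ (- ((alpha + 1) / (2 * alpha))).

(* Main.v *)
Require Import Defs.
From HB Require Import structures.
From mathcomp Require Import all_boot all_order all_algebra.
From mathcomp Require Import all_classical all_reals all_analysis.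
From mathcomp Require Import measurable_realfun.
From mathcomp Require Import ring lra.

(** Write S and SXY for the population covariance operators, Sh and SXYh for their
    sample versions, C = Sh + eps, A = (S + eps)^-1, R for the bounded operator with
    S R = SXY, and Rh = C^-1 SXYh.  With T = S^(1/2) R and Th = C^(-1/2) SXYh the two
    eigenproblems are those of T T^* and Th Th^*.  They are moved to the other space:
    if phi_j and phih_j are the unit eigenvectors of T^* T = SXY^* R and of
    Th^* Th = SXYh^* Rh, with eigenvalues lam_j and lamh_j, then
      eta_j = R phi_j / sqrt lam_j   and   etah_j = Rh phih_j / sqrt lamh_j.
    No square root of an operator is left in these formulas, so that a bound on
    Rh - R in norm is almost all that is needed.

    The error of Rh.  By [resolvent_bound],
      Rh - R = (1 - C^-1 (Sh - S)) A z - eps A R,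
    where z collects the sampling errors of SXYh and Sh.  The bias eps A R is
    O(eps^(min(beta, 1))) by the source condition ([source_condition]).  The operators
    A (SXYh - SXY) and A (Sh - S) are bounded by their Hilbert-Schmidt norms, whose
    second moments are at most a constant times n^-1 tr (A S A)
    ([cov_concentration], [covariance_event]), and the decay of the eigenvalues gives
    tr (A S A) = O(eps^(-(alpha + 1) / alpha)) ([trace_sum_bound]).  The factor
    C^-1 (Sh - S) has norm O_p(n^(-1/2) / eps).  The sum of these contributions is
    O_p(r_n), whether or not r_n tends to 0.

    Eigenvectors ([deterministic_bound]).  Expanding |C^(1/2) R u - Th u|^2 >= 0 shows
    that |Th u|^2 >= |T u|^2 - o(1) |u|^2, so that lamh_j is bounded away from 0 with
    large probability; the lam_j are positive because T has rank d
    ([rank_pos_eigenvalues]).  Where r_n is bounded below, this already gives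
    |etah_j| = O(1 + |Rh|) = O_p(r_n).  Where r_n is small, Weyl's inequality and the
    spectral gaps give lamh_j - lam_j and phih_j - t phi_j of order r_n for some sign t
    ([minmax_compare], [eigenvector_perturbation]).  Finally
    psih_j - t psi_j = C^(1/2) (etah_j - t eta_j) + t (C^(1/2) - S^(1/2)) eta_j is small
    by strong continuity of the square root ([sqrt_strong]), and therefore t is the
    sign of <psih_j, psi_j>.

    Expectations of random vectors and operators are weak, so second moments are
    computed coordinatewise in a complete sequence, which exists because a continuous
    kernel on a subset of R^m has a separable space ([rkhs_parseval]). *)

Set Implicit Arguments.
Unset Strict Implicit.
Unset Printing Implicit Defensive.

Import Order.TTheory GRing.Theory Num.Theory.
Import numFieldNormedType.Exports.

Local Open Scope classical_set_scope.
Local Open Scope ring_scope.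

(** * Inner products, bounded operators and Riesz representation *)

Section InnerProduct.
Variables (R : realType) (H : hilbert R).
Implicit Types (u v w : H) (a b : R).

Lemma innerC u v : inner u v = inner v u.
Proof.
by rewrite /inner hermitian_subproof expr0 mul1r.
Qed.

Lemma innerDr u v w : inner u (v + w) = inner u v + inner u w.
Proof. exact: linearDr. Qed.
Lemma innerDl u v w : inner (v + w) u = inner v u + inner w u.
Proof. by rewrite innerC innerDr !(innerC u). Qed.
Lemma innerZr a u v : inner u (a *: v) = a * inner u v.
Proof. by rewrite /inner linearZr_LR. Qed.
Lemma innerZl a u v : inner (a *: u) v = a * inner u v.
Proof. by rewrite innerC innerZr innerC. Qed.
Lemma innerNr u v : inner u (- v) = - inner u v.
Proof. by rewrite -scaleN1r innerZr mulN1r. Qed.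
Lemma innerNl u v : inner (- u) v = - inner u v.
Proof. by rewrite innerC innerNr innerC. Qed.
Lemma innerBr u v w : inner u (v - w) = inner u v - inner u w.
Proof. by rewrite innerDr innerNr. Qed.
Lemma innerBl u v w : inner (v - w) u = inner v u - inner w u.
Proof. by rewrite innerDl innerNl. Qed.
Lemma inner0r u : inner u 0 = 0.
Proof. by rewrite -(scale0r 0) innerZr mul0r. Qed.
Lemma inner0l u : inner 0 u = 0.
Proof. by rewrite innerC inner0r. Qed.

Definition innerE := (innerDr, innerDl, innerBr, innerBl, innerNr, innerNl,
  innerZr, innerZl, inner0r, inner0l).

Lemma inner_sumr I (r : seq I) (P : pred I) (F : I -> H) u :
  inner u (\sum_(i <- r | P i) F i) = \sum_(i <- r | P i) inner u (F i).
Proof.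
apply: (big_morph (inner u)); [exact: innerDr | exact: inner0r].
Qed.

Lemma inner_suml I (r : seq I) (P : pred I) (F : I -> H) u :
  inner (\sum_(i <- r | P i) F i) u = \sum_(i <- r | P i) inner (F i) u.
Proof. by rewrite innerC inner_sumr; apply: eq_bigr => i _; rewrite innerC. Qed.

Lemma inner_norm u : inner u u = `|u| ^+ 2.
Proof. exact: hilbert_normE. Qed.

Lemma inner_ge0 u : 0 <= inner u u.
Proof. by rewrite inner_norm sqr_ge0. Qed.

Lemma inner_eq0 u : (inner u u = 0) -> u = 0.
Proof.
by rewrite inner_norm => /eqP; rewrite sqrf_eq0 normr_eq0 => /eqP.
Qed.

Lemma inner_inj u v : (forall w, inner u w = inner v w) -> u = v.
Proof.
move=> uv; apply/eqP; rewrite -subr_eq0; apply/eqP/inner_eq0.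
by rewrite innerBl uv subrr.
Qed.

Lemma Cauchy_Schwarz u v : `|inner u v| <= `|u| * `|v|.
Proof.
have [->|v0] := eqVneq v 0; first by rewrite inner0r !normr0 mulr0.
rewrite -(@ler_pXn2r _ 2) ?nnegrE ?mulr_ge0// exprMn -normrX.
rewrite ger0_norm ?sqr_ge0//.
have vp : 0 < inner v v by rewrite inner_norm exprn_gt0// normr_gt0.
have := inner_ge0 (inner v v *: u - inner u v *: v).
rewrite !innerE (innerC v u) => h.
have {h}: 0 <= inner v v * (inner u u * inner v v - inner u v ^+ 2).
  by move: h; congr (0 <= _); ring.
by rewrite pmulr_rge0// subr_ge0 -!inner_norm.
Qed.

Lemma normB_sqr u v : `|u - v| ^+ 2 = `|u| ^+ 2 - 2 * inner u v + `|v| ^+ 2.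
Proof. by rewrite -!inner_norm !innerE (innerC v u); ring. Qed.

Lemma inner_cvgl {T} {F : set_system T} {FF : Filter F} (f : T -> H) u v :
  f @ F --> u -> (fun t => inner (f t) v) @ F --> inner u v.
Proof.
move=> fu; apply/cvgrPdist_lt => e e0; near=> t.
rewrite -innerBl (le_lt_trans (Cauchy_Schwarz _ _))//.
have v0 : 0 < `|v| + 1 by rewrite ltr_wpDl.
rewrite (@le_lt_trans _ _ (`|u - f t| * (`|v| + 1)))//.
  by rewrite ler_wpM2l// lerDl.
rewrite -ltr_pdivlMr//; near: t.
by move/cvgrPdist_lt : fu; apply; rewrite divr_gt0.
Unshelve. all: by end_near. Qed.

End InnerProduct.
Arguments inner_cvgl {R H T F FF f u} v _.

Section LinearMaps.
Variables (R : realType) (H K : hilbert R) (A : H -> K) (lA : linear A).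
Lemma linD u v : A (u + v) = A u + A v.
Proof. by have := lA 1 u v; rewrite !scale1r. Qed.
Lemma lin0 : A 0 = 0.
Proof. by apply: (@addrI _ (A 0)); rewrite -linD !addr0. Qed.
Lemma linZ a u : A (a *: u) = a *: A u.
Proof. by have := lA a u 0; rewrite lin0 !addr0. Qed.
Lemma linN u : A (- u) = - A u.
Proof. by rewrite -scaleN1r linZ scaleN1r. Qed.
Lemma linB u v : A (u - v) = A u - A v.
Proof. by rewrite linD linN. Qed.
Lemma lin_sum I (r : seq I) (P : pred I) (F : I -> H) :
  A (\sum_(i <- r | P i) F i) = \sum_(i <- r | P i) A (F i).
Proof. apply: (big_morph A); [exact: linD | exact: lin0]. Qed.
End LinearMaps.

Lemma bounded_pos (R : realType) (H K : hilbert R) (A : H -> K) :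
  bounded_operator A -> exists2 C : R, 0 < C & forall u, `|A u| <= C * `|u|.
Proof.
move=> [_ [C AC]]; exists (`|C| + 1); first by rewrite ltr_wpDl.
move=> u; apply: le_trans (AC u) _; rewrite ler_wpM2r//.
by rewrite (le_trans (ler_norm C))// lerDl.
Qed.

Lemma bounded_cvg (R : realType) (H K : hilbert R) (A : H -> K) :
  bounded_operator A -> continuous A.
Proof.
move=> bA u; have [C C0 AC] := bounded_pos bA.
apply/cvgrPdist_lt => e e0; near=> v.
rewrite -(linB bA.1) (le_lt_trans (AC _))// mulrC -ltr_pdivlMr//.
near: v; have /cvgrPdist_lt : v @[v --> u] --> u by [].
by apply; rewrite divr_gt0.
Unshelve. all: by end_near. Qed.

Lemma cauchy_seq_cvg (R : realType) (H : completeNormedModType R) (u : nat -> H) :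
  (forall e : R, 0 < e -> exists N, forall m n, (N <= m)%N -> (N <= n)%N ->
     `|u m - u n| <= e) -> cvgn u.
Proof.
move=> cu; apply/cauchy_cvgP/cauchy_exP => e e0.
have [N uN] := cu (e / 2) (divr_gt0 e0 (ltr0n _ 2)).
exists (u N), N => // n /= Nn; rewrite -ball_normE /ball_ /=.
apply: le_lt_trans (uN _ _ (leqnn _) Nn) _.
by rewrite ltr_pdivrMr// ltr_pMr// ltr1n.
Qed.

Lemma eps_inv_ex (R : realType) (e : R) : 0 < e ->
  exists N, forall n, (N <= n)%N -> (n.+1%:R)^-1 <= e.
Proof.
move=> e0; exists (Num.truncn e^-1) => n Nn.
rewrite -(invrK e) lef_pV2 ?posrE ?invr_gt0//.
apply: ltW; apply: lt_le_trans (truncnS_gt _) _.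
by rewrite ler_nat.
Qed.

Definition self_adjoint (R : realType) (H : hilbert R) (B : H -> H) :=
  forall u v, inner (B u) v = inner u (B v).

(** The functional <B u, u> - 2 L u is bounded below and, by the parallelogram
    identity for the form of B, its minimizing sequences are Cauchy; the limit
    solves the Euler equation.  With B the identity this is Riesz representation,
    and with L = <v, .> it inverts a coercive operator. *)
Lemma lax_milgram (R : realType) (H : hilbert R) (B : H -> H) (c CL : R)
    (L : H -> R) : bounded_operator B -> self_adjoint B -> 0 < c ->
  (forall u, c * `|u| ^+ 2 <= inner (B u) u) ->
  (forall a u v, L (a *: u + v) = a * L u + L v) ->
  (forall u, `|L u| <= CL * `|u|) ->
  exists w, forall u, inner (B w) u = L u.
Proof.
move=> bB sB c0 cB lL bL.
have lB := bB.1.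
have LD u v : L (u + v) = L u + L v by have := lL 1 u v; rewrite scale1r mul1r.
have L0 : L 0 = 0 by apply: (@addrI _ (L 0)); rewrite -LD !addr0.
have LZ a u : L (a *: u) = a * L u by have := lL a u 0; rewrite L0 !addr0.
have LB u v : L (u - v) = L u - L v by rewrite -scaleN1r LD LZ mulN1r.
pose J u := inner (B u) u - 2 * L u.
have JB u : - (CL ^+ 2 / c) <= J u.
  have h1 : L u <= CL * `|u| := le_trans (ler_norm _) (bL u).
  apply: (@le_trans _ _ (c * `|u| ^+ 2 - 2 * (CL * `|u|))).
    have -> : c * `|u| ^+ 2 - 2 * (CL * `|u|) =
      c * (`|u| - CL / c) ^+ 2 - CL ^+ 2 / c by field; rewrite gt_eqF.
    by rewrite lerDr mulr_ge0 ?sqr_ge0// ltW.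
  by rewrite /J lerB// ler_wpM2l.
have hinf : has_inf (range J).
  by split; [exists (J 0), 0 | exists (- (CL ^+ 2 / c)) => _ [u _ <-]].
set m := inf (range J).
have mJ u : m <= J u by apply: (ge_inf hinf.2); exists u.
have /choice[u uP] : forall n : nat, exists u, J u <= m + n.+1%:R^-1.
  have h0 n : 0 < n.+1%:R^-1 :> R by rewrite invr_gt0.
  move=> n; have [_ [v _ <-] vm] := inf_adherent (eps := n.+1%:R^-1) (h0 n) hinf.
  by exists v; exact: ltW.
have par v w : c * `|v - w| ^+ 2 <= 2 * (J v + J w - 2 * m).
  have : m <= J (2^-1 *: (v + w)) by [].
  have := cB (v - w).
  rewrite /J !(linZ lB) (linB lB) (linD lB) !LZ !LD !innerE.
  rewrite (innerC (B w) v) -sB => h1 h2.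
  set x := inner (B v) v in h1 h2 *; set y := inner (B w) w in h1 h2 *.
  set z := inner (B v) w in h1 h2 *; lra.
have /cvg_ex[w uw] : cvgn u.
  apply: cauchy_seq_cvg => e e0.
  have e'0 : 0 < c * e ^+ 2 / 4 by rewrite divr_gt0// mulr_gt0// exprn_gt0.
  have [N hN] := eps_inv_ex e'0; exists N => i j /hN hi /hN hj.
  rewrite -(@ler_pXn2r _ 2) ?nnegrE ?(ltW e0)// -(ler_pM2l c0).
  apply: le_trans (par _ _) _.
  move: (uP i) (uP j) hi hj; move: (J (u i)) (J (u j)) (i.+1%:R^-1) (j.+1%:R^-1).
  by move: (c * e ^+ 2) => E a b c' d'; clearbody m; clear; lra.
exists w => v; apply/eqP; rewrite -subr_eq0; apply/eqP.
set q := inner (B v) v.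
have q0 : 0 <= q.
  by apply: le_trans (cB v); rewrite mulr_ge0 ?sqr_ge0// ltW.
have gn n : (inner (B (u n)) v - L v) ^+ 2 <= (q + 1) * n.+1%:R^-1.
  set g := _ - _.
  have := le_trans (uP n) (lerD (mJ (u n - (g / (q + 1)) *: v)) (lexx _)).
  rewrite /J (linB lB) (linZ lB) LB LZ !innerE.
  rewrite (innerC (B v)) -sB -/q.
  have -> : inner (B (u n)) v = g + L v by rewrite /g subrK.
  set x := inner (B (u n)) (u n); set y := L (u n); set z := L v.
  have q1 : 0 < q + 1 by rewrite ltr_wpDl.
  rewrite -subr_ge0 => h.
  (* comparison of J at u_n with J at u_n - (g / (q + 1)) v *)
  have h2 : g ^+ 2 / (q + 1) <= n.+1%:R^-1 + (q / (q+1) - 1) * (g ^+ 2 / (q + 1)).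
    rewrite -subr_ge0; move: h; move: (n.+1%:R^-1) => dn.
    by congr (0 <= _); field; rewrite gt_eqF.
  rewrite mulrC -ler_pdivrMr//; apply: le_trans h2 _.
  rewrite gerDl mulr_le0_ge0//; last by rewrite divr_ge0 ?sqr_ge0// ltW.
  by rewrite subr_le0 ler_pdivrMr// mul1r lerDl.
have glim : (inner (B (u n)) v - L v) ^+ 2 @[n --> \oo] -->
    (inner (B w) v - L v) ^+ 2.
  have h : inner (B (u n)) v - L v @[n --> \oo] --> inner (B w) v - L v.
    apply: cvgB; last exact: cvg_cst.
    apply: (inner_cvgl v); apply: (cvg_comp u B uw).
    exact: bounded_cvg.
  by apply: cvgM.
have rlim : (q + 1) * n.+1%:R^-1 @[n --> \oo] --> (0 : R).
  rewrite -(mulr0 (q + 1)); apply: cvgM; first exact: cvg_cst.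
  exact: cvg_harmonic.
have : (inner (B w) v - L v) ^+ 2 <= 0.
  apply: (ler_cvg_to glim rlim); exact: nearW.
by rewrite le_eqVlt ltNge sqr_ge0 orbF sqrf_eq0 => /eqP.
Qed.

Lemma bounded_id (R : realType) (H : hilbert R) : bounded_operator (@id H).
Proof. by split=> //; exists 1 => u; rewrite mul1r. Qed.

Lemma riesz (R : realType) (H : hilbert R) (CL : R) (L : H -> R) :
  (forall a u v, L (a *: u + v) = a * L u + L v) ->
  (forall u, `|L u| <= CL * `|u|) ->
  exists w, forall u, inner w u = L u.
Proof.
apply: lax_milgram; [exact: bounded_id | by [] | exact: ltr01 |].
by move=> u; rewrite mul1r inner_norm.
Qed.

Lemma adjointP (R : realType) (H K : hilbert R) (A : H -> K) :
  bounded_operator A -> forall u v, inner (A u) v = inner u (adjoint A v).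
Proof.
move=> bA u v; rewrite /adjoint; case: xgetP => [y _ /(_ u)//|].
have [w wP] : exists w, forall u, inner w u = inner (A u) v.
  have [C _ AC] := bounded_pos bA.
  apply: (@riesz _ _ (C * `|v|)) => [a x y|x].
    by rewrite bA.1 !innerE.
  apply: le_trans (Cauchy_Schwarz _ _) _.
  by rewrite mulrAC ler_wpM2r.
by move=> /(_ w) []; move=> x; rewrite /= (innerC x) wP.
Qed.

(** * Square roots of coercive operators *)

Section SquareRoot.
Variables (R : realType) (H : hilbert R).

Definition is_sqrt (A B : H -> H) :=
  [/\ bounded_operator B, self_adjoint B, forall u, 0 <= inner (B u) u &
      forall u, B (B u) = A u].

Lemma op_sqrtP (A : H -> H) : (exists B, is_sqrt A B) -> is_sqrt A (op_sqrt A).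
Proof. by move=> [B BP]; rewrite /op_sqrt; case: xgetP => [//|/(_ B) []]. Qed.

Lemma le_sqr_norm (u : H) (C : R) : 0 <= C -> `|u| ^+ 2 <= C ^+ 2 -> `|u| <= C.
Proof. by move=> C0; rewrite ler_pXn2r ?nnegrE. Qed.

Lemma cvg_norm_le (K : hilbert R) (u : nat -> K) (v : K) (C : R) :
  u @ \oo --> v -> (forall n, `|u n| <= C) -> `|v| <= C.
Proof.
move=> uv uC; have h : `|u n| @[n --> \oo] --> `|v| by exact: cvg_norm.
by apply: (ler_cvg_to h (cvg_cst C)); exact: nearW.
Qed.

Section iteration.
Variables (T : H -> H) (q : R).
Hypotheses (lT : linear T) (sT : self_adjoint T) (q0 : 0 <= q) (q1 : q < 1).
Hypothesis Tq : forall u, `|T u| <= q * `|u|.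

(** Successive approximations to the solution of Y = (T + Y^2) / 2, which is
    the equation (1 - Y)^2 = 1 - T; on operators of norm at most q < 1 they
    contract with ratio q. *)
Fixpoint sqrt_iter n : H -> H :=
  if n is m.+1 then fun u => 2^-1 *: (T u + sqrt_iter m (sqrt_iter m u))
  else fun=> 0.

Local Notation Y := sqrt_iter.

Lemma sqrt_iter_linear n : linear (Y n).
Proof.
elim: n => [|n IH] a u v /=; first by rewrite scaler0 addr0.
by rewrite !IH lT; rewrite !scalerDr !scalerA (mulrC a) addrACA.
Qed.

Lemma sqrt_iter_self_adjoint n : self_adjoint (Y n).
Proof.
elim: n => [|n IH] u v /=; first by rewrite !innerE.
by rewrite !innerE sT !IH.
Qed.

Lemma sqrt_iter_le n u : `|Y n u| <= q * `|u|.
Proof.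
elim: n u => [|n IH] u /=; first by rewrite normr0 mulr_ge0.
rewrite normrZ ger0_norm ?invr_ge0// mulrC ler_pdivrMr//.
apply: le_trans (ler_normD _ _) _.
have h : `|Y n (Y n u)| <= q * `|u|.
  apply: le_trans (IH _) _; rewrite ler_wpM2l//; apply: le_trans (IH _) _.
  by rewrite ler_piMl// ltW.
by rewrite mulr_natr mulr2n lerD.
Qed.

Lemma sqrt_iter_step n u : `|Y n.+1 u - Y n u| <= q ^+ n * `|u|.
Proof.
elim: n u => [|n IH] u.
  rewrite /= !addr0 subr0 expr0 normrZ ger0_norm ?invr_ge0// mulrC ler_pdivrMr//.
  apply: le_trans (Tq u) _; rewrite mul1r mulrC ler_wpM2l//.
  by rewrite (le_trans (ltW q1))// ler1n.
rewrite [X in `|X - _|]/= [X in `|_ - X|]/= -scalerBr addrAC opprD addrA subrr add0r.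
rewrite normrZ ger0_norm ?invr_ge0// mulrC ler_pdivrMr// addrC.
have lY := sqrt_iter_linear.
have -> : Y n.+1 (Y n.+1 u) - Y n (Y n u) =
  Y n.+1 (Y n.+1 u - Y n u) + (Y n.+1 (Y n u) - Y n (Y n u)).
  by rewrite (linB (lY n.+1)) addrA subrK.
apply: le_trans (ler_normD _ _) _; rewrite mulr_natr mulr2n; apply: lerD.
  by apply: le_trans (sqrt_iter_le _ _) _; rewrite exprS -mulrA ler_wpM2l.
apply: le_trans (IH _) _; rewrite exprSr -mulrA ler_wpM2l ?exprn_ge0//.
exact: sqrt_iter_le.
Qed.

Lemma sqrt_iter_tail n k u : `|Y (n + k) u - Y n u| <= q ^+ n / (1 - q) * `|u|.
Proof.
have q1' : 0 < 1 - q by rewrite subr_gt0.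
have -> : Y (n + k) u - Y n u = \sum_(i < k) (Y (n + i).+1 u - Y (n + i) u).
  elim: k => [|k IH]; first by rewrite addn0 subrr big_ord0.
  by rewrite big_ord_recr /= -IH addnS addrC addrA subrK.
apply: le_trans (ler_norm_sum _ _ _) _.
apply: (@le_trans _ _ (\sum_(i < k) (q ^+ n * `|u| * q ^+ i))).
  apply: ler_sum => i _; apply: le_trans (sqrt_iter_step _ _) _.
  by rewrite exprD mulrAC.
rewrite -mulr_sumr [X in _ <= X]mulrAC ler_wpM2l ?mulr_ge0 ?exprn_ge0//.
rewrite -[X in _ <= X]mul1r ler_pdivlMr// mulrC.
have -> : (1 - q) * (\sum_(i < k) q ^+ i) = 1 - q ^+ k.
  by rewrite -opprB -[RHS]opprB subrX1 mulNr.
by rewrite gerBl exprn_ge0.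
Qed.

Lemma sqrt_iter_cauchy (e : R) u : 0 < e ->
  exists N, forall n k, (N <= n)%N -> `|Y (n + k) u - Y n u| <= e.
Proof.
move=> e0.
have h : q ^+ n * ((1 - q)^-1 * `|u|) @[n --> \oo] --> 0 * ((1 - q)^-1 * `|u|).
  apply: cvgM; last exact: cvg_cst.
  by apply: cvg_expr; rewrite ger0_norm.
rewrite mul0r in h.
move/cvgrPdist_lt : h => /(_ e e0)[N _ hN]; exists N => n k Nn.
apply: le_trans (sqrt_iter_tail _ _ _) _.
have := hN n Nn; rewrite /= sub0r normrN mulrA => /ltW.
by apply: le_trans; exact: ler_norm.
Qed.

Lemma sqrt_iter_lim : exists Y0 : H -> H, [/\ linear Y0, self_adjoint Y0,
  forall u, `|Y0 u| <= q * `|u| & forall u, Y0 u = 2^-1 *: (T u + Y0 (Y0 u))].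
Proof.
have cY u : cvgn (fun n => Y n u).
  apply: cauchy_seq_cvg => e e0.
  have [N hN] := sqrt_iter_cauchy u (divr_gt0 e0 (ltr0n _ 2)).
  exists N => m n Nm Nn.
  rewrite -(subnKC Nm) -(subnKC Nn).
  rewrite (_ : _ - _ = (Y (N + (m - N)) u - Y N u) - (Y (N + (n - N)) u - Y N u)).
    apply: le_trans (ler_normB _ _) _.
    by rewrite [e]splitr lerD// hN.
  by rewrite opprB addrA subrK.
pose Y0 u := limn (fun n => Y n u).
have YY u : Y n u @[n --> \oo] --> Y0 u by exact: cY.
have lY := sqrt_iter_linear.
have Y0q u : `|Y0 u| <= q * `|u|.
  by apply: (cvg_norm_le (YY u)) => n; exact: sqrt_iter_le.
have lY0 : linear Y0.
  move=> a u v; apply: (cvg_unique _ (YY (a *: u + v))) => //.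
  have -> : (fun n => Y n (a *: u + v)) = (fun n => a *: Y n u + Y n v).
    by apply/funext => n; rewrite lY.
  apply: cvgD; last exact: YY.
  by apply: cvgZ; [exact: cvg_cst | exact: YY].
exists Y0; split => // [u v|u].
  have h1 : inner (Y n u) v @[n --> \oo] --> inner (Y0 u) v by exact: (inner_cvgl v (@YY u)).
  apply: (cvg_unique _ h1) => //.
  rewrite (_ : (fun n => _) = (fun n => inner (Y n v) u)).
    by rewrite innerC; exact: (inner_cvgl u (@YY v)).
  by apply/funext => n; rewrite sqrt_iter_self_adjoint innerC.
have h1 : Y n.+1 u @[n --> \oo] --> Y0 u by rewrite (cvg_shiftS (fun n => Y n u)).
apply: (cvg_unique _ h1) => //.
apply: cvgZ; first exact: cvg_cst.
apply: cvgD; first exact: cvg_cst.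
have -> : (fun n => Y n (Y n u)) = (fun n => Y n (Y n u - Y0 u) + Y n (Y0 u)).
  by apply/funext => n; rewrite -(linD (lY n)) subrK.
rewrite -[X in _ --> X]add0r; apply: cvgD; last exact: YY.
apply/norm_cvg0P.
have h : q * `|Y n u - Y0 u| @[n --> \oo] --> (0 : R).
  rewrite -(mulr0 q); apply: cvgM; first exact: cvg_cst.
  rewrite -(@normr0 _ H); apply: cvg_norm; rewrite -(subrr (Y0 u)).
  by apply: cvgB; [exact: YY | exact: cvg_cst].
apply: (squeeze_cvgr _ (cvg_cst 0) h).
by apply: nearW => n; rewrite normr_ge0 sqrt_iter_le.
Qed.
End iteration.

(** With s = c / M'^2 the operator T = 1 - s A has norm at most
    sqrt (1 - c^2 / M'^2) < 1, so that s A = (1 - Y)^2 for the limit Y of the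
    successive approximations, and 1 - Y is positive because Y is a contraction. *)
Lemma coercive_sqrt (A : H -> H) (c : R) : bounded_operator A ->
  self_adjoint A -> 0 < c -> (forall u, c * `|u| ^+ 2 <= inner (A u) u) ->
  exists B, is_sqrt A B.
Proof.
move=> bA sA c0 cA; have [M M0 AM] := bounded_pos bA.
have lA := bA.1.
pose M' := M + c; have M'0 : 0 < M' by rewrite addr_gt0.
have AM' u : `|A u| <= M' * `|u|.
  by apply: le_trans (AM u) _; rewrite ler_wpM2r// lerDl ltW.
pose s := c / M' ^+ 2; pose T u := u - s *: A u.
have s0 : 0 < s by rewrite divr_gt0// exprn_gt0.
have t0 : 0 <= 1 - c ^+ 2 / M' ^+ 2.
  rewrite subr_ge0 ler_pdivrMr ?exprn_gt0// mul1r ler_pXn2r ?nnegrE ?ltW//.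
  by rewrite ltrDr.
pose q := Num.sqrt (1 - c ^+ 2 / M' ^+ 2).
have q0 : 0 <= q by exact: sqrtr_ge0.
have q1 : q < 1.
  rewrite -sqrtr1 ltr_sqrt// gtrBl divr_gt0// exprn_gt0//.
have lT : linear T.
  by move=> a u v; rewrite /T lA scalerBr !scalerDr !scalerA (mulrC s) opprD addrACA.
have sT : self_adjoint T by move=> u v; rewrite /T !innerE sA.
have Tq u : `|T u| <= q * `|u|.
  apply: le_sqr_norm; first by rewrite mulr_ge0.
  rewrite exprMn sqr_sqrtr// /T normB_sqr normrZ exprMn (ger0_norm (ltW s0)) innerZr.
  have h1 := cA u; rewrite -sA.
  have h2 : `|A u| ^+ 2 <= M' ^+ 2 * `|u| ^+ 2.
    by rewrite -exprMn ler_pXn2r ?nnegrE// mulr_ge0// ltW.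
  have h3 : s * (c * `|u| ^+ 2) <= s * inner (A u) u by rewrite ler_wpM2l// ltW.
  have h4 : s ^+ 2 * `|A u| ^+ 2 <= s ^+ 2 * (M' ^+ 2 * `|u| ^+ 2).
    by rewrite ler_wpM2l// sqr_ge0.
  have e1 : s ^+ 2 * (M' ^+ 2 * `|u| ^+ 2) = s * (c * `|u| ^+ 2).
    by rewrite /s; field; rewrite gt_eqF.
  have e2 : (1 - c ^+ 2 / M' ^+ 2) * `|u| ^+ 2 = `|u| ^+ 2 - s * (c * `|u| ^+ 2).
    by rewrite /s; field; rewrite gt_eqF.
  rewrite e2; rewrite e1 in h4; lra.
have [Y [lY sY Yq YE]] := sqrt_iter_lim lT sT q0 q1 Tq.
pose r := Num.sqrt s^-1; have r2 : r * r = s^-1.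
  by rewrite -expr2 sqr_sqrtr// invr_ge0 ltW.
have r0 : 0 <= r by exact: sqrtr_ge0.
have lB : linear (fun u => r *: (u - Y u)).
  move=> a u v; rewrite lY opprD addrACA -scalerBr scalerDr !scalerA.
  by rewrite (mulrC a).
exists (fun u => r *: (u - Y u)); split.
- split=> //; exists (r * (1 + q)) => u.
  rewrite normrZ ger0_norm// -mulrA ler_wpM2l// mulrDl mul1r.
  by apply: le_trans (ler_normB _ _) _; rewrite lerD2l.
- by move=> u v; rewrite !innerE sY.
- move=> u; rewrite innerZl mulr_ge0// innerBl subr_ge0.
  apply: le_trans (ler_norm _) _; apply: le_trans (Cauchy_Schwarz _ _) _.
  rewrite inner_norm expr2 ler_wpM2r//; apply: le_trans (Yq u) _.
  by rewrite ler_piMl// ltW.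
- move=> u; rewrite (linZ lY) -scalerBr scalerA r2 (linB lY).
  have e : Y (Y u) = Y u *+ 2 - T u.
    have /(congr1 (fun v => v *+ 2)) := YE u.
    rewrite -(scaler_nat 2 (2^-1 *: _)) scalerA mulfV ?pnatr_eq0// scale1r => ->.
    by rewrite addrC addKr.
  have -> : u - Y u - (Y u - Y (Y u)) = s *: A u.
    by apply: inner_inj => w; rewrite e mulr2n /T !innerE; ring.
  by rewrite scalerA mulVf ?gt_eqF// scale1r.
Qed.

Lemma coercive_op_invP (A : H -> H) (c : R) : bounded_operator A ->
  self_adjoint A -> 0 < c -> (forall u, c * `|u| ^+ 2 <= inner (A u) u) ->
  forall v, A (op_inv A v) = v.
Proof.
move=> bA sA c0 cA v; rewrite /op_inv; case: xgetP => [//|].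
have [w wP] : exists w, forall u, inner (A w) u = inner v u.
  apply: (lax_milgram (CL := `|v|) bA sA c0 cA) => [a x y|x].
    by rewrite !innerE.
  exact: Cauchy_Schwarz.
by move=> /(_ w) []; apply: inner_inj.
Qed.

Lemma coercive_inj (A : H -> H) (c : R) : linear A -> 0 < c ->
  (forall u, c * `|u| ^+ 2 <= inner (A u) u) -> injective A.
Proof.
move=> lA c0 cA u v uv; apply/eqP; rewrite -subr_eq0 -normr_eq0 -sqrf_eq0.
have := cA (u - v); rewrite (linB lA) uv subrr inner0l pmulr_rle0// => h.
by rewrite eq_le h sqr_ge0.
Qed.

(** A square root B of a bijective A is onto, since v = B (B (A^-1 v)). *)
Lemma coercive_sqrt_inv (A : H -> H) (c : R) : bounded_operator A ->
  self_adjoint A -> 0 < c -> (forall u, c * `|u| ^+ 2 <= inner (A u) u) ->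
  let B := op_sqrt A in
  is_sqrt A B /\ forall v, B (op_inv B v) = v.
Proof.
move=> bA sA c0 cA B.
have BP : is_sqrt A B by apply: op_sqrtP; exact: (coercive_sqrt bA sA c0 cA).
split=> // v; rewrite /op_inv; case: xgetP => [//|/(_ (B (op_inv A v)))[]] /=.
by case: BP => _ _ _ ->; rewrite (coercive_op_invP bA sA c0 cA).
Qed.

End SquareRoot.

(** * Diagonal operators in an orthonormal sequence *)

Section QuasiOrthonormal.
Variables (R : realType) (H : hilbert R).

(** Zero vectors are allowed because Gram-Schmidt produces them on a dependent
    family; Bessel's inequality and Fourier expansions are insensitive to them. *)
Definition quasi_orthonormal (I : eqType) (e : I -> H) :=
  (forall i j, i != j -> inner (e i) (e j) = 0) /\
  (forall i, inner (e i) (e i) = 1 \/ e i = 0).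

Lemma orthonormal_quasi (I : eqType) (e : I -> H) :
  (forall i j, inner (e i) (e j) = (i == j)%:R) -> quasi_orthonormal e.
Proof.
move=> eP; split=> [i j /negPf ij|i]; first by rewrite eP ij.
by left; rewrite eP eqxx.
Qed.

Section finite_sums.
Variables (I : finType) (e : I -> H) (eo : quasi_orthonormal e).

Lemma quasi_sum_inner (c : I -> R) j :
  inner (\sum_i c i *: e i) (e j) = c j * inner (e j) (e j).
Proof.
rewrite inner_suml (bigD1 j)//= innerZl big1 ?addr0// => i ij.
by rewrite innerZl eo.1// mulr0.
Qed.

Lemma quasi_inner_scale u j : inner u (e j) * inner (e j) (e j) = inner u (e j).
Proof. by case: (eo.2 j) => ->; rewrite ?mulr1// inner0r mul0r. Qed.

Lemma quasi_inner_le1 j : 0 <= inner (e j) (e j) <= 1.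
Proof. by rewrite inner_ge0; case: (eo.2 j) => ->; rewrite ?inner0r ?lexx ?ler01. Qed.

Lemma quasi_sum_norm (c : I -> R) :
  `|\sum_i c i *: e i| ^+ 2 <= \sum_i c i ^+ 2.
Proof.
rewrite -inner_norm inner_sumr; apply: ler_sum => i _.
rewrite innerZr quasi_sum_inner mulrA -expr2 ler_piMr ?sqr_ge0//.
by case/andP: (quasi_inner_le1 i).
Qed.

Lemma quasi_residual u :
  `|u - \sum_i inner u (e i) *: e i| ^+ 2 = `|u| ^+ 2 - \sum_i inner u (e i) ^+ 2.
Proof.
set p := \sum_i _.
have up : inner u p = \sum_i inner u (e i) ^+ 2.
  by rewrite inner_sumr; apply: eq_bigr => i _; rewrite innerZr expr2.
have pp : inner p p = \sum_i inner u (e i) ^+ 2.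
  rewrite {2}/p inner_sumr; apply: eq_bigr => i _.
  by rewrite innerZr quasi_sum_inner quasi_inner_scale expr2.
by rewrite normB_sqr -(inner_norm p) up pp; ring.
Qed.

Lemma bessel u : \sum_i inner u (e i) ^+ 2 <= `|u| ^+ 2.
Proof. by rewrite -subr_ge0 -quasi_residual sqr_ge0. Qed.
End finite_sums.

Lemma quasi_orthonormal_comp (I J : eqType) (e : I -> H) (f : J -> I) :
  injective f -> quasi_orthonormal e -> quasi_orthonormal (e \o f).
Proof.
by move=> fi [e1 e2]; split=> [i j ij|i] /=; [apply: e1; rewrite (inj_eq fi)|].
Qed.

Variables (e : nat -> H) (eo : quasi_orthonormal e).

Lemma quasi_ord n : quasi_orthonormal (fun i : 'I_n => e i).
Proof. by apply: (quasi_orthonormal_comp (f := @nat_of_ord n)) => //; exact: val_inj. Qed.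

Lemma bessel_seq n u : \sum_(i < n) inner u (e i) ^+ 2 <= `|u| ^+ 2.
Proof. exact: (bessel (quasi_ord n)). Qed.

Lemma sum_shift_norm (c : nat -> R) m n :
  `|\sum_(j < m + n) c j *: e j - \sum_(j < m) c j *: e j| ^+ 2 <=
  \sum_(j < m + n) c j ^+ 2 - \sum_(j < m) c j ^+ 2.
Proof.
rewrite !big_split_ord/= [X in `|X|]addrC addrA addNr add0r.
rewrite [leRHS]addrC addrA addNr add0r.
apply: (quasi_sum_norm (quasi_orthonormal_comp (f := fun i : 'I_n => (m + i)%N) _ eo)).
by move=> i j /addnI /val_inj.
Qed.

(** The operator sum_j c_j e_j (x) e_j, as a strong limit; for c = lam this is
    the last clause of [spectral_decomposition]. *)
Definition diag_op (c : nat -> R) (D : H -> H) :=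
  forall u, \sum_(j < n) c j *: tensor (e j) (e j) u @[n --> \oo] --> D u.

Lemma sqr_sum_cvg (x : nat -> R) (C : R) :
  (forall n, \sum_(j < n) x j ^+ 2 <= C) ->
  cvgn (fun n => \sum_(j < n) x j ^+ 2).
Proof.
move=> xC; apply: (@nondecreasing_is_cvgn _ (fun n => \sum_(j < n) x j ^+ 2)).
  apply/nondecreasing_seqP => n.
  by rewrite big_ord_recr/= lerDl sqr_ge0.
by exists C => _ [n _ <-].
Qed.

Lemma quasi_series_cvg (x : nat -> R) (C : R) :
  (forall n, \sum_(j < n) x j ^+ 2 <= C) ->
  cvgn (fun n => \sum_(j < n) x j *: e j).
Proof.
move=> xC; have sc := sqr_sum_cvg xC.
apply: cauchy_seq_cvg => eps eps0.
have l := sc; set L := lim _ in l.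
move/cvgrPdist_lt : l => /(_ ((eps / 2) ^+ 2)).
rewrite exprn_gt0 ?divr_gt0// => /(_ isT)[N _ hN].
have nd : nondecreasing_seq (fun n => \sum_(j < n) x j ^+ 2).
  by apply/nondecreasing_seqP => n; rewrite big_ord_recr/= lerDl sqr_ge0.
have h n : (N <= n)%N ->
    `|\sum_(j < n) x j *: e j - \sum_(j < N) x j *: e j| <= eps / 2.
  move=> Nn; apply: le_sqr_norm; first by rewrite divr_ge0// ltW.
  rewrite -(subnKC Nn); apply: le_trans (sum_shift_norm _ _ _) _.
  apply: le_trans (ltW (hN N (leqnn _))).
  apply: le_trans (ler_norm _); rewrite lerB//.
  exact: (nondecreasing_cvgn_le nd sc).
exists N => m n Nm Nn.
rewrite (_ : _ - _ = (\sum_(j < m) x j *: e j - \sum_(j < N) x j *: e j) -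
  (\sum_(j < n) x j *: e j - \sum_(j < N) x j *: e j)).
  by apply: le_trans (ler_normB _ _) _; rewrite [eps]splitr lerD// h.
by rewrite opprB addrA subrK.
Qed.

Lemma diag_term (c : R) j u : c *: tensor (e j) (e j) u = (c * inner u (e j)) *: e j.
Proof. by rewrite /tensor scalerA innerC. Qed.

Lemma diag_sum_sqr (c : nat -> R) (C : R) n u : (forall j, `|c j| <= C) ->
  \sum_(j < n) (c j * inner u (e j)) ^+ 2 <= C ^+ 2 * `|u| ^+ 2.
Proof.
move=> cC; have C0 : 0 <= C by apply: le_trans (cC 0%N).
apply: (@le_trans _ _ (C ^+ 2 * \sum_(j < n) inner u (e j) ^+ 2)).
  rewrite mulr_sumr; apply: ler_sum => j _; rewrite exprMn ler_wpM2r ?sqr_ge0//.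
  by rewrite -(real_normK (num_real (c j))) ler_pXn2r ?nnegrE.
by rewrite ler_wpM2l ?sqr_ge0// bessel_seq.
Qed.

Lemma diag_op_ex (c : nat -> R) (C : R) : (forall j, `|c j| <= C) ->
  exists D, diag_op c D.
Proof.
move=> cC.
exists (fun u => limn (fun n => \sum_(j < n) c j *: tensor (e j) (e j) u)) => u.
suff: cvgn (fun n => \sum_(j < n) c j *: tensor (e j) (e j) u) by [].
rewrite (_ : (fun n => _) = (fun n => \sum_(j < n) (c j * inner u (e j)) *: e j)).
  apply: (@quasi_series_cvg (fun j => c j * inner u (e j)) (C ^+ 2 * `|u| ^+ 2)).
  by move=> n; exact: diag_sum_sqr.
by apply/funext => n; apply: eq_bigr => j _; rewrite diag_term.
Qed.

Section diag_theory.
Variables (c : nat -> R) (D : H -> H) (dD : diag_op c D).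

Lemma diag_op_norm (C : R) u : (forall j, `|c j| <= C) -> `|D u| <= C * `|u|.
Proof.
move=> cC; have C0 : 0 <= C by apply: le_trans (cC 0%N).
apply: (cvg_norm_le (@dD u)) => n; apply: le_sqr_norm; first by rewrite mulr_ge0.
rewrite exprMn.
under eq_bigr do rewrite diag_term.
apply: le_trans (quasi_sum_norm (quasi_ord n) _) _; exact: diag_sum_sqr.
Qed.

Lemma diag_op_inner u v :
  \sum_(j < n) c j * (inner u (e j) * inner v (e j)) @[n --> \oo] --> inner (D u) v.
Proof.
rewrite (_ : (fun n => _) =
  (fun n => inner (\sum_(j < n) c j *: tensor (e j) (e j) u) v)).
  exact: (inner_cvgl v (@dD u)).
apply/funext => n; rewrite inner_suml; apply: eq_bigr => j _.
by rewrite diag_term innerZl (innerC v) mulrA.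
Qed.

Lemma diag_op_self_adjoint : self_adjoint D.
Proof.
move=> u v; apply: (cvg_unique _ (@diag_op_inner u v)) => //.
rewrite innerC (_ : (fun n => _) =
   (fun n => \sum_(j < n) c j * (inner v (e j) * inner u (e j)))).
  exact: diag_op_inner.
by apply/funext => n; apply: eq_bigr => j _; rewrite (mulrC (inner u _)).
Qed.

Lemma diag_op_linear : linear D.
Proof.
move=> a u v; apply: (cvg_unique _ (@dD (a *: u + v))) => //.
rewrite (_ : (fun n => _) = (fun n => a *: (\sum_(j < n) c j *: tensor (e j) (e j) u) +
   \sum_(j < n) c j *: tensor (e j) (e j) v)).
  by apply: cvgD => //; apply: cvgZ => //; exact: cvg_cst.
apply/funext => n; rewrite scaler_sumr -big_split/=; apply: eq_bigr => j _.
by rewrite !diag_term scalerA -scalerDl !innerE; congr (_ *: _); ring.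
Qed.

Lemma diag_op_ge0 u : (forall j, 0 <= c j) -> 0 <= inner (D u) u.
Proof.
move=> c0; have h := @diag_op_inner u u.
apply: (ler_cvg_to (cvg_cst 0) h); apply: nearW => n.
by apply: sumr_ge0 => j _; rewrite mulr_ge0// -expr2 sqr_ge0.
Qed.

Lemma diag_op_vec j : D (e j) = c j *: e j.
Proof.
apply: (cvg_unique _ (@dD (e j))) => //.
apply: cvg_near_cst; exists j.+1 => // n /= jn.
rewrite (bigD1 (Ordinal jn))//= diag_term big1 ?addr0.
  by case: (eo.2 j) => ->; rewrite ?mulr1// !scaler0.
by move=> i ij; rewrite diag_term eo.1 ?mulr0 ?scale0r// eq_sym.
Qed.

Lemma diag_op_coef u j : inner (D u) (e j) = c j * inner u (e j).
Proof. by rewrite diag_op_self_adjoint diag_op_vec innerZr. Qed.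

Lemma diag_op_perp u : (forall j, inner u (e j) = 0) -> D u = 0.
Proof.
move=> u0; apply: (cvg_unique _ (@dD u)) => //.
apply: cvg_near_cst; apply: nearW => n; apply: big1 => j _.
by rewrite diag_term u0 mulr0 scale0r.
Qed.

End diag_theory.

Lemma diag_op_comp c c' D D' : diag_op c D -> diag_op c' D' ->
  diag_op (fun j => c j * c' j) (D \o D').
Proof.
move=> dD dD' u; rewrite (_ : (fun n => _) =
    (fun n => \sum_(j < n) c j *: tensor (e j) (e j) (D' u))); first exact: dD.
apply/funext => n; apply: eq_bigr => j _.
by rewrite !diag_term (diag_op_coef dD') mulrA.
Qed.

Lemma diag_op_norm_cvg c D (dD : diag_op c D) u :
  \sum_(j < n) (c j * inner u (e j)) ^+ 2 @[n --> \oo] --> `|D u| ^+ 2.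
Proof.
rewrite -inner_norm -(diag_op_self_adjoint dD).
have h := inner_cvgl u (@diag_op_comp _ _ _ _ dD dD u).
have <- : (fun n => inner (\sum_(j < n) (c j * c j) *: tensor (e j) (e j) u) u) =
    (fun n => \sum_(j < n) (c j * inner u (e j)) ^+ 2); last exact: h.
apply/funext => n; rewrite inner_suml; apply: eq_bigr => j _.
by rewrite diag_term innerZl (innerC (e j)); ring.
Qed.

Lemma diag_op_unique c D D' : diag_op c D -> diag_op c D' -> D = D'.
Proof. by move=> h h'; apply/funext => u; exact: (cvg_unique _ (h u) (h' u)). Qed.

Lemma diag_op_ext c c' D : c =1 c' -> diag_op c D -> diag_op c' D.
Proof. by move=> h; have -> : c' = c by apply/funext => j; rewrite h. Qed.

Lemma diag_op_bounded c D (C : R) : (forall j, `|c j| <= C) -> diag_op c D ->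
  bounded_operator D.
Proof.
move=> cC dD; split; first exact: diag_op_linear dD.
by exists C => u; exact: diag_op_norm.
Qed.

End QuasiOrthonormal.

(** * Linear dependence and Gram-Schmidt *)

Section FiniteDimension.
Variables (R : realType) (H : hilbert R).

Lemma underdetermined k m (M : 'I_k -> 'I_m -> R) : (m < k)%N ->
  exists a : 'I_k -> R, (exists i, a i != 0) /\ forall j, \sum_i a i * M i j = 0.
Proof.
move=> mk; pose A : 'M[R]_(k, m) := \matrix_(i, j) M i j.
have : kermx A != 0.
  rewrite kermx_eq0 -row_leq_rank -ltnNge.
  by apply: leq_ltn_trans mk; exact: rank_leq_col.
move/rowV0Pn => [v /sub_kermxP vA /rV0Pn[i vi]].
exists (fun i => v 0 i); split; first by exists i.
move=> j; have := congr1 (fun B : 'rV_m => B 0 j) vA.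
by rewrite !mxE => h; rewrite -[RHS]h; apply: eq_bigr => l _; rewrite !mxE.
Qed.

Lemma dependent_in_span k m (b : 'I_m -> H) (x : 'I_k -> H) : (m < k)%N ->
  (forall i, exists c : 'I_m -> R, x i = \sum_j c j *: b j) ->
  exists a : 'I_k -> R, (exists i, a i != 0) /\ \sum_i a i *: x i = 0.
Proof.
move=> mk /choice[c xc].
have [a [a0 ac]] := underdetermined c mk.
exists a; split=> //.
under eq_bigr do rewrite xc scaler_sumr.
rewrite exchange_big/= big1// => j _.
by under eq_bigr do rewrite scalerA; rewrite -scaler_suml ac scale0r.
Qed.

(** The recursion carries the whole family built so far, because each
    orthogonalization step uses all the previous vectors. *)
Fixpoint gs_family (x : nat -> H) n : nat -> H :=
  if n is m.+1 then
    fun j => if j == m then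
        let r := x m - \sum_(i < m) inner (x m) (gs_family x m i) *: gs_family x m i in
        `|r|^-1 *: r
      else gs_family x m j
  else fun=> 0.

Definition gram_schmidt x n := gs_family x n.+1 n.

Lemma gs_familyE x n j : (j < n)%N -> gs_family x n j = gram_schmidt x j.
Proof.
elim: n => // n IH; rewrite ltnS leq_eqVlt => /predU1P[->//|jn].
by rewrite [LHS]/= (ltn_eqF jn) IH.
Qed.

Definition gs_residual x n : H :=
  x n - \sum_(i < n) inner (x n) (gram_schmidt x i) *: gram_schmidt x i.

Lemma gram_schmidtE x n : gram_schmidt x n = `|gs_residual x n|^-1 *: gs_residual x n.
Proof.
rewrite /gram_schmidt /= eqxx /gs_residual.
by under eq_bigr do rewrite gs_familyE//.
Qed.

Lemma gram_schmidt_quasi x : quasi_orthonormal (gram_schmidt x).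
Proof.
pose e := gram_schmidt x.
have e1 i : inner (e i) (e i) = 1 \/ e i = 0.
  rewrite /e gram_schmidtE; have [->|r0] := eqVneq (gs_residual x i) 0.
    by right; rewrite scaler0.
  left; rewrite innerZl innerZr inner_norm.
  by field; rewrite normr_eq0.
have eo n : forall i j, (i < n)%N -> (j < n)%N -> i != j -> inner (e i) (e j) = 0.
  elim: n => // n IH.
  have qn : quasi_orthonormal (fun i : 'I_n => e i).
    by split=> [i j ij|i]; [apply: IH|].
  have key j : (j < n)%N -> inner (e n) (e j) = 0.
    move=> jn; rewrite {1}/e gram_schmidtE innerZl /gs_residual innerBl.
    have := quasi_sum_inner qn (fun i => inner (x n) (e i)) (Ordinal jn).
    rewrite /= => ->; have := quasi_inner_scale qn (x n) (Ordinal jn) => /= ->.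
    by rewrite subrr mulr0.
  move=> i j; rewrite ltnS leq_eqVlt => /predU1P[->|hi];
    rewrite ltnS leq_eqVlt => /predU1P[->|hj].
  - by rewrite eqxx.
  - by move=> _; exact: key.
  - by move=> _; rewrite innerC; exact: key.
  - exact: IH.
split=> // i j ij; apply: (eo (maxn i j).+1) => //; rewrite ltnS.
  exact: leq_maxl.
exact: leq_maxr.
Qed.

Lemma gram_schmidt_span x n :
  x n = \sum_(i < n.+1) inner (x n) (gram_schmidt x i) *: gram_schmidt x i.
Proof.
rewrite big_ord_recr/= addrC; apply/eqP; rewrite -subr_eq; apply/eqP.
rewrite -/(gs_residual x n); set r := gs_residual x n.
have q := gram_schmidt_quasi x.
have rx : inner r (gram_schmidt x n) = inner (x n) (gram_schmidt x n).
  rewrite /r /gs_residual innerBl inner_suml big1 ?subr0// => i _.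
  by rewrite innerZl q.1 ?mulr0// ltn_eqF.
rewrite -rx gram_schmidtE -/r innerZr inner_norm scalerA.
have [->|r0] := eqVneq r 0; first by rewrite scaler0.
rewrite (_ : _ * _ = 1) ?scale1r//.
by field; rewrite normr_eq0.
Qed.

Lemma span_quasi_basis m (b : 'I_m -> H) : exists e : 'I_m -> H,
  quasi_orthonormal e /\
  forall v, (exists c : 'I_m -> R, v = \sum_i c i *: b i) ->
    v = \sum_i inner v (e i) *: e i.
Proof.
pose x n := if insub n is Some i then b i else 0.
have q := gram_schmidt_quasi x.
have qe : quasi_orthonormal (fun i : 'I_m => gram_schmidt x i) by exact: quasi_ord.
exists (fun i : 'I_m => gram_schmidt x i); split=> //.
have hb i : b i = \sum_(j < m) inner (b i) (gram_schmidt x j) *: gram_schmidt x j.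
  have := gram_schmidt_span x i; rewrite {1 2}/x valK => {1}->.
  rewrite (big_ord_widen m (fun j => inner (b i) (gram_schmidt x j) *: gram_schmidt x j))//.
  rewrite big_mkcond/=; apply: eq_bigr => j _; case: ifPn => //.
  rewrite -leqNgt => ij; rewrite (_ : inner _ _ = 0) ?scale0r//.
  have := gram_schmidt_span x i; rewrite {1}/x valK => ->.
  rewrite inner_suml big1// => l _; rewrite innerZl q.1 ?mulr0//.
  by rewrite ltn_eqF// (leq_trans (ltn_ord l)).
move=> v [c ->].
rewrite [LHS](eq_bigr (fun i => \sum_(j < m) (c i * inner (b i) (gram_schmidt x j)) *: gram_schmidt x j)); last first.
  by move=> i _; rewrite {1}hb scaler_sumr; apply: eq_bigr => j _; rewrite scalerA.
rewrite exchange_big/=; apply: eq_bigr => j _; rewrite -scaler_suml inner_suml.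
by congr (_ *: _); apply: eq_bigr => i _; rewrite innerZl.
Qed.

End FiniteDimension.

(** * Top eigenvectors of positive operators of finite rank *)

Lemma cvg_finite_sum (K : numFieldType) (V : normedModType K) T (F : set_system T)
    (FF : Filter F) I (r : seq I) (f : I -> T -> V) (l : I -> V) :
  (forall i, f i t @[t --> F] --> l i) ->
  \sum_(i <- r) f i t @[t --> F] --> \sum_(i <- r) l i.
Proof.
move=> fl; elim: r => [|i r IH].
  rewrite big_nil (_ : (fun t => _) = fun=> 0); first exact: cvg_cst.
  by apply/funext => t; rewrite big_nil.
rewrite big_cons (_ : (fun t => _) = (fun t => f i t + \sum_(j <- r) f j t)).
  exact: cvgD.
by apply/funext => t; rewrite big_cons.
Qed.

Section Spectral.
Variables (R : realType) (H : hilbert R).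

Lemma unit_ball_compact n : compact [set c : 'rV[R]_n | \sum_i c 0 i ^+ 2 <= 1].
Proof.
apply: (subclosed_compact _ (rV_compact (A := fun=> `[(-1 : R), 1]%classic) _)).
- rewrite (_ : [set c | _] = (fun c : 'rV[R]_n => \sum_i c 0 i ^+ 2) @^-1` [set x | x <= 1]) //.
  apply: closed_comp; last exact: closed_le.
  move=> c _; apply: (@cvg_finite_sum _ _ _ (nbhs c) _) => i.
  apply: (@cvgM _ _ (nbhs c) _); exact: coord_continuous.
- by move=> i; exact: segment_compact.
- move=> c /= c1 i; rewrite in_itv/= -ler_norml -(@ler_pXn2r _ 2) ?nnegrE//.
  rewrite expr1n real_normK ?num_real//; apply: le_trans c1.
  by rewrite (bigD1 i)//= lerDl sumr_ge0// => j _; rewrite sqr_ge0.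
Qed.

Variables (A : H -> H) (lA : linear A) (sA : self_adjoint A).
Hypothesis A0 : forall u, 0 <= inner (A u) u.

Lemma psd_Cauchy_Schwarz u v : inner (A u) v ^+ 2 <= inner (A u) u * inner (A v) v.
Proof.
have key t : 0 <= inner (A u) u + 2 * t * inner (A u) v + t ^+ 2 * inner (A v) v.
  have := A0 (u + t *: v); rewrite (linD lA) (linZ lA) !innerE.
  by rewrite (innerC (A v)) -sA; congr (0 <= _); ring.
set a := inner (A u) u in key *; set b := inner (A u) v in key *.
set c := inner (A v) v in key *.
have a0 : 0 <= a by exact: A0.
have c0 : 0 <= c by exact: A0.
have [c0'|cN] := eqVneq c 0.
  have [->|bN] := eqVneq b 0; first by rewrite expr0n mulr_ge0.
  have := key (- (a + 1) / (2 * b)).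
  rewrite c0' mulr0 addr0 (_ : a + _ = -1); last by field.
  by rewrite ler0N1.
have := key (- b / c).
have -> : a + 2 * (- b / c) * b + (- b / c) ^+ 2 * c = (a * c - b ^+ 2) / c by field.
by rewrite pmulr_lge0 ?subr_ge0// invr_gt0 lt_neqAle eq_sym cN.
Qed.

(** The Cauchy-Schwarz inequality of the form of A gives |A u|^2 <= L <A u, u>,
    so that equality in the Rayleigh quotient forces |A u - L u|^2 <= 0. *)
Lemma psd_rayleigh_eigen u (L : R) : (forall v, inner (A v) v <= L * `|v| ^+ 2) ->
  inner (A u) u = L * `|u| ^+ 2 -> A u = L *: u.
Proof.
move=> AL AuL; apply/eqP; rewrite -subr_eq0 -normr_eq0 -sqrf_eq0; apply/eqP.
apply/eqP; rewrite eq_le sqr_ge0 andbT.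
have h : `|A u| ^+ 2 <= L * inner (A u) u.
  have [->|Au0] := eqVneq (A u) 0.
    by rewrite normr0 expr0n inner0l mulr0.
  have p : 0 < `|A u| ^+ 2 by rewrite exprn_gt0// normr_gt0.
  rewrite -(ler_pM2r p) -expr2 -{1}inner_norm.
  apply: le_trans (psd_Cauchy_Schwarz _ _) _.
  rewrite mulrC mulrAC ler_wpM2r//.
rewrite normB_sqr normrZ exprMn innerZr real_normK ?num_real//.
move: h; rewrite AuL => h.
have -> : `|A u| ^+ 2 - 2 * (L * (L * `|u| ^+ 2)) + L ^+ 2 * `|u| ^+ 2 =
   `|A u| ^+ 2 - L * (L * `|u| ^+ 2) by ring.
by rewrite subr_le0.
Qed.

(** The quotient <A v, v> / |v|^2 only depends on the coordinates of v in the
    range of A, hence is maximal at a point of a compact ball.  The ball is used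
    rather than the sphere because a quasi-orthonormal family may contain zero
    vectors; a positive maximum over the ball is reached on the sphere. *)
Lemma finite_rank_top_eigen m (b : 'I_m -> H) :
  (forall u, exists c : 'I_m -> R, A u = \sum_i c i *: b i) ->
  (forall u, A u = 0) \/
  exists L u, [/\ 0 < L, u <> 0, A u = L *: u & forall v, inner (A v) v <= L * `|v| ^+ 2].
Proof.
move=> Ab; have [e [eq eb]] := span_quasi_basis b.
have Ae u : A u = \sum_i inner (A u) (e i) *: e i by exact: eb.
pose x (c : 'rV[R]_m) := \sum_i c 0 i *: e i.
pose F c := inner (A (x c)) (x c).
have FE c : F c = \sum_i \sum_j c 0 i * c 0 j * inner (A (e i)) (e j).
  rewrite /F /x (lin_sum lA) inner_suml; apply: eq_bigr => i _.
  rewrite inner_sumr; apply: eq_bigr => j _.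
  by rewrite (linZ lA) innerZl innerZr; ring.
have Fcont : continuous F.
  rewrite (_ : F = fun c => \sum_i \sum_j c 0 i * c 0 j * inner (A (e i)) (e j)).
    move=> c; do 2!apply: (@cvg_finite_sum _ _ _ (nbhs c) _) => ?.
    apply: (@cvgM _ _ (nbhs c) _); last exact: cvg_cst.
    apply: (@cvgM _ _ (nbhs c) _); exact: coord_continuous.
  by apply/funext.
have [|c0 c0in c0max] := EVT_max_rV _ (@unit_ball_compact m) (continuous_subspaceT Fcont).
  by exists 0 => /=; rewrite big1// => i _; rewrite mxE expr0n.
rewrite inE/= in c0in.
have AF u : inner (A u) u <= F c0 * `|u| ^+ 2.
  have [->|u0] := eqVneq u 0; first by rewrite inner0r normr0 expr0n mulr0.
  have up : 0 < `|u| by rewrite normr_gt0.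
  pose c := \row_i (inner u (e i) / `|u|) : 'rV[R]_m.
  have cin : c \in [set c : 'rV[R]_m | \sum_i c 0 i ^+ 2 <= 1].
    rewrite inE/=.
    under eq_bigr do rewrite mxE exprMn.
    rewrite -mulr_suml exprVn ler_pdivrMr ?exprn_gt0// mul1r.
    exact: bessel.
  have := c0max c cin; suff -> : F c = inner (A u) u / `|u| ^+ 2.
    by rewrite ler_pdivrMr ?exprn_gt0.
  pose v := \sum_i inner u (e i) *: e i.
  have xv : x c = `|u|^-1 *: v.
    rewrite /x /v scaler_sumr; apply: eq_bigr => i _.
    by rewrite mxE scalerA mulrC.
  have Auv : A v = A u.
    apply/eqP; rewrite -subr_eq0 -(linB lA); apply/eqP/inner_eq0.
    rewrite sA (Ae (A (v - u))) inner_sumr big1// => i _; rewrite innerZr innerBl.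
    by rewrite /v (quasi_sum_inner eq) (quasi_inner_scale eq) subrr mulr0.
  rewrite /F xv (linZ lA) innerZl innerZr Auv sA Auv -sA.
  by field; rewrite gt_eqF.
have F0 : 0 <= F c0 by exact: A0.
move: F0; rewrite le_eqVlt => /predU1P[F0|F0].
  left=> u; apply/inner_eq0/eqP; rewrite -sqrf_eq0 eq_le sqr_ge0 andbT.
  apply: le_trans (psd_Cauchy_Schwarz _ _) _.
  have := AF u; rewrite -F0 mul0r => h.
  have -> : inner (A u) u = 0 by apply/eqP; rewrite eq_le h A0.
  by rewrite mul0r.
right; exists (F c0), (x c0).
have x1 : `|x c0| ^+ 2 <= 1 by apply: le_trans (quasi_sum_norm eq _) _.
have x2 : F c0 = F c0 * `|x c0| ^+ 2.
  by apply/eqP; rewrite eq_le; apply/andP; split; [exact: AF|rewrite ler_piMr// ltW].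
split => //; last exact: psd_rayleigh_eigen.
move=> x0; move: F0; rewrite x2 x0 normr0 expr0n mulr0 ltxx//.
Qed.

End Spectral.

(** Deflation.  With Pi the projection onto the span of psi, Q = M (1 - Pi) is
    positive of finite rank, and a top eigenvector of Q with eigenvalue L > 0 is an
    eigenvector of M orthogonal to psi, so that L <= lam j.  The quadratic form of
    M splits into that of Q and sum_k lam_k <u, psi_k>^2, both of which are then
    controlled by lam j. *)
Lemma first_eigenfunctions_rayleigh (R : realType) (H : hilbert R) (M : H -> H)
    m (b : 'I_m -> H) d (psi : 'I_d -> H) (lam : 'I_d -> R) :
  linear M -> self_adjoint M -> (forall u, 0 <= inner (M u) u) ->
  (forall u, exists c : 'I_m -> R, M u = \sum_i c i *: b i) ->
  (forall i j, inner (psi i) (psi j) = (i == j)%:R) ->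
  (forall j, M (psi j) = lam j *: psi j) ->
  (forall i j : 'I_d, (i <= j)%N -> lam j <= lam i) ->
  (forall (l : R) (u : H), eigenpair M l u ->
     (forall j, inner u (psi j) = 0) -> forall j, l <= lam j) ->
  forall (j : 'I_d) u, (forall k : 'I_d, (k < j)%N -> inner u (psi k) = 0) ->
  inner (M u) u <= lam j * `|u| ^+ 2.
Proof.
move=> lM sM M0 Mb psio Mpsi lamo top.
have qpsi := orthonormal_quasi psio.
pose Pi u := \sum_k inner u (psi k) *: psi k.
pose Q u := M (u - Pi u).
have lPi : linear Pi.
  move=> a u v; rewrite /Pi scaler_sumr -big_split/=; apply: eq_bigr => k _.
  by rewrite !innerE scalerDl scalerA.
have Pik u k : inner (Pi u) (psi k) = inner u (psi k).
  by rewrite (quasi_sum_inner qpsi) quasi_inner_scale.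
have MPi u : M (Pi u) = \sum_k (lam k * inner u (psi k)) *: psi k.
  by rewrite (lin_sum lM); apply: eq_bigr => k _; rewrite (linZ lM) Mpsi scalerA mulrC.
have perp u v : inner (u - Pi u) (M (Pi v)) = 0.
  by rewrite MPi inner_sumr big1// => k _; rewrite innerZr innerBl Pik subrr mulr0.
have lQ : linear Q.
  by move=> a u v; rewrite /Q lPi -lM; congr M; rewrite opprD addrACA -scalerBr.
have QE u v : inner (Q u) v = inner (M (u - Pi u)) (v - Pi v).
  by rewrite innerBr -[LHS]subr0; congr (_ - _); rewrite sM perp.
have sQ : self_adjoint Q by move=> u v; rewrite QE innerC [RHS]innerC QE -sM innerC.
have Q0 u : 0 <= inner (Q u) u by rewrite QE.
have Msplit u : inner (M u) u = inner (Q u) u + \sum_k lam k * inner u (psi k) ^+ 2.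
  rewrite -{1}(subrK (Pi u) u) (linD lM) innerDl; congr (_ + _).
  rewrite MPi inner_suml; apply: eq_bigr => k _.
  by rewrite innerZl (innerC (psi k)); ring.
have lam0 k : 0 <= lam k.
  by have := M0 (psi k); rewrite Mpsi innerZl psio eqxx mulr1.
have sumle (j : 'I_d) u : (forall k : 'I_d, (k < j)%N -> inner u (psi k) = 0) ->
    \sum_k lam k * inner u (psi k) ^+ 2 <= lam j * \sum_k inner u (psi k) ^+ 2.
  move=> uj; rewrite mulr_sumr; apply: ler_sum => k _.
  case: (ltnP k j) => kj; first by rewrite uj// expr0n !mulr0.
  by rewrite ler_wpM2r ?sqr_ge0// lamo.
have [|Q00|[L [w [L0 w0 Qw QL]]]] := finite_rank_top_eigen lQ sQ Q0 (b := b).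
- by move=> u; exact: Mb.
- move=> j u uj; rewrite Msplit Q00 inner0l add0r.
  apply: le_trans (sumle _ _ uj) _; rewrite ler_wpM2l//; exact: bessel.
have wpsi k : inner w (psi k) = 0.
  have /eqP : L * inner w (psi k) = 0.
    rewrite -innerZl -Qw QE [X in inner _ X](_ : _ = 0) ?inner0r//.
    rewrite /Pi (bigD1 k)//= psio eqxx scale1r big1 ?addr0 ?subrr// => i ik.
    by rewrite psio eq_sym (negPf ik) scale0r.
  by rewrite mulf_eq0 gt_eqF//= => /eqP.
have Piw : Pi w = 0 by rewrite /Pi big1// => k _; rewrite wpsi scale0r.
have Llam k : L <= lam k.
  by apply: (top L w) => //; split=> //; rewrite -Qw /Q Piw subr0.
move=> j u uj; rewrite Msplit.
have -> : inner (Q u) u = inner (Q (u - Pi u)) (u - Pi u).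
  rewrite (QE u u) (QE (u - Pi u) (u - Pi u)); have PP : Pi (u - Pi u) = 0.
    by rewrite /Pi big1// => k _; rewrite innerBl Pik subrr scale0r.
  by rewrite !PP !subr0.
apply: le_trans (lerD (QL _) (sumle _ _ uj)) _.
rewrite (quasi_residual qpsi).
have bes := bessel qpsi u.
set S := \sum_k _ in bes *.
have : L * (`|u| ^+ 2 - S) <= lam j * (`|u| ^+ 2 - S) by rewrite ler_wpM2r// subr_ge0.
lra.
Qed.

(** * Perturbation of eigenvalues and eigenvectors *)

Section Perturbation.
Variables (R : realType).
Implicit Types (H K : hilbert R).

Lemma orthonormal_sum_norm H n (x : 'I_n -> H) (a : 'I_n -> R) :
  (forall i j, inner (x i) (x j) = (i == j)%:R) ->
  `|\sum_i a i *: x i| ^+ 2 = \sum_i a i ^+ 2.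
Proof.
move=> xo; rewrite -inner_norm inner_sumr; apply: eq_bigr => i _.
by rewrite innerZr (quasi_sum_inner (orthonormal_quasi xo)) xo eqxx mulr1 expr2.
Qed.

(** One half of the Courant-Fischer principle: among the combinations of j + 1
    orthonormal vectors x some nonzero one is orthogonal to the j vectors y, and
    both estimates apply to it. *)
Lemma minmax_compare H (q1 q2 : H -> R) (l1 l2 delta : R) j (x : 'I_j.+1 -> H)
    (y : 'I_j -> H) :
  (forall i k, inner (x i) (x k) = (i == k)%:R) ->
  (forall a : 'I_j.+1 -> R, l1 * `|\sum_i a i *: x i| ^+ 2 <= q1 (\sum_i a i *: x i)) ->
  (forall u, (forall k, inner u (y k) = 0) -> q2 u <= l2 * `|u| ^+ 2) ->
  (forall u, q1 u <= q2 u + delta * `|u| ^+ 2) ->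
  l1 <= l2 + delta.
Proof.
move=> xo q1l q2l q12.
have [a [[i0 ai0] ay]] := underdetermined (fun i k => inner (x i) (y k)) (ltnSn j).
set u := \sum_i a i *: x i.
have u0 : 0 < `|u| ^+ 2.
  rewrite orthonormal_sum_norm// lt_neqAle sumr_ge0 ?andbT; last by move=> i _; exact: sqr_ge0.
  rewrite eq_sym psumr_neq0; last by move=> i _; exact: sqr_ge0.
  by apply/hasP; exists i0; rewrite ?mem_index_enum//= lt_neqAle sqr_ge0 eq_sym sqrf_eq0 ai0.
have uy k : inner u (y k) = 0.
  by rewrite -[RHS](ay k) inner_suml; apply: eq_bigr => i _; rewrite innerZl.
rewrite -(ler_pM2r u0) mulrDl.
apply: le_trans (q1l a) _; apply: le_trans (q12 u) _.
by rewrite lerD2r q2l.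
Qed.

(** N - lam j is bounded below by the gap g on the complement of phi j, hence
    the component of x there has norm at most eta / g.  With c = <x, phi j> this
    says 1 - c^2 <= (eta / g)^2, and |x - t phi j|^2 = 2 - 2 |c| <= 2 (1 - c^2). *)
Lemma eigenvector_perturbation H d (phi : 'I_d -> H) (lam : 'I_d -> R)
    (N : H -> H) (j : 'I_d) (g eta : R) (x : H) :
  (forall i k, inner (phi i) (phi k) = (i == k)%:R) ->
  (forall u, N u = \sum_k (lam k * inner u (phi k)) *: phi k) ->
  0 < g -> (forall k, k != j -> g <= `|lam k - lam j|) -> g <= `|lam j| ->
  `|x| = 1 -> `|N x - lam j *: x| <= eta ->
  let t : R := if 0 <= inner x (phi j) then 1 else -1 in
  `|x - t *: phi j| <= 2 * eta / g.
Proof.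
move=> phio NE g0 gk gj x1 Nx; set t := (X in let t := X in _).
change (`|x - t *: phi j| <= 2 * eta / g).
have qphi := orthonormal_quasi phio.
set c := inner x (phi j) in t *.
pose r := x - c *: phi j.
have phi1 k : `|phi k| = 1.
  by apply/eqP; rewrite -(@eqrXn2 _ 2)// -inner_norm phio eqxx expr1n.
have rj : inner r (phi j) = 0 by rewrite /r innerBl innerZl phio eqxx mulr1 subrr.
have rnorm : `|r| ^+ 2 = 1 - c ^+ 2.
  by rewrite /r normB_sqr normrZ phi1 x1 innerZr -/c mulr1 real_normK ?num_real//; ring.
pose p := \sum_k inner r (phi k) *: phi k.
have Nr : N x - lam j *: x = \sum_k ((lam k - lam j) * inner r (phi k)) *: phi k
    - lam j *: (r - p).
  have -> : N x = \sum_k (lam k * inner r (phi k)) *: phi k + (lam j * c) *: phi j.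
    rewrite NE (bigD1 j)//= [in RHS](bigD1 j)//= rj mulr0 scale0r add0r addrC.
    congr (_ + _); apply: eq_bigr => k kj.
    by rewrite /r innerBl innerZl phio eq_sym (negPf kj) mulr0 subr0.
  have -> : \sum_k ((lam k - lam j) * inner r (phi k)) *: phi k =
      \sum_k (lam k * inner r (phi k)) *: phi k - lam j *: p.
    rewrite /p scaler_sumr -sumrB; apply: eq_bigr => k _.
    by rewrite scalerA mulrBl scalerBl.
  by apply: inner_inj => w; rewrite /r !innerE; ring.
have rp k : inner (r - p) (phi k) = 0.
  by rewrite innerBl (quasi_sum_inner qphi) (quasi_inner_scale qphi) subrr.
have Nrn : `|N x - lam j *: x| ^+ 2 =
    \sum_k ((lam k - lam j) * inner r (phi k)) ^+ 2 + lam j ^+ 2 * `|r - p| ^+ 2.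
  rewrite Nr; move: (r - p) rp => z zp.
  rewrite normB_sqr orthonormal_sum_norm// normrZ exprMn real_normK ?num_real//.
  rewrite inner_suml [X in _ - 2 * X]big1 ?mulr0 ?subr0// => k _.
  by rewrite innerZl innerZr (innerC (phi k)) zp !mulr0.
have rg : (g * `|r|) ^+ 2 <= eta ^+ 2.
  apply: (@le_trans _ _ (`|N x - lam j *: x| ^+ 2)); last by rewrite lerXn2r ?nnegrE// (le_trans _ Nx).
  rewrite Nrn exprMn.
  have -> : `|r| ^+ 2 = \sum_k inner r (phi k) ^+ 2 + `|r - p| ^+ 2.
    by rewrite (quasi_residual qphi) addrC subrK.
  rewrite mulrDr mulr_sumr; apply: lerD.
    apply: ler_sum => k _; have [->|kj] := eqVneq k j.
      by rewrite rj expr0n !mulr0 expr0n.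
    rewrite exprMn ler_wpM2r ?sqr_ge0// -(real_normK (num_real (lam k - lam j))).
    by rewrite ler_pXn2r ?nnegrE// ?gk// ltW.
  rewrite ler_wpM2r ?sqr_ge0// -(real_normK (num_real (lam j))).
  by rewrite ler_pXn2r ?nnegrE// ltW.
have eta0 : 0 <= eta by rewrite (le_trans _ Nx).
have rle : `|r| <= eta / g.
  rewrite ler_pdivlMr// mulrC -(@ler_pXn2r _ 2) ?nnegrE// mulr_ge0// ltW//.
have c1 : `|c| <= 1 by apply: le_trans (Cauchy_Schwarz _ _) _; rewrite x1 phi1 mulr1.
have tn : `|x - t *: phi j| ^+ 2 = 2 - 2 * `|c|.
  rewrite normB_sqr normrZ phi1 x1 innerZr -/c mulr1.
  by rewrite /t; case: ifPn => [c0|/negbTE]; [rewrite normr1 ger0_norm//; ring|];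
     move=> /negbT; rewrite -ltNge => c0; rewrite normrN1 ltr0_norm//; ring.
apply: le_sqr_norm; first by rewrite divr_ge0 ?mulr_ge0// ltW.
rewrite tn -mulrA exprMn.
have rr : `|r| ^+ 2 <= (eta / g) ^+ 2 by rewrite ler_pXn2r ?nnegrE// divr_ge0// ltW.
apply: (@le_trans _ _ (2 * `|r| ^+ 2)).
  rewrite rnorm -(real_normK (num_real c)).
  have := normr_ge0 c; move: (`|c|) c1 => z z1 z0; nra.
by move: (sqr_ge0 (eta / g)) rr; move: (`|r| ^+ 2) ((eta / g) ^+ 2); clear; move=> a b; lra.
Qed.

End Perturbation.

(** * Singular vectors *)

Section SingularValues.
Variables (R : realType) (H K : hilbert R) (T : H -> K) (Ta : K -> H).
Hypotheses (lT : linear T) (lTa : linear Ta).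
Hypothesis TTa : forall u v, inner (T u) v = inner u (Ta v).
Variables (d : nat) (psi : 'I_d -> K) (lam : 'I_d -> R).
Hypothesis psio : forall i j, inner (psi i) (psi j) = (i == j)%:R.
Hypothesis Mpsi : forall j, T (Ta (psi j)) = lam j *: psi j.

Definition right_vector k : H := (Num.sqrt (lam k))^-1 *: Ta (psi k).

Local Notation phi := right_vector.

Lemma svd_norm i j : inner (Ta (psi i)) (Ta (psi j)) = lam i * (i == j)%:R.
Proof. by rewrite -TTa Mpsi innerZl psio. Qed.

Lemma svd_ge0 j : 0 <= lam j.
Proof. by have := inner_ge0 (Ta (psi j)); rewrite svd_norm eqxx mulr1. Qed.

Lemma right_vector_orthonormal i j : 0 < lam i ->
  inner (phi i) (phi j) = (i == j)%:R.
Proof.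
move=> li; rewrite /right_vector innerZl innerZr svd_norm.
have [<-|] := eqVneq i j; last by rewrite !mulr0.
rewrite mulr1 mulrA -invfM -expr2 sqr_sqrtr ?ltW// mulVf ?gt_eqF//.
Qed.

Lemma svd_right j : 0 < lam j -> T (phi j) = Num.sqrt (lam j) *: psi j.
Proof.
move=> lj; rewrite /right_vector (linZ lT) Mpsi scalerA -{2}(sqr_sqrtr (ltW lj)).
by rewrite expr2 mulrA mulVf ?mul1r// gt_eqF// sqrtr_gt0.
Qed.

Lemma svd_left j : 0 < lam j -> Ta (psi j) = Num.sqrt (lam j) *: phi j.
Proof.
by move=> lj; rewrite /right_vector scalerA mulfV ?scale1r// gt_eqF// sqrtr_gt0.
Qed.

Lemma svd_eigen j : 0 < lam j -> Ta (T (phi j)) = lam j *: phi j.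
Proof.
move=> lj; rewrite svd_right// (linZ lTa) svd_left// scalerA.
by rewrite -expr2 sqr_sqrtr// ltW.
Qed.

Lemma svd_inner_right u j : 0 < lam j ->
  inner (T u) (psi j) = Num.sqrt (lam j) * inner u (phi j).
Proof. by move=> lj; rewrite TTa svd_left// innerZr. Qed.

Lemma svd_gram_self_adjoint : self_adjoint (T \o Ta).
Proof. by move=> u v /=; rewrite TTa innerC -TTa innerC. Qed.

Lemma svd_gram_ge0 u : 0 <= inner (T (Ta u)) u.
Proof. by rewrite TTa inner_ge0. Qed.

Variables (m : nat) (b : 'I_m -> K).
Hypothesis Tb : forall u, exists c : 'I_m -> R, T u = \sum_i c i *: b i.
Hypothesis lamo : forall i j : 'I_d, (i <= j)%N -> lam j <= lam i.
Hypothesis top : forall (l : R) (u : K), eigenpair (T \o Ta) l u ->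
  (forall j, inner u (psi j) = 0) -> forall j, l <= lam j.

(** Carries the variational bound from T T^* over to T^* T, through
    |T u|^4 = <u, T^* T u>^2 <= |u|^2 <T T^* (T u), T u>. *)
Lemma svd_rayleigh (j : 'I_d) u :
  (forall k : 'I_d, (k < j)%N -> inner u (Ta (psi k)) = 0) ->
  `|T u| ^+ 2 <= lam j * `|u| ^+ 2.
Proof.
move=> uj; have [->|Tu0] := eqVneq (T u) 0.
  by rewrite normr0 expr0n mulr_ge0 ?sqr_ge0// svd_ge0.
have p : 0 < `|T u| ^+ 2 by rewrite exprn_gt0// normr_gt0.
have lM : linear (T \o Ta) by move=> a x y; rewrite /= lTa lT.
have := first_eigenfunctions_rayleigh lM svd_gram_self_adjoint svd_gram_ge0
  (fun u => Tb (Ta u)) psio Mpsi lamo top.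
move=> /(_ j (T u)) h.
have {}h : `|Ta (T u)| ^+ 2 <= lam j * `|T u| ^+ 2.
  rewrite -inner_norm -TTa; apply: h => k kj.
  by rewrite TTa uj.
rewrite -(ler_pM2r p) -expr2.
have -> : (`|T u| ^+ 2) ^+ 2 = (inner u (Ta (T u))) ^+ 2 by rewrite -TTa inner_norm.
apply: (@le_trans _ _ (`|u| ^+ 2 * `|Ta (T u)| ^+ 2)).
  rewrite -exprMn -(real_normK (num_real (inner _ _))) ler_pXn2r ?nnegrE ?mulr_ge0//.
  exact: Cauchy_Schwarz.
rewrite [leRHS](_ : _ = `|u| ^+ 2 * (lam j * `|T u| ^+ 2)); last by ring.
by apply: ler_wpM2l; rewrite ?sqr_ge0.
Qed.

End SingularValues.

Section RankAndSpectrum.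
Variables (R : realType) (H K : hilbert R) (T : H -> K) (Ta : K -> H).
Hypotheses (lT : linear T) (lTa : linear Ta).
Hypothesis TTa : forall u v, inner (T u) v = inner u (Ta v).
Variables (d : nat) (psi : 'I_d -> K) (lam : 'I_d -> R).
Hypothesis psio : forall i j, inner (psi i) (psi j) = (i == j)%:R.
Hypothesis Mpsi : forall j, T (Ta (psi j)) = lam j *: psi j.
Hypothesis lamo : forall i j : 'I_d, (i <= j)%N -> lam j <= lam i.
Hypothesis top : forall (l : R) (u : K), eigenpair (T \o Ta) l u ->
  (forall j, inner u (psi j) = 0) -> forall j, l <= lam j.
Hypothesis rT : has_rank T d.

(** If lam j vanished, the variational bound would make T^* vanish on the
    complement of j < d vectors, and the range of T would have dimension below d. *)
Lemma rank_pos_eigenvalues j : 0 < lam j.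
Proof.
have [b [bfree bran]] := rT.
have Tb u : exists c : 'I_d -> R, T u = \sum_i c i *: b i.
  have : range T (T u) by exists u.
  by rewrite bran.
have qpsi := orthonormal_quasi psio.
rewrite lt_neqAle eq_sym (svd_ge0 TTa psio Mpsi) andbT; apply/eqP => lj0.
pose y (k : 'I_j) := psi (widen_ord (ltnW (ltn_ord j)) k).
have yo i k : inner (y i) (y k) = (i == k)%:R by rewrite psio.
have Ty v : range T v -> v = \sum_k inner v (y k) *: y k.
  move=> [u _ uv]; apply/eqP; rewrite -subr_eq0; apply/eqP.
  set v' := v - _.
  have v'y k : inner v' (y k) = 0.
    by rewrite innerBl (quasi_sum_inner (orthonormal_quasi yo)) yo eqxx mulr1 subrr.
  have Tav' : Ta v' = 0.
    have lM : linear (T \o Ta) by move=> a x z; rewrite /= lTa lT.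
    have := first_eigenfunctions_rayleigh lM (svd_gram_self_adjoint TTa)
      (svd_gram_ge0 TTa) (fun u => Tb (Ta u)) psio Mpsi lamo top.
    move=> /(_ j v'); rewrite lj0 mul0r => h; apply/inner_eq0/eqP.
    rewrite eq_le inner_ge0 andbT -TTa; apply: h => k kj.
    by rewrite -(v'y (Ordinal kj)) /y; congr (inner _ (psi _)); exact: val_inj.
  apply: inner_eq0; rewrite {2}/v' innerBr inner_sumr big1 ?subr0.
    by rewrite -uv innerC TTa Tav' inner0r.
  by move=> k _; rewrite innerZr v'y mulr0.
have [a [[i ai] ab]] : exists a : 'I_d -> R, (exists i, a i != 0) /\ \sum_i a i *: b i = 0.
  apply: (@dependent_in_span _ _ d j y b); first exact: ltn_ord.
  move=> i; exists (fun k => inner (b i) (y k)); apply: Ty.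
  rewrite bran; exists (fun k => (k == i)%:R).
  by rewrite (bigD1 i)//= eqxx scale1r big1 ?addr0// => k /negPf ->; rewrite scale0r.
by move: ai; rewrite (bfree a ab) eqxx.
Qed.

(** The psi_k are in the range of T because lam k > 0; a further vector of the
    range orthogonal to them would make d + 1 independent vectors in it. *)
Lemma rank_span_eigenvectors u : T u = \sum_k inner (T u) (psi k) *: psi k.
Proof.
have [b [bfree bran]] := rT.
have Tb v : exists c : 'I_d -> R, T v = \sum_i c i *: b i.
  have : range T (T v) by exists v.
  by rewrite bran.
apply/eqP; rewrite -subr_eq0; apply/eqP; set v := _ - _.
have vpsi k : inner v (psi k) = 0.
  by rewrite innerBl (quasi_sum_inner (orthonormal_quasi psio)) psio eqxx mulr1 subrr.
have psiT k : psi k = T ((lam k)^-1 *: Ta (psi k)).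
  by rewrite (linZ lT) Mpsi scalerA mulVf ?scale1r// gt_eqF// rank_pos_eigenvalues.
have [w vw] : exists w, v = T w.
  exists (u - \sum_k inner (T u) (psi k) *: ((lam k)^-1 *: Ta (psi k))).
  rewrite (linB lT) (lin_sum lT); congr (_ - _); apply: eq_bigr => k _.
  by rewrite [in RHS](linZ lT) -psiT.
pose x (i : 'I_d.+1) := if unlift ord0 i is Some k then psi k else v.
have [a [[i ai] ax]] : exists a : 'I_d.+1 -> R, (exists i, a i != 0) /\ \sum_i a i *: x i = 0.
  apply: (@dependent_in_span _ _ d.+1 d b x) => // i.
  by rewrite /x; case: unliftP => [k _|_]; [rewrite psiT; exact: Tb | rewrite vw; exact: Tb].
rewrite big_ord_recl /x unlift_none in ax.
have ax' : a ord0 *: v + \sum_k a (lift ord0 k) *: psi k = 0.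
  by rewrite -[RHS]ax; congr (_ + _); apply: eq_bigr => k _; rewrite liftK.
have ak k : a (lift ord0 k) = 0.
  have := congr1 (fun z => inner z (psi k)) ax'.
  rewrite /= innerDl innerZl vpsi mulr0 add0r (quasi_sum_inner (orthonormal_quasi psio)).
  by rewrite psio eqxx mulr1 inner0l.
have a0 : a ord0 != 0.
  by move: ai; case: (unliftP ord0 i) => [k ->|->//]; rewrite ak eqxx.
have : a ord0 *: v = 0.
  by rewrite -[RHS]ax' big1 ?addr0// => k _; rewrite ak scale0r.
by move/eqP; rewrite scaler_eq0 (negPf a0)/= => /eqP.
Qed.

Lemma rank_gram_expansion u :
  Ta (T u) = \sum_k (lam k * inner u (right_vector Ta psi lam k)) *:
     right_vector Ta psi lam k.
Proof.
rewrite {1}rank_span_eigenvectors (lin_sum lTa); apply: eq_bigr => k _.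
have lk := rank_pos_eigenvalues k.
rewrite (linZ lTa) (svd_inner_right (lam := lam) TTa _ _ lk) (svd_left Ta psi lk) scalerA.
by rewrite mulrAC -expr2 sqr_sqrtr// ltW.
Qed.

Lemma distinct_eigenvalues i j : distinct_nonzero_eigenvalues (T \o Ta) ->
  i != j -> lam i != lam j.
Proof.
move=> dist ij; apply/eqP => lij.
have psi0 k : psi k <> 0.
  by move=> pk; have := psio k k; rewrite pk inner0l eqxx => /eqP; rewrite eq_sym oner_eq0.
have [c psij] : exists c, psi j = c *: psi i.
  apply: (dist (lam i)); first by rewrite gt_eqF// rank_pos_eigenvalues.
    by split=> //=; rewrite Mpsi.
  by split=> //=; rewrite Mpsi lij.
have := psio i j; rewrite psij innerZr psio eqxx mulr1 (negPf ij) => c0.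
by apply: (psi0 j); rewrite psij c0 scale0r.
Qed.

End RankAndSpectrum.

(** * Continuity of the square root *)

Section SqrtContinuity.
Variables (R : realType) (H : hilbert R).

Lemma sqrt_norm (C B : H -> H) (c : R) u : is_sqrt C B ->
  (forall u, `|C u| <= c * `|u|) -> `|B u| ^+ 2 <= c * `|u| ^+ 2.
Proof.
move=> [bB sB _ BC] Cc; rewrite -inner_norm sB BC.
apply: le_trans (ler_norm _) _; apply: le_trans (Cauchy_Schwarz _ _) _.
by rewrite mulrC expr2 mulrA ler_wpM2r.
Qed.

Lemma sqrt_norm_le (C B : H -> H) (c : R) u : is_sqrt C B -> 0 <= c ->
  (forall u, `|C u| <= c * `|u|) -> `|B u| <= (c + 1) * `|u|.
Proof.
move=> CB c0 Cc; apply: le_sqr_norm; first by rewrite mulr_ge0 ?addr_ge0.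
apply: le_trans (sqrt_norm _ CB Cc) _; rewrite exprMn ler_wpM2r ?sqr_ge0//.
by rewrite sqrrD1; nra.
Qed.

(** (B + s) (B u - s u) = C u - s^2 u, and B + s >= s. *)
Lemma sqrt_near_eigen (C B : H -> H) (s tau : R) u : is_sqrt C B -> 0 < s ->
  `|C u - (s ^+ 2) *: u| <= tau -> `|B u - s *: u| <= tau / s.
Proof.
move=> [bB sB B0 BC] s0 Cu; have lB := bB.1.
set x := B u - s *: u.
have e : B x + s *: x = C u - s ^+ 2 *: u.
  rewrite /x (linB lB) (linZ lB) BC.
  by apply: inner_inj => w; rewrite !innerE; ring.
have [->|x0] := eqVneq x 0.
  by rewrite normr0 divr_ge0 ?(ltW s0)//; apply: le_trans Cu.
have p : 0 < `|x| by rewrite normr_gt0.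
rewrite ler_pdivlMr// -(ler_pM2r p).
apply: (@le_trans _ _ (inner (B x + s *: x) x)).
  rewrite innerDl innerZl inner_norm; have := B0 x; lra.
apply: le_trans (ler_norm _) _; apply: le_trans (Cauchy_Schwarz _ _) _.
by rewrite e ler_wpM2r.
Qed.

(** Strong continuity of the square root at S.  On an eigenvector e_k both B and
    Bh are close to the scalar sqrt (lam k) by [sqrt_near_eigen]; a finite
    combination of the e_k approximates v, and both roots are bounded. *)
Lemma sqrt_strong (S B : H -> H) (e : nat -> H) (lam c : nat -> R) (v : H) (e0 : R) :
  bounded_operator S -> is_sqrt S B ->
  (forall k, 0 < lam k) -> (forall k, S (e k) = lam k *: e k) ->
  (forall k, `|e k| = 1) ->
  \sum_(k < n) c k *: e k @[n --> \oo] --> v -> 0 < e0 ->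
  exists2 tau, 0 < tau & forall C Bh, is_sqrt C Bh ->
    (forall u, `|C u - S u| <= tau * `|u|) -> `|Bh v - B v| <= e0.
Proof.
move=> bS SB lam0 Se e1 cv e00.
have [M M0 SM] := bounded_pos bS.
pose K := M + 2.
have K0 : 0 < K by rewrite addr_gt0.
move/cvgrPdist_lt : cv => /(_ (e0 / (4 * K))).
rewrite divr_gt0 ?mulr_gt0// => /(_ isT) [n _ /(_ n (leqnn _))/= vn].
set vn' := \sum_(k < n) _ in vn.
pose W := \sum_(k < n) `|c k| * (2 / Num.sqrt (lam k)).
have W0 : 0 <= W by apply: sumr_ge0 => k _; rewrite mulr_ge0// divr_ge0// sqrtr_ge0.
have W1 : 0 < W + 1 by rewrite ltr_wpDl.
exists (Num.min 1 (e0 / (2 * (W + 1)))).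
  by rewrite lt_min ltr01 divr_gt0// mulr_gt0.
move=> C Bh CB CS; set tau := Num.min _ _ in CS.
have tau1 : tau <= 1 by rewrite ge_min lexx.
have tau0 : 0 <= tau by rewrite le_min ler01 divr_ge0 ?(ltW e00)// mulr_ge0// ltW.
have CM u : `|C u| <= (M + 1) * `|u|.
  rewrite -[C u](subrK (S u)); apply: le_trans (ler_normD _ _) _.
  rewrite mulrDl mul1r addrC lerD//; apply: le_trans (CS u) _.
  by rewrite ler_piMl.
have BhK u : `|Bh u| <= K * `|u|.
  have -> : K = M + 1 + 1 by rewrite /K; ring.
  by apply: (sqrt_norm_le _ CB) => //; rewrite addr_ge0// ltW.
have BK u : `|B u| <= K * `|u|.
  apply: le_trans (sqrt_norm_le u SB (ltW M0) SM) _.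
  by rewrite ler_wpM2r// /K; lra.
have [bBh _ _ _] := CB; have [bB _ _ _] := SB.
have ek k : `|Bh (e k) - B (e k)| <= tau * (2 / Num.sqrt (lam k)).
  have s0 : 0 < Num.sqrt (lam k) by rewrite sqrtr_gt0.
  have h1 : `|Bh (e k) - Num.sqrt (lam k) *: e k| <= tau / Num.sqrt (lam k).
    apply: (sqrt_near_eigen CB s0).
    rewrite sqr_sqrtr ?(ltW (lam0 k))// -Se; apply: le_trans (CS _) _.
    by rewrite e1 mulr1.
  have h2 : `|B (e k) - Num.sqrt (lam k) *: e k| <= tau / Num.sqrt (lam k).
    apply: (sqrt_near_eigen SB s0).
    by rewrite sqr_sqrtr ?(ltW (lam0 k))// -Se subrr normr0.
  rewrite (_ : _ - _ = (Bh (e k) - Num.sqrt (lam k) *: e k) -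
     (B (e k) - Num.sqrt (lam k) *: e k)); last by rewrite opprB addrA subrK.
  apply: le_trans (ler_normB _ _) _; apply: le_trans (lerD h1 h2) _.
  by rewrite le_eqVlt; apply/orP; left; apply/eqP; ring.
have -> : Bh v - B v = (Bh vn' - B vn') + (Bh (v - vn') - B (v - vn')).
  by rewrite (linB bBh.1) (linB bB.1) addrACA -opprD !subrKC.
apply: le_trans (ler_normD _ _) _; rewrite [e0]splitr; apply: lerD.
  apply: (@le_trans _ _ (tau * W)).
    rewrite /vn' (lin_sum bBh.1) (lin_sum bB.1) -sumrB.
    apply: le_trans (ler_norm_sum _ _ _) _; rewrite /W mulr_sumr.
    apply: ler_sum => k _; rewrite (linZ bBh.1) (linZ bB.1) -scalerBr normrZ.
    by rewrite mulrCA ler_wpM2l.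
  have : tau <= e0 / (2 * (W + 1)) by rewrite ge_min lexx orbT.
  rewrite ler_pdivlMr ?mulr_gt0//.
  nra.
apply: le_trans (ler_normB _ _) _.
have h : `|v - vn'| * (4 * K) <= e0 by rewrite -ler_pdivlMr ?mulr_gt0// ltW.
have := BhK (v - vn'); have := BK (v - vn'); lra.
Qed.

Lemma inv_sqrt_facts (C : H -> H) (c : R) : bounded_operator C ->
  self_adjoint C -> 0 < c -> (forall u, c * `|u| ^+ 2 <= inner (C u) u) ->
  let B := op_sqrt C in let Q := op_inv B in
  [/\ is_sqrt C B, forall v, B (Q v) = v, forall v, Q (B v) = v, linear Q &
      self_adjoint Q] /\ forall v, C (Q (Q v)) = v.
Proof.
move=> bC sC c0 Cc B Q.
have [BP BQ] : is_sqrt C B /\ (forall v, B (Q v) = v) := coercive_sqrt_inv bC sC c0 Cc.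
have [bB sB _ BC] := BP.
have Cinj := coercive_inj bC.1 c0 Cc.
have Binj : injective B by move=> x y xy; apply: Cinj; rewrite -!BC xy.
have QB v : Q (B v) = v by apply: Binj; rewrite BQ.
split; first split=> //.
- by move=> a u v; apply: Binj; rewrite BQ bB.1 !BQ.
- by move=> u v; rewrite -{2}(BQ u) sB BQ.
- by move=> v; rewrite -BC !BQ.
Qed.

End SqrtContinuity.

(** * From the regression operator to its singular vectors *)

Lemma pos_lower_bound (R : realType) (I : finType) (f : I -> R) :
  (forall i, 0 < f i) -> exists2 g, 0 < g & forall i, g <= f i.
Proof.
move=> f0; exists (\big[Num.min/1]_i f i); last by move=> i; apply: bigmin_le_cond.
by apply: lt_bigmin.
Qed.

Section Deterministic.
Variables (R : realType) (HX HY : hilbert R).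
Variables (S B : HX -> HX) (SXY Rop : HY -> HX).
Hypotheses (bS : bounded_operator S) (sS : self_adjoint S) (SB : is_sqrt S B).
Hypotheses (bSXY : bounded_operator SXY) (bR : bounded_operator Rop).
Hypothesis SR : forall g, S (Rop g) = SXY g.

Let T : HY -> HX := B \o Rop.
Let Ta : HX -> HY := adjoint T.

Lemma pop_bounded : bounded_operator T.
Proof.
have [bB _ _ _] := SB; split.
  by move=> a u v; rewrite /T /= bR.1 bB.1.
have [C C0 BC] := bounded_pos bB; have [D D0 RD] := bounded_pos bR.
exists (C * D) => u; apply: le_trans (BC _) _.
by rewrite -mulrA ler_wpM2l// ltW.
Qed.

Lemma pop_adjoint u v : inner (T u) v = inner u (Ta v).
Proof. exact: adjointP pop_bounded u v. Qed.

Lemma adjoint_linear (H K : hilbert R) (A : H -> K) : bounded_operator A ->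
  linear (adjoint A).
Proof.
move=> bA a u v; apply: inner_inj => w.
have e x : inner (adjoint A x) w = inner (A w) x by rewrite innerC adjointP.
by rewrite e !innerE !e.
Qed.

Lemma pop_inner u v : inner (T u) (T v) = inner (SXY u) (Rop v).
Proof. by case: SB => _ sB _ BB; rewrite /T /= -sB BB SR. Qed.

Variables (d : nat) (psi : 'I_d -> HX) (lam : 'I_d -> R).
Hypothesis psio : forall i j, inner (psi i) (psi j) = (i == j)%:R.
Hypothesis Mpsi : forall j, T (Ta (psi j)) = lam j *: psi j.
Hypothesis lamo : forall i j : 'I_d, (i <= j)%N -> lam j <= lam i.
Hypothesis top : forall (l : R) (u : HX), eigenpair (T \o Ta) l u ->
  (forall j, inner u (psi j) = 0) -> forall j, l <= lam j.
Hypothesis rT : has_rank T d.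
Hypothesis dist : distinct_nonzero_eigenvalues (T \o Ta).

Let phi := right_vector Ta psi lam.

Let lT : linear T := pop_bounded.1.
Let lTa : linear Ta := adjoint_linear pop_bounded.

Lemma pop_lam_gt0 j : 0 < lam j.
Proof. exact: (rank_pos_eigenvalues lT lTa pop_adjoint psio Mpsi lamo top rT). Qed.

(** The vector S^(-1/2) psi_j, in a form without square roots: T^* psi_j is an
    eigenvector of T^* T, where T = S^(1/2) Rop. *)
Definition pop_eta j : HX := (lam j)^-1 *: Rop (Ta (psi j)).

Lemma pop_etaE j : pop_eta j = (Num.sqrt (lam j))^-1 *: Rop (phi j).
Proof.
have lj := pop_lam_gt0 j.
rewrite /phi /right_vector (linZ bR.1) scalerA -invfM -expr2 sqr_sqrtr//.
exact: ltW.
Qed.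

Lemma pop_eta_sqrt j : B (pop_eta j) = psi j.
Proof.
have lj := pop_lam_gt0 j; have [bB _ _ _] := SB.
rewrite /pop_eta (linZ bB.1) -[B _]/(T (Ta (psi j))) Mpsi scalerA.
by rewrite mulVf ?scale1r// gt_eqF.
Qed.

Variables (e : nat -> HX) (lamS : nat -> R).
Hypotheses (lamS0 : forall k, 0 < lamS k) (Se : forall k, S (e k) = lamS k *: e k).
Hypothesis e1 : forall k, `|e k| = 1.
Hypothesis Re : forall g, exists c : nat -> R,
  \sum_(k < n) c k *: e k @[n --> \oo] --> Rop g.

(** The lower bound that [minmax_compare] asks for on spans of right singular
    vectors. *)
Lemma svd_span_lower (H K : hilbert R) (T' : H -> K) (Ta' : K -> H) d'
  (psi' : 'I_d' -> K) (lam' : 'I_d' -> R) n (f : 'I_n -> 'I_d') (l : R)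
  (a : 'I_n -> R) :
  linear T' -> linear Ta' ->
  (forall u v, inner (T' u) v = inner u (Ta' v)) ->
  (forall i j, inner (psi' i) (psi' j) = (i == j)%:R) ->
  (forall j, T' (Ta' (psi' j)) = lam' j *: psi' j) ->
  (forall j, 0 < lam' j) -> injective f -> (forall i, l <= lam' (f i)) ->
  l * `|\sum_i a i *: right_vector Ta' psi' lam' (f i)| ^+ 2 <=
  `|T' (\sum_i a i *: right_vector Ta' psi' lam' (f i))| ^+ 2.
Proof.
move=> lT' lTa' T'Ta' psio' Mpsi' lam0' finj lf.
rewrite orthonormal_sum_norm; last first.
  move=> i j; rewrite (right_vector_orthonormal T'Ta' psio' Mpsi')//.
  by rewrite (inj_eq finj).
rewrite (lin_sum lT').
rewrite (eq_bigr (fun i => (a i * Num.sqrt (lam' (f i))) *: psi' (f i))); last first.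
  by move=> i _; rewrite (linZ lT') (svd_right lT' Mpsi')// scalerA.
rewrite (orthonormal_sum_norm (x := psi' \o f)); last first.
  by move=> i j; rewrite /= psio' (inj_eq finj).
rewrite mulr_sumr; apply: ler_sum => i _.
rewrite exprMn (sqr_sqrtr (ltW (lam0' _))) [leRHS]mulrC.
by apply: ler_wpM2r; rewrite ?sqr_ge0.
Qed.

Definition sample_bound (eps D1 D2 : R) (Sh : HX -> HX) (SXYh : HY -> HX) :=
  let C := fun f => Sh f + eps *: f in
  let Q := op_inv (op_sqrt C) in
  [/\ forall u, `|Sh u - S u| <= D1 * `|u|,
      forall g, `|SXYh g - SXY g| <= D1 * `|g| &
      forall g, `|Q (Q (SXYh g)) - Rop g| <= D2 * `|g|].

(** Let T = B Rop and Th = C^(-1/2) SXYh.  Applying C^(-1/2) to the singular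
    relation Th phih_j = sqrt (lamh_j) psih_j gives
      C^(-1/2) psih_j = C^-1 SXYh phih_j / sqrt (lamh_j),
    where C^-1 SXYh is within D2 of Rop, while pop_eta j = Rop phi_j / sqrt (lam_j).
    The quadratic forms of Th^* Th and T^* T differ by O(D1 + D2), and so do lamh_j
    and lam_j, and phih_j and t phi_j for a sign t.

    The comparison only has to be sharp when D1 + D2 is small: the lower bound on
    lamh_j comes from D1 and eps alone, and it gives a bound that suffices when
    D1 + D2 stays away from 0.  The sign t is that of <phih_j, phi_j>; it is also
    that of <psih_j, psi_j> as soon as psih_j - t psi_j is small, and this follows
    by applying C^(1/2), which is strongly close to B. *)
Lemma deterministic_bound (j : 'I_d) : exists K kappa : R,
  [/\ 0 < K, 0 < kappa & forall (eps D1 D2 : R) (Sh : HX -> HX) (SXYh : HY -> HX)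
     m (b : 'I_m -> HX) (psih : 'I_d -> HX),
   let C := fun f => Sh f + eps *: f in
   let Q := op_inv (op_sqrt C) in
   let Th := fun g => Q (SXYh g) in
   0 < eps -> eps <= kappa -> 0 <= D1 -> D1 <= kappa -> 0 <= D2 ->
   bounded_operator Sh -> self_adjoint Sh -> (forall u, 0 <= inner (Sh u) u) ->
   bounded_operator SXYh ->
   (forall g, exists c : 'I_m -> R, SXYh g = \sum_i c i *: b i) ->
   sample_bound eps D1 D2 Sh SXYh ->
   first_eigenfunctions (fun f => Th (adjoint Th f)) psih ->
   `|Q (psih j) - Num.sg (inner (psih j) (psi j)) *: pop_eta j| <= K * (D1 + D2)].
Proof.
have [rho rho0 Rrho] := bounded_pos bR.
have [sig sig0 Ssig] := bounded_pos bS.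
have [sxy sxy0 SXYs] := bounded_pos bSXY.
have [bB sB B0 BB] := SB.
have lam0 := pop_lam_gt0.
have [m0 m00 m0lam] := pos_lower_bound lam0.
have [g g0 [gk gj]] : exists2 g : R, 0 < g &
    (forall k, k != j -> g <= `|lam k - lam j|) /\ g <= `|lam j|.
  have [|g g0 gP] := @pos_lower_bound _ _ (fun k => if k == j then lam j else `|lam k - lam j|).
    move=> k; case: ifPn => // kj; rewrite normr_gt0 subr_eq0.
    exact: (distinct_eigenvalues lT lTa pop_adjoint psio Mpsi lamo top rT dist kj).
  exists g => //; split; first by move=> k /negPf kj; have := gP k; rewrite kj.
  by have := gP j; rewrite eqxx ger0_norm// ltW.
have e40 : (0 : R) < 4^-1 by rewrite invr_gt0.
have [c ceta] : exists c : nat -> R, \sum_(k < n) c k *: e k @[n --> \oo] --> pop_eta j.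
  have [c cR] := Re (Ta (psi j)).
  exists (fun k => (lam j)^-1 * c k); rewrite /pop_eta.
  rewrite (_ : (fun n => _) = (fun n => (lam j)^-1 *: \sum_(k < n) c k *: e k)).
    by apply: cvgZ => //; exact: cvg_cst.
  by apply/funext => n; rewrite scaler_sumr; apply: eq_bigr => k _; rewrite scalerA.
have [tau tau0 tauP] := sqrt_strong bS SB lamS0 Se e1 ceta e40.
pose s := Num.sqrt (m0 / 2).
have s0 : 0 < s by rewrite sqrtr_gt0 divr_gt0.
pose q := 2 * rho + 2 * rho ^+ 2.
have q0 : 0 < q by rewrite addr_gt0// mulr_gt0// exprn_gt0.
pose kappa := Num.min 1 (Num.min (m0 / (2 * q)) (tau / 2)).
have kappa0 : 0 < kappa by rewrite !lt_min ltr01 !divr_gt0// mulr_gt0.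
have kappa1 : kappa <= 1 by rewrite ge_min lexx.
have kappaq : kappa * q <= m0 / 2.
  have : kappa <= m0 / (2 * q) by rewrite !ge_min lexx !orbT.
  by rewrite ler_pdivlMr ?mulr_gt0// ler_pdivlMr// (mulrC 2) mulrA.
have kappat : kappa + kappa <= tau.
  have : kappa <= tau / 2 by rewrite !ge_min lexx !orbT.
  by lra.
pose K1 := sxy + 1 + rho.
have K10 : 0 < K1 by rewrite !addr_gt0.
pose K2 := s^-1 + s^-1 * (rho * (4 * K1 / g)) + K1 / (2 * s ^+ 3) * rho.
have K20 : 0 <= K2.
  have si0 : 0 <= s^-1 by rewrite invr_ge0 ltW.
  have k1 : 0 <= rho * (4 * K1 / g) by rewrite mulr_ge0 ?divr_ge0 ?mulr_ge0// ltW.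
  have k2 : 0 <= K1 / (2 * s ^+ 3) * rho.
    by rewrite mulr_ge0 ?divr_ge0 ?mulr_ge0 ?exprn_ge0// ltW.
  by rewrite /K2 addr_ge0// addr_ge0// mulr_ge0.
pose c0 := (4 * (sig + 3) * (K2 + 1))^-1.
have sig3 : 0 < sig + 3 by rewrite addr_gt0.
have K21 : 0 < K2 + 1 by rewrite ltr_wpDl.
have c00 : 0 < c0 by rewrite invr_gt0 mulr_gt0 ?mulr_gt0.
pose K3 := s^-1 * (2 * rho / c0 + 1).
have K30 : 0 < K3.
  by rewrite mulr_gt0 ?invr_gt0// ltr_wpDl// divr_ge0 ?(ltW c00)// mulr_ge0// ltW.
exists (K2 + K3), kappa; split=> //; first by rewrite ltr_wpDl.
move=> eps D1 D2 Sh SXYh m b psih C Q Th eps0 epsk D10 D1k D20 bSh sSh Sh0 bSXYh SXYhb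
  [ShS SXYhS RhR] [lamh [psiho Mpsih lamho toph]].
have bC : bounded_operator C.
  split; first by move=> a u v; rewrite /C bSh.1 !scalerDr !scalerA (mulrC a) addrACA.
  have [M M0 ShM] := bounded_pos bSh; exists (M + eps) => u.
  apply: le_trans (ler_normD _ _) _; rewrite normrZ (ger0_norm (ltW eps0)) mulrDl.
  by rewrite lerD2r.
have sC : self_adjoint C by move=> u v; rewrite /C !innerE sSh.
have cC u : eps * `|u| ^+ 2 <= inner (C u) u.
  by rewrite /C !innerE inner_norm lerDr.
pose Bh := op_sqrt C.
have [[CB BQ QB lQ sQ] CQQ] : [/\ is_sqrt C Bh, forall v, Bh (Q v) = v,
    forall v, Q (Bh v) = v, linear Q & self_adjoint Q] /\ forall v, C (Q (Q v)) = v.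
  exact: inv_sqrt_facts bC sC eps0 cC.
have [bBh sBh Bh0 BhBh] := CB.
have QQ u v : inner (Q u) (Q v) = inner (Q (Q u)) v by rewrite -sQ.
have lTh : linear Th by move=> a u v; rewrite /Th bSXYh.1 lQ.
have bTh : bounded_operator Th.
  split=> //; have [M M0 SXYhM] := bounded_pos bSXYh.
  exists ((Num.sqrt eps)^-1 * M) => u.
  have se : 0 < Num.sqrt eps by rewrite sqrtr_gt0.
  rewrite -mulrA mulrC ler_pdivlMr// mulrC; apply: le_trans (SXYhM u).
  rewrite /Th; set v := SXYh u.
  rewrite -(@ler_pXn2r _ 2) ?nnegrE// ?mulr_ge0// ?sqrtr_ge0// exprMn sqr_sqrtr ?(ltW eps0)//.
  apply: le_trans (cC (Q v)) _.
  by rewrite -BhBh sBh BQ inner_norm.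
set Tha := adjoint Th in Mpsih toph.
have ThTha u v : inner (Th u) v = inner u (Tha v) := adjointP bTh u v.
have lTha : linear Tha := adjoint_linear bTh.
pose r := D1 + D2.
have r0 : 0 <= r by rewrite addr_ge0.
have D11 : D1 <= 1 by apply: le_trans kappa1.
(* |Bh w - Th u|^2 >= 0 with w = Rop u bounds |Th u|^2 from below by a quantity
   that involves no inverse of C *)
have low u : `|T u| ^+ 2 <= `|Th u| ^+ 2 + m0 / 2 * `|u| ^+ 2.
  set w := Rop u.
  have h1 : 2 * inner w (SXYh u) - inner (C w) w <= `|Th u| ^+ 2.
    have := inner_ge0 (Bh w - Th u).
    rewrite innerBl !innerBr (innerC (Th u) (Bh w)) -sBh.
    have -> : inner (Bh w) (Th u) = inner w (SXYh u) by rewrite sBh BQ.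
    by rewrite BhBh inner_norm; lra.
  have h2 : `|T u| ^+ 2 = 2 * inner w (SXY u) - inner (S w) w.
    rewrite -inner_norm pop_inner -/w SR (innerC w); ring.
  have h3 : - (D1 * rho * `|u| ^+ 2) <= inner w (SXYh u - SXY u).
    rewrite lerNl; apply: le_trans (ler_norm _) _; rewrite normrN.
    apply: le_trans (Cauchy_Schwarz _ _) _.
    apply: (@le_trans _ _ ((rho * `|u|) * (D1 * `|u|))).
      by apply: ler_pM; rewrite ?normr_ge0 ?Rrho ?SXYhS.
    by rewrite le_eqVlt; apply/orP; left; apply/eqP; ring.
  have h4 : inner (C w - S w) w <= (D1 + eps) * rho ^+ 2 * `|u| ^+ 2.
    apply: le_trans (ler_norm _) _; apply: le_trans (Cauchy_Schwarz _ _) _.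
    have h : `|C w - S w| <= (D1 + eps) * `|w|.
      rewrite /C addrAC; apply: le_trans (ler_normD _ _) _.
      by rewrite normrZ (ger0_norm (ltW eps0)) mulrDl lerD2r.
    apply: (@le_trans _ _ (((D1 + eps) * (rho * `|u|)) * (rho * `|u|))).
      apply: ler_pM; [by []|by []| |exact: Rrho].
      by apply: le_trans h _; rewrite ler_wpM2l ?Rrho// addr_ge0// ltW.
    by rewrite le_eqVlt; apply/orP; left; apply/eqP; ring.
  have h5 : 2 * (D1 * rho * `|u| ^+ 2) + (D1 + eps) * rho ^+ 2 * `|u| ^+ 2 <= m0 / 2 * `|u| ^+ 2.
    have -> : 2 * (D1 * rho * `|u| ^+ 2) + (D1 + eps) * rho ^+ 2 * `|u| ^+ 2 =
      (2 * D1 * rho + (D1 + eps) * rho ^+ 2) * `|u| ^+ 2 by ring.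
    rewrite ler_wpM2r ?sqr_ge0//; apply: le_trans kappaq.
    rewrite /q.
    have a1 : D1 * rho <= kappa * rho by rewrite ler_wpM2r// ltW.
    have a2 : (D1 + eps) * rho ^+ 2 <= (kappa + kappa) * rho ^+ 2.
      by rewrite ler_wpM2r ?sqr_ge0// lerD.
    move: a1 a2; rewrite !mulrDr !mulrDl; lra.
  move: h3 h4; rewrite innerBr innerBl; lra.
have qphi i k : inner (phi i) (phi k) = (i == k)%:R.
  exact: (right_vector_orthonormal pop_adjoint psio Mpsi k (lam0 i)).
have weyl_low (delta : R) (k : 'I_d) :
    (forall u, `|T u| ^+ 2 <= `|Th u| ^+ 2 + delta * `|u| ^+ 2) -> lam k <= lamh k + delta.
  move=> TTh.
  pose f (i : 'I_k.+1) : 'I_d := widen_ord (ltn_ord k) i.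
  have fi : injective f by move=> x y /(congr1 val)/= xy; exact: val_inj.
  apply: (@minmax_compare _ HY (fun u => `|T u| ^+ 2) (fun u => `|Th u| ^+ 2) _ _ _ k
    (fun i => phi (f i)) (fun i => Tha (psih (widen_ord (ltnW (ltn_ord k)) i)))) => //.
  - move=> a; apply: (svd_span_lower a lT lTa pop_adjoint psio Mpsi lam0 fi) => i.
    by apply: lamo; rewrite /f /= -ltnS.
  - move=> u uy.
    apply: (svd_rayleigh lTh lTha ThTha psiho Mpsih (b := Q \o b) _ lamho toph).
      move=> v; have [a va] := SXYhb v; exists a; rewrite /Th va (lin_sum lQ).
      by apply: eq_bigr => i _; rewrite (linZ lQ).
    move=> i ik; rewrite -(uy (Ordinal ik)); congr (inner _ (Tha (psih _))).
    exact: val_inj.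
have lamh0 k : m0 / 2 <= lamh k.
  have := weyl_low _ k low; have := m0lam k; lra.
have lamhp k : 0 < lamh k by apply: lt_le_trans (lamh0 k); rewrite divr_gt0.
pose phih := right_vector Tha psih lamh.
have qphih i k : inner (phih i) (phih k) = (i == k)%:R.
  exact: (right_vector_orthonormal ThTha psiho Mpsih k (lamhp i)).
have norm1 (H : hilbert R) (x : H) : inner x x = 1 -> `|x| = 1.
  by move=> h; apply/eqP; rewrite -(@eqrXn2 _ 2)// -inner_norm h expr1n.
have phih1 : `|phih j| = 1 by apply: norm1; rewrite qphih eqxx.
have phi1 : `|phi j| = 1 by apply: norm1; rewrite qphi eqxx.
have etahE : Q (psih j) = (Num.sqrt (lamh j))^-1 *: Q (Q (SXYh (phih j))).
  rewrite -[Q (SXYh _)]/(Th (phih j)) (svd_right lTh Mpsih (lamhp j)) (linZ lQ).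
  by rewrite scalerA mulVf ?scale1r// gt_eqF// sqrtr_gt0.
have sle (x : R) : m0 / 2 <= x -> s <= Num.sqrt x by exact: ler_wsqrtr.
have sh := sle _ (lamh0 j).
have sl : s <= Num.sqrt (lam j) by apply: sle; have := m0lam j; lra.
have shp : 0 < Num.sqrt (lamh j) by rewrite sqrtr_gt0.
have slp : 0 < Num.sqrt (lam j) by rewrite sqrtr_gt0.
have shi : (Num.sqrt (lamh j))^-1 <= s^-1 by rewrite lef_pV2.
have sli : (Num.sqrt (lam j))^-1 <= s^-1 by rewrite lef_pV2.
have etan : `|pop_eta j| <= s^-1 * rho.
  rewrite pop_etaE normrZ ger0_norm ?invr_ge0 ?sqrtr_ge0//.
  apply: ler_pM; rewrite ?invr_ge0 ?sqrtr_ge0 ?normr_ge0//.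
  by apply: le_trans (Rrho _) _; rewrite phi1 mulr1.
have [rc0|rc0] := ltP c0 r.
  (* r is bounded below, so bounded quantities are O(r) *)
  apply: le_trans (ler_normB _ _) _.
  have h1 : `|Q (psih j)| <= s^-1 * (rho + D2).
    rewrite etahE normrZ ger0_norm ?invr_ge0 ?sqrtr_ge0//.
    apply: ler_pM; rewrite ?invr_ge0 ?sqrtr_ge0 ?normr_ge0//.
    rewrite -(subrK (Rop (phih j)) (Q _)); apply: le_trans (ler_normD _ _) _.
    have := RhR (phih j); have := Rrho (phih j); rewrite phih1 !mulr1; lra.
  have h2 : `|Num.sg (inner (psih j) (psi j)) *: pop_eta j| <= s^-1 * rho.
    rewrite normrZ; apply: le_trans etan; rewrite ler_piMl//.
    by rewrite normr_sg lern1 leq_b1.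
  apply: le_trans (lerD h1 h2) _.
  apply: (@le_trans _ _ (K3 * r)); last by rewrite ler_wpM2r// lerDr.
  rewrite /K3 -mulrDr -mulrA ler_wpM2l ?invr_ge0 ?(ltW s0)//.
  have : 2 * rho <= 2 * rho / c0 * r.
    by rewrite -mulrA ler_peMr ?mulr_ge0 ?(ltW rho0)// mulrC ler_pdivlMr ?mul1r// ltW.
  rewrite mulrDl mul1r /r; lra.
pose delta := D2 * (sxy + D1) + rho * D1.
have deltar : delta <= K1 * r.
  rewrite /delta /K1 /r.
  have a1 : D2 * (sxy + D1) <= D2 * (sxy + 1) by rewrite ler_wpM2l// lerD2l.
  have a2 : 0 <= D1 * (sxy + 1) by rewrite mulr_ge0// addr_ge0// ltW.
  have a3 : 0 <= rho * D2 by rewrite mulr_ge0// ltW.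
  move: a1 a2 a3; rewrite !mulrDr !mulrDl; lra.
have delta0 : 0 <= delta by rewrite addr_ge0// mulr_ge0 ?addr_ge0// ltW.
have SXYhn v : `|SXYh v| <= (sxy + D1) * `|v|.
  rewrite -(subrK (SXY v) (SXYh v)); apply: le_trans (ler_normD _ _) _.
  by rewrite mulrDl addrC lerD.
have Ndiff u v : `|inner (Th u) (Th v) - inner (T u) (T v)| <= delta * `|u| * `|v|.
  rewrite pop_inner (innerC (SXY u)) /Th QQ.
  have -> : inner (Q (Q (SXYh u))) (SXYh v) - inner (Rop v) (SXY u) =
     inner (Q (Q (SXYh u)) - Rop u) (SXYh v) + inner (Rop u) (SXYh v - SXY v).
    rewrite innerBl innerBr (_ : inner (Rop u) (SXY v) = inner (Rop v) (SXY u)).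
      by ring.
    by rewrite -!SR -sS innerC.
  apply: le_trans (ler_normD _ _) _.
  rewrite /delta !mulrDl; apply: lerD.
    apply: le_trans (Cauchy_Schwarz _ _) _.
    apply: (@le_trans _ _ ((D2 * `|u|) * ((sxy + D1) * `|v|))).
      by apply: ler_pM; rewrite ?normr_ge0 ?RhR ?SXYhn.
    by rewrite le_eqVlt; apply/orP; left; apply/eqP; ring.
  apply: le_trans (Cauchy_Schwarz _ _) _.
  apply: (@le_trans _ _ ((rho * `|u|) * (D1 * `|v|))).
    by apply: ler_pM; rewrite ?normr_ge0 ?Rrho ?SXYhS.
  by rewrite le_eqVlt; apply/orP; left; apply/eqP; ring.
have qdiff u : `| `|Th u| ^+ 2 - `|T u| ^+ 2| <= delta * `|u| ^+ 2.
  by rewrite -!(inner_norm (_ : HX)) expr2 mulrA Ndiff.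
have lamlow : lam j <= lamh j + delta.
  apply: weyl_low => u; have := qdiff u; rewrite ler_norml => /andP[h _]; lra.
have lamup : lamh j <= lam j + delta.
  pose f (i : 'I_j.+1) : 'I_d := widen_ord (ltn_ord j) i.
  have fi : injective f by move=> x y /(congr1 val)/= xy; exact: val_inj.
  apply: (@minmax_compare _ HY (fun u => `|Th u| ^+ 2) (fun u => `|T u| ^+ 2) _ _ _ j
    (fun i => phih (f i)) (fun i => Ta (psi (widen_ord (ltnW (ltn_ord j)) i)))) => //.
  - move=> a; apply: (svd_span_lower a lTh lTha ThTha psiho Mpsih lamhp fi) => i.
    by apply: lamho; rewrite /f /= -ltnS.
  - move=> u uy.
    apply: (svd_rayleigh lT lTa pop_adjoint psio Mpsi (b := psi) _ lamo top).
      move=> v; exists (fun k => inner (T v) (psi k)).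
      exact: (rank_span_eigenvectors lT lTa pop_adjoint psio Mpsi lamo top rT).
    move=> i ik; rewrite -(uy (Ordinal ik)); congr (inner _ (Ta (psi _))).
    exact: val_inj.
  - by move=> u; have := qdiff u; rewrite ler_norml => /andP[_ h]; lra.
have lamdiff : `|lamh j - lam j| <= delta by rewrite ler_norml; apply/andP; split; lra.
have Nphih : `|Ta (T (phih j)) - lam j *: phih j| <= 2 * delta.
  have -> : Ta (T (phih j)) - lam j *: phih j =
     (Ta (T (phih j)) - Tha (Th (phih j))) + (lamh j - lam j) *: phih j.
    by rewrite (svd_eigen lTh lTha Mpsih (lamhp j)) scalerBl addrA subrK.
  apply: le_trans (ler_normD _ _) _; rewrite normrZ phih1 mulr1 mulr_natl mulr2n.
  apply: lerD => //; set z := _ - _.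
  have [->|z0] := eqVneq z 0; first by rewrite normr0.
  have zp : 0 < `|z| by rewrite normr_gt0.
  rewrite -(ler_pM2r zp) -expr2 -inner_norm {2}/z innerBr -pop_adjoint -ThTha.
  rewrite !(innerC (_ z)) -[X in X * _](mulr1 delta) -phih1.
  apply: le_trans (Ndiff (phih j) z); rewrite distrC; apply: ler_norm.
pose t : R := if 0 <= inner (phih j) (phi j) then 1 else -1.
have t1 : `|t| = 1 by rewrite /t; case: ifP; rewrite ?normrN1 ?normr1.
have phidiff : `|phih j - t *: phi j| <= 4 * delta / g.
  have := eigenvector_perturbation qphi
    (rank_gram_expansion lT lTa pop_adjoint psio Mpsi lamo top rT) g0 gk gj phih1 Nphih.
  by rewrite mulrA -natrM.
have etadiff : `|Q (psih j) - t *: pop_eta j| <= K2 * r.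
  rewrite etahE pop_etaE.
  set a := (Num.sqrt (lamh j))^-1; set a' := (Num.sqrt (lam j))^-1.
  have -> : a *: Q (Q (SXYh (phih j))) - t *: (a' *: Rop (phi j)) =
     a *: (Q (Q (SXYh (phih j))) - Rop (phih j)) + a *: (Rop (phih j - t *: phi j))
     + (t * (a - a')) *: Rop (phi j).
    move: (phih j) (phi j) => p1 p2; move: (Q (Q (SXYh p1))) => z.
    by rewrite (linB bR.1) (linZ bR.1); apply: inner_inj => w; rewrite !innerE; ring.
  have a0 : 0 <= a by rewrite invr_ge0 sqrtr_ge0.
  have h1 : `|a *: (Q (Q (SXYh (phih j))) - Rop (phih j))| <= s^-1 * r.
    rewrite normrZ ger0_norm//; apply: ler_pM => //.
    by apply: le_trans (RhR _) _; rewrite phih1 mulr1 /r lerDr.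
  have h2 : `|a *: (Rop (phih j - t *: phi j))| <= s^-1 * (rho * (4 * K1 / g)) * r.
    rewrite normrZ ger0_norm// -(mulrA s^-1); apply: ler_pM => //.
    apply: le_trans (Rrho _) _; rewrite -[leRHS]mulrA.
    apply: ler_wpM2l; first exact: ltW.
    apply: le_trans phidiff _; rewrite [leRHS]mulrAC.
    apply: ler_wpM2r; first by rewrite invr_ge0 ltW.
    by rewrite -[leRHS]mulrA; apply: ler_wpM2l.
  have h3 : `|(t * (a - a')) *: Rop (phi j)| <= K1 / (2 * s ^+ 3) * rho * r.
    rewrite normrZ normrM t1 mul1r mulrAC; apply: ler_pM => //; last first.
      by apply: le_trans (Rrho _) _; rewrite phi1 mulr1.
    pose x := Num.sqrt (lamh j); pose y := Num.sqrt (lam j).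
    have [x0 y0 sx sy] : [/\ 0 < x, 0 < y, s <= x & s <= y] by [].
    have xy : `|x - y| * (2 * s) <= delta.
      apply: le_trans lamdiff; rewrite -(sqr_sqrtr (ltW (lamhp j))) -(sqr_sqrtr (ltW (lam0 j))).
      rewrite -/x -/y subr_sqr normrM; apply: ler_wpM2l => //.
      rewrite ger0_norm; last by rewrite addr_ge0 ?ltW.
      by rewrite mulr_natl mulr2n lerD.
    have -> : a - a' = (y - x) / (x * y).
      by rewrite /a /a' -/x -/y; field; rewrite !gt_eqF.
    rewrite normrM normfV (ger0_norm (ltW (mulr_gt0 x0 y0))) distrC.
    rewrite ler_pdivrMr ?mulr_gt0//.
    have xys : s ^+ 2 <= x * y by rewrite expr2; apply: ler_pM; rewrite ?(ltW s0).
    have : `|x - y| <= K1 * r / (2 * s).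
      by rewrite ler_pdivlMr ?mulr_gt0//; apply: le_trans deltar.
    move=> h; apply: le_trans h _.
    rewrite (_ : K1 / (2 * s ^+ 3) * r * (x * y) = K1 * r / (2 * s) * (x * y / s ^+ 2)); last first.
      by field; rewrite gt_eqF.
    rewrite ler_peMr//; first by rewrite divr_ge0 ?mulr_ge0// ltW.
    by rewrite ler_pdivlMr ?mul1r// exprn_gt0.
  apply: le_trans (ler_normD _ _) _.
  have -> : K2 * r = s^-1 * r + s^-1 * (rho * (4 * K1 / g)) * r +
      K1 / (2 * s ^+ 3) * rho * r by rewrite /K2; ring.
  apply: lerD; last exact: h3.
  by apply: le_trans (ler_normD _ _) _; apply: lerD; [exact: h1 | exact: h2].
(* a distance at most 1/2 between unit vectors fixes the sign *)
have psidiff : `|psih j - t *: psi j| <= 1 / 2.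
  have -> : psih j - t *: psi j = Bh (Q (psih j) - t *: pop_eta j) +
      t *: (Bh (pop_eta j) - B (pop_eta j)).
    rewrite pop_eta_sqrt (linB bBh.1) (linZ bBh.1) BQ.
    move: (Bh (pop_eta j)) (psih j) (psi j) => z1 z2 z3.
    by apply: inner_inj => w; rewrite !innerE; ring.
  have CS u : `|C u - S u| <= tau * `|u|.
    rewrite /C addrAC; apply: le_trans (ler_normD _ _) _.
    rewrite normrZ (ger0_norm (ltW eps0)).
    apply: (@le_trans _ _ ((kappa + kappa) * `|u|)); last by rewrite ler_wpM2r.
    rewrite mulrDl; apply: lerD; last by rewrite ler_wpM2r.
    by apply: le_trans (ShS u) _; rewrite ler_wpM2r.
  have h2 := tauP C Bh CB CS.
  have h1 : `|Bh (Q (psih j) - t *: pop_eta j)| <= 4^-1.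
    have Cn u : `|C u| <= (sig + 2) * `|u|.
      rewrite -(subrK (S u) (C u)); apply: le_trans (ler_normD _ _) _.
      rewrite addrC mulrDl; apply: lerD => //.
      rewrite /C addrAC; apply: le_trans (ler_normD _ _) _.
      rewrite normrZ (ger0_norm (ltW eps0)) mulr_natl mulr2n.
      apply: lerD; last by rewrite ler_piMl// (le_trans epsk).
      by apply: le_trans (ShS u) _; rewrite ler_piMl.
    have sig2 : 0 <= sig + 2 by rewrite addr_ge0// ltW.
    apply: le_trans (sqrt_norm_le _ CB sig2 Cn) _.
    rewrite (_ : sig + 2 + 1 = sig + 3); last by ring.
    apply: (@le_trans _ _ ((sig + 3) * ((K2 + 1) * c0))).
      rewrite ler_wpM2l ?(ltW sig3)//; apply: le_trans etadiff _.
      by apply: ler_pM => //; rewrite lerDl.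
    rewrite /c0 le_eqVlt; apply/orP; left; apply/eqP; field.
    by rewrite !gt_eqF.
  apply: le_trans (ler_normD _ _) _; rewrite normrZ t1 mul1r; lra.
have psi1 : `|psi j| = 1 by apply: norm1; rewrite psio eqxx.
have psih1 : `|psih j| = 1 by apply: norm1; rewrite psiho eqxx.
have sgt : Num.sg (inner (psih j) (psi j)) = t.
  have : `|psih j - t *: psi j| ^+ 2 <= 1 / 4.
    rewrite (_ : 1 / 4 = (1 / 2) ^+ 2); last by field.
    by rewrite ler_pXn2r ?nnegrE.
  rewrite normB_sqr normrZ t1 psi1 psih1 innerZr mulr1 expr1n.
  rewrite /t; case: ifP => _ h; first by rewrite gtr0_sg//; lra.
  by rewrite ltr0_sg//; lra.
rewrite sgt; apply: le_trans etadiff _.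
by rewrite ler_wpM2r// lerDl ltW.
Qed.

End Deterministic.

(** * Resolvent expansion and spectral calculus *)

Section Resolvent.
Variables (R : realType) (H K : hilbert R).

Lemma coercive_lower (C : H -> H) (eps : R) u : 0 < eps ->
  (forall u, eps * `|u| ^+ 2 <= inner (C u) u) -> `|u| <= `|C u| / eps.
Proof.
move=> eps0 Cc; rewrite ler_pdivlMr//.
have [->|u0] := eqVneq u 0; first by rewrite normr0 mul0r.
have p : 0 < `|u| by rewrite normr_gt0.
rewrite -(ler_pM2r p) mulrAC -expr2 mulrC; apply: le_trans (Cc u) _.
by apply: le_trans (ler_norm _) _; exact: Cauchy_Schwarz.
Qed.

(** With y = Rop g - eps A Rop g = A (SXY g) and
    z = (SXYh g - SXY g) - (Sh y - S y) one has C (x - y) = z, and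
    C^-1 z = A z - C^-1 (Sh - S) A z.  The sampling errors thus only occur behind the
    population resolvent A, except for a factor |C^-1 (Sh - S)| <= D1 / eps. *)
Lemma resolvent_bound (S Sh A : H -> H) (SXY SXYh Rop : K -> H)
    (eps rho D1 E b0 : R) (x g : _) :
  let C := fun f => Sh f + eps *: f in
  0 < eps -> 0 <= D1 -> 0 <= E -> linear Sh -> linear S -> linear A ->
  (forall u, 0 <= inner (Sh u) u) ->
  (forall f, A (S f + eps *: f) = f) -> (forall f, S (A f) + eps *: A f = f) ->
  (forall g, S (Rop g) = SXY g) ->
  (forall f, `|Sh f - S f| <= D1 * `|f|) ->
  (forall f, `|A (Sh f - S f)| <= E * `|f|) ->
  (forall g, `|A (SXYh g - SXY g)| <= E * `|g|) ->
  (forall g, `|Rop g| <= rho * `|g|) ->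
  (forall g, `|eps *: A (Rop g)| <= b0 * `|g|) ->
  C x = SXYh g ->
  `|x - Rop g| <= ((1 + D1 / eps) * (E * (1 + rho + b0)) + b0) * `|g|.
Proof.
move=> C eps0 D10 E0 lSh lS lA Sh0 AS SA SR ShS AXX AXY Rrho Rb Cx.
have cC u : eps * `|u| ^+ 2 <= inner (C u) u by rewrite /C innerDl innerZl inner_norm lerDr.
have lC : linear C by move=> a u v; rewrite /C lSh !scalerDr !scalerA (mulrC a) addrACA.
pose y := Rop g - eps *: A (Rop g).
have yn : `|y| <= (rho + b0) * `|g|.
  by apply: le_trans (ler_normB _ _) _; rewrite mulrDl lerD.
have Sy : S y + eps *: y = SXY g.
  rewrite /y (linB lS) (linZ lS) scalerBr SR addrACA -opprD -scalerDr SA.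
  by rewrite addrK.
pose z := (SXYh g - SXY g) - (Sh y - S y).
have Az : `|A z| <= E * (1 + rho + b0) * `|g|.
  rewrite /z (linB lA); apply: le_trans (ler_normB _ _) _.
  have h1 := AXY g; have h2 := AXX y.
  have h3 : E * `|y| <= E * ((rho + b0) * `|g|) by rewrite ler_wpM2l.
  have -> : E * (1 + rho + b0) * `|g| = E * `|g| + E * ((rho + b0) * `|g|) by ring.
  lra.
pose x' := x - y - A z.
have Cx' : C x' = - (Sh (A z) - S (A z)).
  have Cy : C y = SXY g + (Sh y - S y).
    rewrite -Sy /C; move: (Sh y) (S y) (eps *: y) => z1 z2 z3.
    by rewrite [RHS]addrC addrA subrK.
  have CA : C (A z) = z + (Sh (A z) - S (A z)).
    by rewrite -[X in X + _](SA z) [RHS]addrC addrA subrK.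
  rewrite /x' (linB lC (x - y)) (linB lC x y) Cx Cy CA; move: (Sh (A z)) (S (A z)) => z5 z6.
  rewrite /z; move: (SXYh g) (SXY g) (Sh y) (S y) => z1 z2 z3 z4.
  by apply: inner_inj => w; rewrite !(innerDl, innerBl, innerNl); ring.
have x'n : `|x'| <= D1 / eps * `|A z|.
  apply: le_trans (coercive_lower x' eps0 cC) _; rewrite Cx' normrN mulrAC.
  by rewrite ler_wpM2r ?invr_ge0 ?(ltW eps0).
have -> : x - Rop g = x' + A z - eps *: A (Rop g).
  rewrite /x' /y subrK; move: (A (Rop g)) (Rop g) => z1 z2.
  by apply: inner_inj => w; rewrite !innerE; ring.
apply: le_trans (ler_normB _ _) _; rewrite [leRHS]mulrDl; apply: lerD => //.
apply: le_trans (ler_normD _ _) _.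
apply: (@le_trans _ _ ((1 + D1 / eps) * `|A z|)).
  by rewrite mulrDl mul1r addrC lerD.
rewrite -[leRHS]mulrA; apply: ler_wpM2l; last exact: Az.
by rewrite addr_ge0// divr_ge0// ltW.
Qed.

End Resolvent.

Section DiagonalCalculus.
Variables (R : realType) (H : hilbert R) (e : nat -> H).
Hypothesis eo : quasi_orthonormal e.

Lemma diag_op_add c c' D D' : diag_op e c D -> diag_op e c' D' ->
  diag_op e (fun j => c j + c' j) (fun u => D u + D' u).
Proof.
move=> dD dD' u; rewrite (_ : (fun n => _) = (fun n =>
    \sum_(j < n) c j *: tensor (e j) (e j) u +
    \sum_(j < n) c' j *: tensor (e j) (e j) u)).
  by apply: cvgD; [exact: dD | exact: dD'].
by apply/funext => n; rewrite -big_split/=; apply: eq_bigr => j _; rewrite scalerDl.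
Qed.

Lemma diag_op_scale a c D : diag_op e c D ->
  diag_op e (fun j => a * c j) (fun u => a *: D u).
Proof.
move=> dD u; rewrite (_ : (fun n => _) = (fun n =>
    a *: \sum_(j < n) c j *: tensor (e j) (e j) u)).
  by apply: cvgZ; [exact: cvg_cst | exact: dD].
by apply/funext => n; rewrite scaler_sumr; apply: eq_bigr => j _; rewrite scalerA.
Qed.

Lemma mp_inv_eq (K : hilbert R) (A : H -> K) u v : linear A -> A u = v ->
  (forall z, A z = 0 -> inner u z = 0) -> mp_inv A v = u.
Proof.
move=> lA Au up; rewrite /mp_inv; case: xgetP => [w _ /= [Aw wp]|/(_ u)[]//].
apply/eqP; rewrite -subr_eq0; apply/eqP/inner_eq0.
have Awu : A (w - u) = 0 by rewrite (linB lA) Au Aw subrr.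
by rewrite {1}innerBl wp// up// subrr.
Qed.

End DiagonalCalculus.

Section SpectralOperator.
Variables (R : realType) (H : hilbert R) (S : H -> H).

Lemma spectral_quasi lam e : spectral_decomposition S lam e -> quasi_orthonormal e.
Proof. by case=> eo _ _; exact: orthonormal_quasi. Qed.

Lemma spectral_diag_op lam e : spectral_decomposition S lam e -> diag_op e lam S.
Proof. by case. Qed.

Lemma spectral_norm1 lam e j : spectral_decomposition S lam e -> `|e j| = 1.
Proof.
by case=> eo _ _; apply/eqP; rewrite -(@eqrXn2 _ 2)// -inner_norm eo eqxx expr1n.
Qed.

Lemma spectral_le lam e (M : R) j : spectral_decomposition S lam e ->
  (forall u, `|S u| <= M * `|u|) -> lam j <= M.
Proof.
move=> sd SM; have := SM (e j); rewrite (diag_op_vec (spectral_quasi sd) (spectral_diag_op sd)).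
rewrite normrZ (spectral_norm1 j sd) !mulr1; apply: le_trans; exact: ler_norm.
Qed.

(** [op_pow] chooses among all the spectral decompositions of S, so that the one
    it is computed with may differ from the given one. *)
Lemma op_powP (M s : R) lam e : 0 <= s -> (forall u, `|S u| <= M * `|u|) ->
  spectral_decomposition S lam e ->
  exists lam' e', spectral_decomposition S lam' e' /\
    diag_op e' (fun j => lam' j `^ s) (op_pow S s).
Proof.
move=> s0 SM sd; rewrite /op_pow; case: xgetP => [B _ []|].
  by move=> lam' [e' [sd' h]]; exists lam', e'.
have lam0 : forall j, 0 <= lam j by case: sd.
have M0 : 0 <= M by apply: le_trans (lam0 0%N) (spectral_le _ sd SM).
have [|D dD] := @diag_op_ex _ _ _ (spectral_quasi sd) (fun j => lam j `^ s) (M `^ s).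
  move=> j; rewrite ger0_norm ?powR_ge0//; apply: ge0_ler_powR => //.
  - exact: lam0.
  - exact: spectral_le sd SM.
by move=> /(_ D) []; exists lam, e; split.
Qed.

Lemma spectral_sqrt (M : R) lam e : (forall u, `|S u| <= M * `|u|) ->
  spectral_decomposition S lam e -> exists B, is_sqrt S B.
Proof.
move=> SM sd; have eo := spectral_quasi sd.
have lam0 : forall j, 0 <= lam j by case: sd.
have cM j : `|Num.sqrt (lam j)| <= Num.sqrt M.
  by rewrite ger0_norm ?sqrtr_ge0// ler_wsqrtr// (spectral_le _ sd SM).
have [D dD] := diag_op_ex eo cM; exists D; split.
- by apply: (diag_op_bounded eo (C := Num.sqrt M) _ dD) => j; exact: cM.
- exact: diag_op_self_adjoint dD.
- by move=> u; apply: (diag_op_ge0 dD) => j; rewrite sqrtr_ge0.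
- move=> u; have h := @diag_op_comp _ _ _ eo _ _ _ _ dD dD.
  have h' : diag_op e lam (D \o D).
    by apply: diag_op_ext h => j; rewrite -expr2 sqr_sqrtr.
  by rewrite (diag_op_unique (spectral_diag_op sd) h').
Qed.

(** The part of u orthogonal to all the e_k is in the kernel of S, hence
    orthogonal to u. *)
Lemma spectral_span lam e u : spectral_decomposition S lam e ->
  (forall z, S z = 0 -> inner u z = 0) ->
  \sum_(k < n) inner u (e k) *: e k @[n --> \oo] --> u.
Proof.
move=> sd up; have eo := spectral_quasi sd.
have [|D dD] := @diag_op_ex _ _ _ eo (fun=> 1) 1; first by move=> j; rewrite normr1.
have Du : D u = u.
  apply/eqP; rewrite eq_sym -subr_eq0; apply/eqP/inner_eq0; set w := u - D u.
  have we j : inner w (e j) = 0.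
    by rewrite innerBl (diag_op_coef eo dD) mul1r subrr.
  rewrite {1}/w innerBl up; last exact: diag_op_perp (spectral_diag_op sd) _ we.
  by rewrite (diag_op_self_adjoint dD) (diag_op_perp dD we) inner0r subrr.
rewrite -{2}Du; have := @dD u.
by under eq_fun do under eq_bigr do rewrite diag_term mul1r.
Qed.

End SpectralOperator.

(** * Bias exponent and effective dimension *)

Section Exponents.
Variable R : realType.
Implicit Types (l M eps beta alpha : R).

(** For beta <= 1, eps^(1 - beta) l^beta <= max(eps, l); for beta > 1,
    l^beta <= l M^(beta - 1). *)
Lemma powR_bias l M eps beta : 0 <= l -> l <= M -> 1 <= M -> 0 < eps -> 0 < beta ->
  eps * l `^ beta / (l + eps) <= M `^ beta * eps `^ (Num.min beta 1).
Proof.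
move=> l0 lM M1 eps0 beta0.
have le0 : 0 < l + eps by rewrite ltr_wpDl.
have M0 : 0 <= M by exact: le_trans M1.
have Mb : 1 <= M `^ beta.
  have <- : 1 `^ beta = 1 :> R by rewrite powR1.
  by apply: ge0_ler_powR; rewrite ?nnegrE ?(ltW beta0).
rewrite ler_pdivrMr//.
have [b1|b1] := leP beta 1.
  apply: (@le_trans _ _ (eps `^ beta * (l + eps))); last first.
    by rewrite ler_wpM2r ?(ltW le0)// ler_peMl// powR_ge0.
  have [le|el] := leP l eps.
    apply: (@le_trans _ _ (eps * eps `^ beta)).
      rewrite ler_wpM2l ?(ltW eps0)//.
      by apply: ge0_ler_powR; rewrite ?nnegrE// ltW.
    by rewrite mulrC ler_wpM2l ?powR_ge0// lerDr.
  have lp : 0 < l by exact: lt_trans eps0 el.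
  have -> : eps * l `^ beta = eps `^ beta * (eps `^ (1 - beta) * l `^ beta).
    by rewrite mulrA -powRD ?(gt_eqF eps0) ?implybT// [beta + _]addrC subrK powRr1// ltW.
  rewrite ler_wpM2l ?powR_ge0//.
  apply: (@le_trans _ _ (l `^ (1 - beta) * l `^ beta)).
    rewrite ler_wpM2r ?powR_ge0//.
    by apply: ge0_ler_powR; rewrite ?nnegrE ?subr_ge0// ltW.
  rewrite -powRD ?(gt_eqF lp) ?implybT// subrK powRr1//.
  by rewrite lerDl ltW.
rewrite powRr1 ?(ltW eps0)// mulrAC [leLHS]mulrC ler_wpM2r ?(ltW eps0)//.
rewrite -(mulr_powRB1 l0 beta0) mulrC.
apply: ler_pM; rewrite ?powR_ge0//; last by rewrite lerDl ltW.
apply: (@le_trans _ _ (M `^ (beta - 1))).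
  by apply: ge0_ler_powR; rewrite ?nnegrE ?subr_ge0// ltW.
by apply: ler_powR => //; rewrite gerBl.
Qed.

(** (x / y)^(1 - alpha) = exp (- (alpha - 1) ln (x / y)) >= 1 + (alpha - 1) / y for
    y = x + 1, by exp t >= 1 + t and ln t <= t - 1.  This bounds the tails of
    sum_k k^(-alpha) by telescoping. *)
Lemma powR_telescope (x alpha : R) : 0 < x -> 1 < alpha ->
  (alpha - 1) * (x + 1) `^ (- alpha) <= x `^ (1 - alpha) - (x + 1) `^ (1 - alpha).
Proof.
move=> x0 a1; have y0 : 0 < x + 1 by rewrite addr_gt0.
have yN : x + 1 != 0 by rewrite gt_eqF.
set y := x + 1 in y0 yN *.
have e1 : y `^ (- alpha) = y `^ (1 - alpha) / y.
  by rewrite -[X in _ / X](powRr1 (ltW y0)) -powRB ?yN ?implybT//; congr (_ `^ _); ring.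
have e2 : x `^ (1 - alpha) = y `^ (1 - alpha) * (x / y) `^ (1 - alpha).
  rewrite -powRM ?divr_ge0 ?(ltW y0) ?(ltW x0)//; congr (_ `^ _).
  by field.
have e3 : 1 + (alpha - 1) / y <= (x / y) `^ (1 - alpha).
  have xy0 : 0 < x / y by rewrite divr_gt0.
  rewrite /powR gt_eqF//.
  apply: le_trans (expR_ge1Dx _); rewrite lerD2l.
  have : ln (x / y) <= - y^-1.
    have := @le_ln1Dx R (- y^-1).
    have -> : 1 + - y^-1 = x / y by rewrite /y; field.
    apply; rewrite ltrN2 invf_lt1// /y ltrDr//.
  have a0 : 0 <= alpha - 1 by rewrite subr_ge0 ltW.
  move=> /(ler_wpM2l a0); rewrite mulrN -/(_ / y); lra.
rewrite e1 e2; have := ler_wpM2l (powR_ge0 y (1 - alpha)) e3.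
set a := y `^ _; set b := (x / y) `^ _.
by rewrite mulrDr mulr1 mulrCA; lra.
Qed.

(** The terms are at most eps^-1 min(1, lam k / eps).  The first bound is used
    for k up to K0 ~ eps^(-1/alpha), where lam k becomes of order eps, and the second
    one beyond. *)
Lemma trace_sum_bound (C alpha : R) (lam : nat -> R) : 1 < alpha -> 0 <= C ->
  (forall k, 0 <= lam k) ->
  (forall k, lam k <= C * k.+1%:R `^ (- alpha)) ->
  exists2 Kt, 0 < Kt & forall eps n, 0 < eps -> eps <= 1 ->
    \sum_(k < n) lam k / (lam k + eps) ^+ 2 <=
    Kt * (eps `^ (- ((alpha + 1) / (2 * alpha)))) ^+ 2.
Proof.
move=> a1 C0 lam0 lamC.
have am0 : 0 < alpha - 1 by rewrite subr_gt0.
have ap : 0 < alpha by exact: lt_trans a1.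
exists (2 + C / (alpha - 1)); first by rewrite ltr_wpDr ?divr_ge0// ltW.
move=> eps n eps0 eps1.
pose x0 := eps `^ (- alpha^-1).
have x01 : 1 <= x0.
  rewrite /x0 powRN -[leLHS]invr1 lef_pV2 ?posrE ?powR_gt0//.
  have <- : 1 `^ alpha^-1 = 1 :> R by rewrite powR1.
   apply: ge0_ler_powR; rewrite ?nnegrE ?invr_ge0// ltW//.
have x0p : 0 < x0 by exact: lt_le_trans x01.
pose K0 := (Num.truncn x0).+1.
have K0l : x0 <= K0%:R by apply: ltW; exact: truncnS_gt.
have K0u : K0%:R <= 2 * x0.
  rewrite /K0 -addn1 natrD mulr_natl mulr2n lerD//.
  by rewrite truncn_le ltW.
pose tau k : R := k%:R `^ (1 - alpha).
have term k : lam k / (lam k + eps) ^+ 2 <= eps^-1 * (if (k < K0)%N then 1 else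
    C / eps * ((tau k - tau k.+1) / (alpha - 1))).
  have le0 : 0 < lam k + eps by rewrite ltr_wpDl.
  have -> : lam k / (lam k + eps) ^+ 2 = (lam k + eps)^-1 * (lam k / (lam k + eps)).
    by field; rewrite gt_eqF.
  apply: ler_pM; rewrite ?invr_ge0 ?divr_ge0 ?(ltW le0)//.
    by rewrite lef_pV2 ?posrE// lerDr.
  case: ltnP => kK; first by rewrite ler_pdivrMr// mul1r lerDl ltW.
  apply: (@le_trans _ _ (lam k / eps)).
    by rewrite ler_wpM2l// lef_pV2 ?posrE// lerDr.
  rewrite mulrAC ler_wpM2r ?invr_ge0 ?(ltW eps0)//.
  apply: le_trans (lamC k) _; rewrite ler_wpM2l// ler_pdivlMr// mulrC.
  have k0 : (0 : R) < k%:R by rewrite ltr0n (leq_trans _ kK).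
  by have := powR_telescope k0 a1; rewrite natr1.
have sumb m : \sum_(k < m) (if (k < K0)%N then 1 else
    C / eps * ((tau k - tau k.+1) / (alpha - 1))) =
    (minn m K0)%:R + C / eps * ((tau K0 - tau (maxn m K0)) / (alpha - 1)).
  elim: m => [|m IH]; first by rewrite big_ord0 min0n max0n subrr mul0r mulr0 addr0.
  rewrite big_ord_recr/= IH; case: ltnP => mK.
    rewrite (minn_idPl mK) (maxn_idPr mK).
    by rewrite subrr mul0r mulr0 !addr0 natr1.
  rewrite (minn_idPr (leqW mK)) (maxn_idPl (leqW mK)).
  by rewrite -addrA -mulrDr -mulrDl addrA subrK.
apply: (@le_trans _ _ (eps^-1 * (K0%:R + C / eps * (tau K0 / (alpha - 1))))).
  apply: (le_trans (ler_sum _ (fun (i : 'I_n) _ => term i))).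
  rewrite -mulr_sumr ler_wpM2l ?invr_ge0 ?(ltW eps0)// sumb lerD//.
    by rewrite ler_nat geq_minr.
  rewrite ler_wpM2l ?divr_ge0 ?(ltW eps0)// ler_wpM2r ?invr_ge0 ?(ltW am0)//.
  by rewrite gerBl powR_ge0.
have tK : tau K0 <= eps * x0.
  apply: (@le_trans _ _ (x0 `^ (1 - alpha))).
    rewrite /tau -[1 - alpha]opprB !powRN lef_pV2 ?posrE ?powR_gt0//.
    by apply: ge0_ler_powR; rewrite ?nnegrE ?(ltW am0) ?(ltW x0p).
  rewrite /x0 -powRrM -{2}(powRr1 (ltW eps0)) -powRD ?(gt_eqF eps0) ?implybT//.
  rewrite le_eqVlt; apply/orP; left; apply/eqP; congr (_ `^ _).
  by field; rewrite gt_eqF.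
have -> : (eps `^ (- ((alpha + 1) / (2 * alpha)))) ^+ 2 = eps^-1 * x0.
  rewrite -powR_mulrn ?powR_ge0// -powRrM /x0 -(powR_inv1 (ltW eps0)) -powRD ?(gt_eqF eps0) ?implybT//.
  by congr (_ `^ _); field; rewrite gt_eqF.
rewrite [leRHS]mulrCA ler_wpM2l ?invr_ge0 ?(ltW eps0)// mulrDl lerD//.
rewrite [leRHS](_ : _ = C / eps * ((eps * x0) / (alpha - 1))); last first.
  by field; rewrite !gt_eqF.
by rewrite ler_wpM2l ?divr_ge0 ?(ltW eps0)// ler_wpM2r ?invr_ge0 ?(ltW am0).
Qed.

End Exponents.

(** * Expectations of bounded random variables *)

Section Expectation.
Context d (T : measurableType d) (R : realType) (P : probability T R).
Implicit Types f g : T -> R.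

Definition bmf f := measurable_fun [set: T] f /\ exists M : R, forall w, `|f w| <= M.

Definition Ex f : R := \int[P]_(w in [set: T]) f w.

Lemma bmf_integrable f : bmf f -> P.-integrable [set: T] (EFin \o f).
Proof.
move=> [mf [M fM]]; apply: measurable_bounded_integrable => //.
  by rewrite (le_lt_trans (probability_le1 _ _))// ltry.
by exists M; split; rewrite ?num_real// => x Mx w _; apply: le_trans (fM w) (ltW Mx).
Qed.

Lemma bmf_cst (c : R) : bmf (fun=> c).
Proof. by split; [exact: measurable_cst | exists `|c|]. Qed.

Lemma bmfD f g : bmf f -> bmf g -> bmf (fun w => f w + g w).
Proof.
move=> [mf [M fM]] [mg [N gN]]; split; first exact: measurable_funD.
by exists (M + N) => w; apply: le_trans (ler_normD _ _) _; exact: lerD.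
Qed.

Lemma bmfM f g : bmf f -> bmf g -> bmf (fun w => f w * g w).
Proof.
move=> [mf [M fM]] [mg [N gN]]; split; first exact: measurable_funM.
by exists (M * N) => w; rewrite normrM; apply: ler_pM.
Qed.

Lemma bmfZ c f : bmf f -> bmf (fun w => c * f w).
Proof. by move=> bf; apply: bmfM => //; exact: bmf_cst. Qed.

Lemma bmfB f g : bmf f -> bmf g -> bmf (fun w => f w - g w).
Proof.
move=> bf bg; rewrite (_ : (fun w => _) = (fun w => f w + (-1) * g w)).
  by apply: bmfD => //; exact: bmfZ.
by apply/funext => w; rewrite mulN1r.
Qed.

Lemma bmf_sqr f : bmf f -> bmf (fun w => f w ^+ 2).
Proof. by move=> bf; rewrite (_ : (fun w => _) = (fun w => f w * f w))//; exact: bmfM. Qed.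

Lemma bmf_sum I (r : seq I) (F : I -> T -> R) : (forall i, bmf (F i)) ->
  bmf (fun w => \sum_(i <- r) F i w).
Proof.
move=> bF; elim: r => [|i r IH].
  rewrite (_ : (fun w => _) = fun=> 0); first exact: bmf_cst.
  by apply/funext => w; rewrite big_nil.
rewrite (_ : (fun w => _) = (fun w => F i w + \sum_(j <- r) F j w)); first exact: bmfD.
by apply/funext => w; rewrite big_cons.
Qed.

Lemma Ex_cst (c : R) : Ex (fun=> c) = c.
Proof.
rewrite /Ex Rintegral_cst//; have h := probability_setT P.
by rewrite [X in fine X]h mulr1.
Qed.

Lemma ExD f g : bmf f -> bmf g -> Ex (fun w => f w + g w) = Ex f + Ex g.
Proof. by move=> bf bg; rewrite /Ex RintegralD//; exact: bmf_integrable. Qed.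

Lemma ExZ c f : bmf f -> Ex (fun w => c * f w) = c * Ex f.
Proof. by move=> bf; rewrite /Ex RintegralZl//; exact: bmf_integrable. Qed.

Lemma ExB f g : bmf f -> bmf g -> Ex (fun w => f w - g w) = Ex f - Ex g.
Proof. by move=> bf bg; rewrite /Ex RintegralB//; exact: bmf_integrable. Qed.

Lemma Ex_sum I (r : seq I) (F : I -> T -> R) : (forall i, bmf (F i)) ->
  Ex (fun w => \sum_(i <- r) F i w) = \sum_(i <- r) Ex (F i).
Proof.
move=> bF; elim: r => [|i r IH].
  rewrite big_nil -[RHS](Ex_cst 0); congr Ex.
  by apply/funext => w; rewrite big_nil.
rewrite big_cons -IH -ExD//; last exact: bmf_sum.
by congr Ex; apply/funext => w; rewrite big_cons.
Qed.

Lemma Ex_le f g : bmf f -> bmf g -> (forall w, f w <= g w) -> Ex f <= Ex g.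
Proof.
by move=> bf bg fg; apply: le_Rintegral => //; exact: bmf_integrable.
Qed.

Lemma Ex_ge0 f : (forall w, 0 <= f w) -> 0 <= Ex f.
Proof. by move=> f0; exact: Rintegral_ge0. Qed.

Lemma Ex_EFin f : bmf f -> (\int[P]_w (f w)%:E)%E = (Ex f)%:E.
Proof.
by move=> bf; rewrite /Ex /Rintegral fineK// integrable_fin_num//; exact: bmf_integrable.
Qed.

Lemma bounded_markov f (c t : R) : bmf f -> (forall w, 0 <= f w) -> Ex f <= c -> 0 < t ->
  (P [set w | (t < f w)%R] <= (c / t)%:E)%E.
Proof.
move=> bf f0 fc t0.
have mA : measurable [set w | t < f w].
  rewrite (_ : [set w | _] = f @^-1` `]t, +oo[%classic); last first.
    by apply/seteqP; split=> w /=; rewrite in_itv/= andbT.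
  by rewrite -[X in measurable X]setTI; apply: bf.1.
have bI : bmf (\1_[set w | t < f w] : T -> R).
  by split=> //; exists 1 => w; rewrite indicE; case: (_ \in _); rewrite ?normr1 ?normr0.
have h : t * Ex (\1_[set w | t < f w]) <= c.
  rewrite -ExZ//; apply: le_trans fc; apply: Ex_le => //; first exact: bmfZ.
  move=> w; rewrite indicE; have [|] := boolP (w \in _).
    by rewrite inE /= mulr1 => /ltW.
  by rewrite mulr0.
have -> : P [set w | t < f w] = (Ex (\1_[set w | t < f w]))%:E.
  by rewrite -Ex_EFin// integral_indic// setIT.
by rewrite lee_fin ler_pdivlMr// mulrC.
Qed.

(** The events {t < W n} increase with n, so that continuity from below of P
    passes Markov's inequality to their union, and only finite sums have to be
    integrated. *)
Lemma increasing_markov (W : nat -> T -> R) (c t : R) :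
  (forall n, bmf (W n)) -> (forall n w, 0 <= W n w) ->
  (forall n w, W n w <= W n.+1 w) -> (forall n, Ex (W n) <= c) -> 0 < t ->
  exists A, [/\ measurable A, (P A <= (c / t)%:E)%E &
    forall w, ~ A w -> forall n, W n w <= t].
Proof.
move=> bW W0 Winc Wc t0.
pose F n := [set w | t < W n w].
have mF n : measurable (F n).
  rewrite (_ : F n = W n @^-1` `]t, +oo[%classic); last first.
    by apply/seteqP; split=> w /=; rewrite in_itv/= andbT.
  by rewrite -[X in measurable X]setTI; apply: (bW n).1.
have mU : measurable (\bigcup_n F n) by exact: bigcup_measurable.
exists (\bigcup_n F n); split=> //.
  have ndF : nondecreasing_seq F.
    apply/nondecreasing_seqP => n; apply/subsetPset => w /= h.
    exact: lt_le_trans (Winc n w).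
  have := nondecreasing_cvg_mu (mu := P) mF mU ndF.
  move=> h; rewrite -(cvg_lim _ h)//; apply: lime_le; first exact: cvgP h.
  by apply: nearW => n; exact: bounded_markov.
move=> w nA n; rewrite leNgt; apply/negP => h; apply: nA; by exists n.
Qed.

End Expectation.

Section WeakExpectation.
Context d (T : measurableType d) (R : realType) (P : probability T R).
Variables (H : hilbert R).

Definition weakly_measurable (Z : T -> H) :=
  forall u, measurable_fun [set: T] (fun w => inner (Z w) u).

Lemma weak_bmf (Z : T -> H) (M : R) u : weakly_measurable Z ->
  (forall w, `|Z w| <= M) -> bmf (fun w => inner (Z w) u).
Proof.
move=> mZ ZM; split=> //; exists (M * `|u|) => w.
by apply: le_trans (Cauchy_Schwarz _ _) _; rewrite ler_wpM2r.
Qed.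

(** The functional u |-> E <Z, u> is bounded by M |u|, hence represented by a
    vector, which is the weak expectation. *)
Lemma hexpectationP (Z : T -> H) (M : R) u : weakly_measurable Z ->
  (forall w, `|Z w| <= M) ->
  inner (hexpectation P Z) u = Ex P (fun w => inner (Z w) u).
Proof.
move=> mZ ZM; have bZ v := weak_bmf v mZ ZM.
rewrite /hexpectation; case: xgetP => [m _ /(_ u)[_]|].
  by rewrite unlock Ex_EFin// => -[].
have [m mP] : exists m, forall v, inner m v = Ex P (fun w => inner (Z w) v).
  apply: (@riesz _ _ M) => [a x y|x].
    rewrite -ExZ// -ExD//; last exact: bmfZ.
    by congr Ex; apply/funext => w; rewrite innerDr innerZr.
  have h (f : T -> R) : bmf f -> (forall w, f w <= M * `|x|) -> Ex P f <= M * `|x|.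
    by move=> bf fM; rewrite -(Ex_cst P (M * `|x|)); apply: Ex_le => //; exact: bmf_cst.
  rewrite ler_norml; apply/andP; split.
    rewrite lerNl -mulN1r -ExZ//; apply: h; first exact: bmfZ.
    move=> w; rewrite mulN1r -innerNl; apply: le_trans (ler_norm _) _.
    by apply: le_trans (Cauchy_Schwarz _ _) _; rewrite normrN ler_wpM2r.
  apply: h => // w; apply: le_trans (ler_norm _) _.
  by apply: le_trans (Cauchy_Schwarz _ _) _; rewrite ler_wpM2r.
move=> /(_ m) [] v; split; first exact: bmf_integrable.
by rewrite unlock Ex_EFin// mP.
Qed.

End WeakExpectation.

(** * Averages of independent copies *)

Section ExpectationTransfer.
Context d (T : measurableType d) (R : realType) (P : probability T R).

Section pack.
Context d' (T' : measurableType d') (U : T -> T').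
Hypothesis mU : measurable_fun [set: T] U.
Let mixin := isMeasurableFun.Build _ _ _ _ _ mU.
Definition mfun_pack : {mfun T >-> T'} := MeasurableFun.Pack (MeasurableFun.Class mixin).
End pack.

Lemma integral_transfer d' (T' : measurableType d') (U : T -> T')
    (mU : measurable_fun [set: T] U) (f : T' -> R) :
  measurable_fun [set: T'] f -> P.-integrable [set: T] (EFin \o f \o U) ->
  (\int[distribution P (mfun_pack mU)]_y (f y)%:E = \int[P]_w (f (U w))%:E)%E.
Proof.
move=> mf intf.
have := @integral_pushforward _ _ _ _ R U mU P setT (EFin \o f) _ _ measurableT.
rewrite preimage_setT; apply => //.
exact/measurable_EFinP.
Qed.

Lemma Ex_same_law (U V : T -> R) : bmf U -> bmf V ->
  (forall B : set R, measurable B -> P (U @^-1` B) = P (V @^-1` B)) ->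
  Ex P U = Ex P V.
Proof.
move=> bU bV UV; apply: EFin_inj; rewrite -!Ex_EFin//.
have mid : measurable_fun [set: R] (@id R) by exact: measurable_id.
rewrite -(integral_transfer bU.1 mid (bmf_integrable P bU)).
rewrite -(integral_transfer bV.1 mid (bmf_integrable P bV)).
by apply: eq_measure_integral => A mA _; exact: UV.
Qed.

(** The law of (U, V) is the product of the laws of U and V, because both agree
    on rectangles; Fubini's theorem then applies to (x, y) |-> x y. *)
Lemma Ex_independent (U V : T -> R) : bmf U -> bmf V ->
  (forall A B : set R, measurable A -> measurable B ->
    P (U @^-1` A `&` V @^-1` B) = (P (U @^-1` A) * P (V @^-1` B))%E) ->
  Ex P (fun w => U w * V w) = Ex P U * Ex P V.
Proof.
move=> bU bV UV; have [mU _] := bU; have [mV _] := bV.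
have mUV : measurable_fun [set: T] (fun w => (U w, V w)) by exact: measurable_fun_pair.
pose m1 := distribution P (mfun_pack mU).
pose m2 := distribution P (mfun_pack mV).
pose m' := distribution P (mfun_pack mUV).
have eqm A : measurable A -> (m1 \x m2)%E A = m' A.
  by apply: product_measure_unique => B C mB mC; rewrite -UV.
have mf : measurable_fun [set: R * R] (fun z : R * R => z.1 * z.2).
  by apply: measurable_funM; [exact: measurable_fst | exact: measurable_snd].
have bUV := bmfM bU bV.
have intP : P.-integrable setT (EFin \o (fun z : R * R => z.1 * z.2) \o (fun w => (U w, V w))).
  exact: bmf_integrable bUV.
have int12 : (m1 \x m2)%E.-integrable setT (EFin \o (fun z : R * R => z.1 * z.2)).
  apply/integrableP; split; first exact/measurable_EFinP.
  rewrite (eq_measure_integral m'); last by move=> A mA _; exact: eqm.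
  have : m'.-integrable setT (EFin \o (fun z : R * R => z.1 * z.2)).
    apply: (@integrable_pushforward _ _ _ _ R _ mUV P setT) => //.
    exact/measurable_EFinP.
  by case/integrableP.
apply: EFin_inj; rewrite -Ex_EFin//.
have mid : measurable_fun [set: R] (@id R) by exact: measurable_id.
rewrite -(integral_transfer mUV mf intP) -/m'.
rewrite (eq_measure_integral (m1 \x m2)%E); last by move=> A mA _; exact/esym/eqm.
rewrite -(integral12_prod_meas1 int12).
have h (x : R) : (\int[m2]_y (x * y)%:E = (x * Ex P V)%:E)%E.
  under eq_integral do rewrite EFinM.
  rewrite integralZl//; last first.
    apply: (@integrable_pushforward _ _ _ _ R _ mV P setT) => //; exact: bmf_integrable.
  by rewrite (integral_transfer mV mid (bmf_integrable P bV)) Ex_EFin// EFinM.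
rewrite (eq_integral (fun x : R => (Ex P V)%:E * x%:E)%E); last first.
  by move=> x _; rewrite -EFinM mulrC; exact: h.
rewrite integralZl//; last first.
  apply: (@integrable_pushforward _ _ _ _ R _ mU P setT) => //; exact: bmf_integrable.
by rewrite (integral_transfer mU mid (bmf_integrable P bU)) Ex_EFin// -EFinM mulrC.
Qed.

End ExpectationTransfer.

Section IidAverages.
Context d (T : measurableType d) (R : realType) (P : probability T R).
Context d' (Z : measurableType d') (Zs : nat -> T -> Z) (Z0 : T -> Z).
Hypotheses (mZs : forall i, measurable_fun [set: T] (Zs i))
  (mZ0 : measurable_fun [set: T] Z0).
Hypothesis Zlaw : forall i (C : set Z), measurable C -> P (Zs i @^-1` C) = P (Z0 @^-1` C).
Hypothesis Zind : forall i j (C D : set Z), i != j -> measurable C -> measurable D ->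
  P (Zs i @^-1` C `&` Zs j @^-1` D) = (P (Zs i @^-1` C) * P (Zs j @^-1` D))%E.

Lemma bmf_comp (g : T -> Z) (f : Z -> R) : measurable_fun [set: T] g -> bmf f ->
  bmf (fun w => f (g w)).
Proof.
move=> mg [mf [M fM]]; split; last by exists M => w.
exact: measurableT_comp.
Qed.

Definition avg (V : lmodType R) n (f : Z -> V) (w : T) : V :=
  n%:R^-1 *: \sum_(i < n) f (Zs i w).

Lemma bmf_avg n (f : Z -> R) : bmf f -> bmf (avg n (f : Z -> R^o)).
Proof.
move=> bf; apply: (@bmfZ _ _ _ n%:R^-1 (fun w => \sum_(i < n) f (Zs i w))).
by apply: bmf_sum => i; exact: bmf_comp.
Qed.

Lemma Ex_iid i (f : Z -> R) : bmf f -> Ex P (fun w => f (Zs i w)) = Ex P (fun w => f (Z0 w)).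
Proof.
move=> bf; apply: Ex_same_law; [exact: bmf_comp|exact: bmf_comp|].
move=> B mB; apply: Zlaw (f @^-1` B) _.
by rewrite -[X in measurable X]setTI; apply: bf.1.
Qed.

(** The cross terms of the squared centred sum have mean 0 by independence. *)
Lemma variance_avg n (f : Z -> R) : (0 < n)%N -> bmf f ->
  Ex P (fun w => (avg n (f : Z -> R^o) w - Ex P (fun w => f (Z0 w))) ^+ 2) <=
  n%:R^-1 * Ex P (fun w => f (Z0 w) ^+ 2).
Proof.
move=> n0 bf; set mu := Ex P (fun w => f (Z0 w)).
have nR : n%:R != 0 :> R by rewrite pnatr_eq0 -lt0n.
pose g z := f z - mu.
have bg : bmf g by apply: bmfB => //; exact: bmf_cst.
have Eg i : Ex P (fun w => g (Zs i w)) = 0.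
  rewrite Ex_iid// /g ExB ?Ex_cst ?subrr//; first exact: bmf_comp.
  exact: bmf_cst.
have Egg i j : i != j -> Ex P (fun w => g (Zs i w) * g (Zs j w)) = 0.
  move=> ij; rewrite Ex_independent ?Eg ?mul0r//; [exact: bmf_comp|exact: bmf_comp|].
  move=> A B mA mB; apply: (Zind (C := g @^-1` A) (D := g @^-1` B) ij);
    by rewrite -[X in measurable X]setTI; apply: bg.1.
have gE w : avg n (f : Z -> R^o) w - mu = n%:R^-1 * \sum_(i < n) g (Zs i w).
  rewrite /avg /g sumrB sumr_const card_ord mulrBr; congr (_ - _).
  by rewrite -[mu *+ n]mulr_natl mulrA mulVf// mul1r.
have bgg i j : bmf (fun w => g (Zs i w) * g (Zs j w)).
  by apply: bmfM; exact: bmf_comp.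
rewrite (_ : (fun w => _) = (fun w => n%:R^-1 ^+ 2 *
   \sum_(i < n) \sum_(j < n) g (Zs i w) * g (Zs j w))); last first.
  apply/funext => w; rewrite gE exprMn; congr (_ * _).
  by rewrite expr2 mulr_suml; apply: eq_bigr => i _; rewrite mulr_sumr.
rewrite ExZ; last by apply: bmf_sum => i; exact: bmf_sum.
rewrite Ex_sum; last by move=> i; exact: bmf_sum.
have Eii (i : 'I_n) : Ex P (fun w => \sum_(j < n) g (Zs i w) * g (Zs j w)) <=
    Ex P (fun w => f (Z0 w) ^+ 2).
  rewrite Ex_sum// (bigD1 i)//= big1 ?addr0; last by move=> j ij; rewrite Egg// eq_sym.
  rewrite (_ : (fun w => _) = (fun w => (fun z => g z ^+ 2) (Zs i w)))//.
  rewrite (Ex_iid i (f := fun z => g z ^+ 2)); last exact: bmf_sqr.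
  have -> : Ex P (fun w => g (Z0 w) ^+ 2) =
      Ex P (fun w => f (Z0 w) ^+ 2) - mu ^+ 2.
    rewrite (_ : (fun w => g (Z0 w) ^+ 2) = (fun w => (f (Z0 w) ^+ 2 - (2 * mu) * f (Z0 w)) + mu ^+ 2)); last first.
      by apply/funext => w; rewrite /g; ring.
    have b1 : bmf (fun w => f (Z0 w)) by exact: bmf_comp.
    rewrite ExD; [|by apply: bmfB; [exact: bmf_sqr|exact: bmfZ]|exact: bmf_cst].
    rewrite ExB; [|exact: bmf_sqr|exact: bmfZ].
    by rewrite ExZ// Ex_cst -/mu; ring.
  by rewrite gerBl sqr_ge0.
rewrite expr2 -mulrA ler_wpM2l ?invr_ge0// mulrC ler_pdivrMr ?ltr0n//.
apply: le_trans (ler_sum _ (fun i _ => Eii i)) _.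
by rewrite sumr_const card_ord mulr_natr.
Qed.

End IidAverages.

(** * Concentration of sample covariance operators *)

Definition parseval (R : realType) (H : hilbert R) (e : nat -> H) : Prop :=
  quasi_orthonormal e /\
  forall v, \sum_(l < n) inner v (e l) ^+ 2 @[n --> \oo] --> `|v| ^+ 2.

Section CovarianceConcentration.
Context d (T : measurableType d) (R : realType) (P : probability T R).
Context d' (Z : measurableType d') (Zs : nat -> T -> Z) (Z0 : T -> Z).
Hypotheses (mZs : forall i, measurable_fun [set: T] (Zs i))
  (mZ0 : measurable_fun [set: T] Z0).
Hypothesis Zlaw : forall i (C : set Z), measurable C -> P (Zs i @^-1` C) = P (Z0 @^-1` C).
Hypothesis Zind : forall i j (C D : set Z), i != j -> measurable C -> measurable D ->
  P (Zs i @^-1` C `&` Zs j @^-1` D) = (P (Zs i @^-1` C) * P (Zs j @^-1` D))%E.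
Variables (H K : hilbert R) (xi : Z -> H) (zeta : Z -> K) (M : R).
Hypotheses (mxi : weakly_measurable xi) (mzeta : weakly_measurable zeta).
Hypotheses (xiM : forall z, `|xi z| <= M) (zetaM : forall z, `|zeta z| <= M).
Hypothesis xi0 : forall u, Ex P (fun w => inner (xi (Z0 w)) u) = 0.
Variable SXY : K -> H.
Hypothesis bSXY : bounded_operator SXY.
Hypothesis SXYE : forall g u,
  inner (SXY g) u = Ex P (fun w => inner (zeta (Z0 w)) g * inner (xi (Z0 w)) u).
Variables (f : nat -> H) (e : nat -> K).
Hypotheses (pf : parseval f) (pe : parseval e).
Variables (A : H -> H) (tau : R).
Hypotheses (lA : linear A) (sA : self_adjoint A).
Hypothesis Atau : forall N, \sum_(k < N) Ex P (fun w => inner (xi (Z0 w)) (A (f k)) ^+ 2) <= tau.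

Definition sample_cov n w (g : K) : H :=
  avg Zs n (fun z => inner (zeta z) g *: xi z) w -
  inner (avg Zs n zeta w) g *: avg Zs n xi w.

Lemma inner_avgl (L : hilbert R) n (h : Z -> L) w u :
  inner (avg Zs n h w) u = avg Zs n ((fun z => inner (h z) u) : Z -> R^o) w.
Proof. by rewrite /avg innerZl inner_suml. Qed.

Lemma norm_avg_le (L : hilbert R) n (h : Z -> L) (C : R) w : 0 <= C ->
  (forall z, `|h z| <= C) -> `|avg Zs n h w| <= C.
Proof.
move=> C0 hC; rewrite /avg normrZ ger0_norm ?invr_ge0//.
have [->|n0] := posnP n; first by rewrite invr0 mul0r.
rewrite mulrC ler_pdivrMr ?ltr0n//; apply: le_trans (ler_norm_sum _ _ _) _.
apply: le_trans (ler_sum _ (fun i _ => hC _)) _.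
by rewrite sumr_const card_ord mulr_natr.
Qed.

Lemma square_sum_mono (x : nat -> nat -> R) m n : (m <= n)%N ->
  \sum_(k < m) \sum_(l < m) x k l ^+ 2 <= \sum_(k < n) \sum_(l < n) x k l ^+ 2.
Proof.
move=> mn.
have mono (y : nat -> R) : (forall i, 0 <= y i) -> \sum_(k < m) y k <= \sum_(k < n) y k.
  move=> y0; rewrite -(subnKC mn) big_split_ord/= lerDl.
  by apply: sumr_ge0.
apply: (@le_trans _ _ (\sum_(k < m) \sum_(l < n) x k l ^+ 2)).
  by apply: ler_sum => k _; apply: (mono (fun l => x k l ^+ 2)) => l; rewrite sqr_ge0.
apply: (mono (fun k => \sum_(l < n) x k l ^+ 2)) => k.
by apply: sumr_ge0 => l _; rewrite sqr_ge0.
Qed.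

(** In the complete systems f and e, the squared Hilbert-Schmidt norm of
    A (n^-1 sum_i xi_i (x) zeta_i - SXY) is the sum over k and l of the squares of
    the centred averages X k l, and the sum of their variances is at most
    n^-1 E |A xi|^2 |zeta|^2.  The empirical centring subtracts the tensor of the two
    sample means; the squares of Y k add up to |A xi_mean|^2, and the other mean is
    bounded by M. *)
Lemma cov_concentration n (t : R) : (0 < n)%N -> 0 < t ->
  exists E, [/\ measurable E, (P E <= ((M ^+ 2 + 1) * tau / n%:R / t)%:E)%E &
    forall w, ~ E w ->
      forall g, `|A (sample_cov n w g - SXY g)| <= Num.sqrt t * (1 + M) * `|g|].
Proof.
move=> n0 t0.
have M0 : 0 <= M := le_trans (normr_ge0 _) (xiM point).
have bxi u : bmf (fun z => inner (xi z) u) := weak_bmf u mxi xiM.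
have bzeta u : bmf (fun z => inner (zeta z) u) := weak_bmf u mzeta zetaM.
have bxi0 u : bmf (fun w => inner (xi (Z0 w)) u) := bmf_comp mZ0 (bxi u).
have bzeta0 u : bmf (fun w => inner (zeta (Z0 w)) u) := bmf_comp mZ0 (bzeta u).
pose h k l z := inner (zeta z) (e l) * inner (xi z) (A (f k)).
pose a k z := inner (xi z) (A (f k)).
have bh k l : bmf (h k l) by apply: bmfM.
have ba k : bmf (a k) := bxi _.
pose mu k l := Ex P (fun w => h k l (Z0 w)).
pose X k l w : R := avg Zs n (h k l : Z -> R^o) w - mu k l.
pose Y k w : R := avg Zs n (a k : Z -> R^o) w.
have bX k l : bmf (X k l) by apply: bmfB; [exact: bmf_avg | exact: bmf_cst].
have bY k : bmf (Y k) by exact: bmf_avg.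
pose W N w := \sum_(k < N) \sum_(l < N) X k l w ^+ 2 + \sum_(k < N) Y k w ^+ 2.
have bXX N : bmf (fun w => \sum_(k < N) \sum_(l < N) X k l w ^+ 2).
  by apply: bmf_sum => k; apply: bmf_sum => l; exact: bmf_sqr.
have bYY N : bmf (fun w => \sum_(k < N) Y k w ^+ 2).
  by apply: bmf_sum => k; exact: bmf_sqr.
have nV0 : 0 <= n%:R^-1 :> R by rewrite invr_ge0.
have EX N : Ex P (fun w => \sum_(k < N) \sum_(l < N) X k l w ^+ 2) <= n%:R^-1 * (M ^+ 2 * tau).
  rewrite Ex_sum; last by move=> k; apply: bmf_sum => l; exact: bmf_sqr.
  apply: (@le_trans _ _ (\sum_(k < N) n%:R^-1 * (M ^+ 2 * Ex P (fun w => a k (Z0 w) ^+ 2)))).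
    apply: ler_sum => k _; rewrite Ex_sum; last by move=> l; exact: bmf_sqr.
    apply: (@le_trans _ _ (\sum_(l < N) n%:R^-1 * Ex P (fun w => h k l (Z0 w) ^+ 2))).
      by apply: ler_sum => l _; exact: variance_avg.
    rewrite -mulr_sumr ler_wpM2l// -Ex_sum; last first.
      by move=> l; apply: bmf_sqr; exact: bmf_comp.
    rewrite -ExZ; last by apply: bmf_sqr; exact: bmf_comp.
    apply: Ex_le.
    - by apply: bmf_sum => l; apply: bmf_sqr; exact: bmf_comp.
    - by apply: bmfZ; apply: bmf_sqr; exact: bmf_comp.
    move=> w; rewrite /h.
    under eq_bigr do rewrite exprMn.
    rewrite -mulr_suml ler_wpM2r ?sqr_ge0//.
    apply: le_trans (bessel_seq pe.1 _ _) _.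
    by rewrite ler_pXn2r ?nnegrE.
  by rewrite -!mulr_sumr ler_wpM2l// ler_wpM2l ?sqr_ge0// Atau.
have EY N : Ex P (fun w => \sum_(k < N) Y k w ^+ 2) <= n%:R^-1 * tau.
  rewrite Ex_sum; last by move=> k; exact: bmf_sqr.
  apply: (@le_trans _ _ (\sum_(k < N) n%:R^-1 * Ex P (fun w => a k (Z0 w) ^+ 2))).
    apply: ler_sum => k _.
    have := variance_avg mZs mZ0 Zlaw Zind n0 (ba k); rewrite xi0.
    by under eq_fun do rewrite subr0.
  by rewrite -mulr_sumr ler_wpM2l// Atau.
have [|||N|E [mE PE EW]] := @increasing_markov _ _ _ P W ((M ^+ 2 + 1) * tau / n%:R) t _ _ _ _ t0.
- by move=> N; apply: bmfD.
- move=> N w; rewrite addr_ge0//; apply: sumr_ge0 => k _; last exact: sqr_ge0.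
  by apply: sumr_ge0 => l _; exact: sqr_ge0.
- move=> N w; apply: lerD; first exact: (square_sum_mono (fun k l => X k l w)).
  by rewrite big_ord_recr/= lerDl sqr_ge0.
- rewrite ExD//; apply: le_trans (lerD (EX N) (EY N)) _.
  by rewrite le_eqVlt; apply/orP; left; apply/eqP; ring.
exists E; split=> // w nE g.
have {}EW N := EW w nE N.
have X0 N : 0 <= \sum_(k < N) \sum_(l < N) X k l w ^+ 2.
  by apply: sumr_ge0 => k _; apply: sumr_ge0 => l _; exact: sqr_ge0.
have Y0 N : 0 <= \sum_(k < N) Y k w ^+ 2 by apply: sumr_ge0 => k _; exact: sqr_ge0.
pose m k := adjoint SXY (A (f k)).
pose D k := avg Zs n (fun z => a k z *: zeta z) w - m k.
have De k l : inner (D k) (e l) = X k l w.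
  rewrite /D innerBl inner_avgl; congr (_ - _).
    by congr avg; apply/funext => z; rewrite innerZl mulrC.
  by rewrite innerC -adjointP// SXYE.
have Dn N : \sum_(k < N) `|D k| ^+ 2 <= t.
  have l1 : \sum_(k < N) \sum_(l < L) inner (D k) (e l) ^+ 2 @[L --> \oo] -->
      \sum_(k < N) `|D k| ^+ 2.
    by apply: cvg_finite_sum => k; exact: pe.2.
  apply: (ler_cvg_to l1 (cvg_cst t)); exists N => // L /= NL.
  under eq_bigr do under eq_bigr do rewrite De.
  have h1 : \sum_(k < L) \sum_(l < L) X k l w ^+ 2 <= t.
    by have := EW L; have := Y0 L; rewrite /W; lra.
  apply: le_trans h1.
  rewrite -(subnKC NL) [leRHS]big_split_ord/= lerDl; apply: sumr_ge0 => k _.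
  by apply: sumr_ge0 => l _; exact: sqr_ge0.
have part1 : `|A (avg Zs n (fun z => inner (zeta z) g *: xi z) w - SXY g)| <= Num.sqrt t * `|g|.
  apply: le_sqr_norm; first by rewrite mulr_ge0 ?sqrtr_ge0.
  rewrite exprMn sqr_sqrtr ?(ltW t0)//.
  apply: (ler_cvg_to (pf.2 _) (cvg_cst (t * `|g| ^+ 2))); apply: nearW => N.
  apply: (@le_trans _ _ (\sum_(k < N) (`|D k| ^+ 2 * `|g| ^+ 2))); last first.
    by rewrite -mulr_suml ler_wpM2r ?sqr_ge0.
  apply: ler_sum => k _.
  have -> : inner (A (avg Zs n (fun z => inner (zeta z) g *: xi z) w - SXY g)) (f k) = inner (D k) g.
    rewrite sA innerBl /D innerBl; congr (_ - _).
      rewrite !inner_avgl; congr avg; apply/funext => z.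
      by rewrite !innerZl mulrC.
    by rewrite adjointP// innerC.
  rewrite -exprMn -(real_normK (num_real (inner _ _))) ler_pXn2r ?nnegrE ?mulr_ge0//.
  exact: Cauchy_Schwarz.
have part2 : `|A (avg Zs n xi w)| <= Num.sqrt t.
  apply: le_sqr_norm; first exact: sqrtr_ge0.
  rewrite sqr_sqrtr ?(ltW t0)//.
  apply: (ler_cvg_to (pf.2 _) (cvg_cst t)); apply: nearW => N.
  have h1 : \sum_(k < N) Y k w ^+ 2 <= t.
    by have := EW N; have := X0 N; rewrite /W; lra.
  apply: le_trans h1; apply: ler_sum => k _.
  by rewrite sA inner_avgl.
have -> : A (sample_cov n w g - SXY g) =
    A (avg Zs n (fun z => inner (zeta z) g *: xi z) w - SXY g) -
    inner (avg Zs n zeta w) g *: A (avg Zs n xi w).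
  by rewrite -(linZ lA) -(linB lA) /sample_cov addrAC.
apply: le_trans (ler_normB _ _) _.
have -> : Num.sqrt t * (1 + M) * `|g| = Num.sqrt t * `|g| + (M * `|g|) * Num.sqrt t by ring.
apply: lerD => //; rewrite normrZ; apply: ler_pM => //.
apply: le_trans (Cauchy_Schwarz _ _) _; rewrite ler_wpM2r//.
exact: norm_avg_le.
Qed.

End CovarianceConcentration.

(** * Trace sigma-algebras and separability of kernel spaces *)

Section TraceSpace.
Context d (B : measurableType d) (D : set B).

(** A kernel is continuous on its domain only, and the domain may fail to be
    measurable.  For this larger sigma-algebra, which does not see the complement of
    D, functions that are continuous on D are measurable, while random elements with
    values in D remain measurable. *)
Definition trace_sets : set_system B :=
  [set A | exists C, measurable C /\ forall z, D z -> (A z <-> C z)].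

Definition trace_space := g_sigma_algebraType trace_sets.

Lemma trace_sigma_algebra : sigma_algebra setT trace_sets.
Proof.
split.
- by exists set0; split=> //; exact: measurable0.
- move=> A [C [mC AC]]; exists (~` C); split; first exact: measurableC.
  move=> z Dz; rewrite setTD /=.
  by split=> h; apply: contra_not h; move=> /(AC z Dz).
- move=> A /choice[C CP]; exists (\bigcup_k C k); split.
    by apply: bigcup_measurable => k _; exact: (CP k).1.
  by move=> z Dz; split=> -[k _ h]; exists k => //; apply/((CP k).2 z Dz).
Qed.

Lemma trace_measurable (A : set trace_space) : measurable A ->
  exists C : set B, measurable C /\ forall z, D z -> (A z <-> C z).
Proof. exact: (smallest_sub trace_sigma_algebra (@subset_refl _ trace_sets)). Qed.

Lemma trace_measurable_fun d' (T : measurableType d') (g : T -> B) :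
  measurable_fun [set: T] g -> (forall w, D (g w)) ->
  measurable_fun [set: T] (g : T -> trace_space).
Proof.
move=> mg Dg _ A /trace_measurable[C [mC AC]]; rewrite setTI.
rewrite (_ : _ @^-1` A = g @^-1` C); last first.
  by apply/seteqP; split=> w /= /AC; apply.
by rewrite -[X in measurable X]setTI; exact: mg.
Qed.

End TraceSpace.

Section RkhsFacts.
Variables (R : realType) (m : nat) (D : set 'rV[R]_m).
Variables (k : 'rV[R]_m -> 'rV[R]_m -> R) (H : rkhs D k).
Hypothesis hk : bounded_continuous_kernel D k.

Local Notation sec := (rkhs_section H).
Local Notation ev := (rkhs_eval (r := H)).

Lemma section_inner x y : D x -> D y -> inner (sec x) (sec y) = k y x.
Proof. by move=> Dx Dy; rewrite rkhs_reproducing// rkhs_sectionE. Qed.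

Lemma section_bounded : exists2 M : R, 0 < M & forall x, D x -> `|sec x| <= M.
Proof.
have [[C kC] _] := hk; exists (`|C| + 1); first by rewrite ltr_wpDl.
move=> x Dx; apply: le_sqr_norm; first by rewrite addr_ge0.
rewrite -inner_norm section_inner//; apply: le_trans (ler_norm _) _.
apply: le_trans (kC x x Dx Dx) _; apply: le_trans (ler_norm _) _.
by rewrite sqrrD1; have := normr_ge0 C; nra.
Qed.

Lemma section_continuous x (e : R) : D x -> 0 < e ->
  \forall y \near x, D y -> `|sec y - sec x| <= e.
Proof.
move=> Dx e0; have [_ /subspace_continuousP kc] := hk.
have := kc (x, x) (conj Dx Dx) => /cvgrPdist_lt /(_ (e ^+ 2 / 4)).
rewrite divr_gt0 ?exprn_gt0// => /(_ isT); rewrite near_withinE.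
move=> [[U V]] /= [Ux Vx] UV.
near=> y => Dy.
have kn a b : D a -> D b -> U a -> V b -> `|k x x - k a b| < e ^+ 2 / 4.
  by move=> Da Db Ua Vb; apply: (UV (a, b)).
have Uy : U y by near: y.
have Vy : V y by near: y.
have Ux' : U x by exact: nbhs_singleton.
have Vx' : V x by exact: nbhs_singleton.
apply: le_sqr_norm; first exact: ltW.
rewrite normB_sqr -!inner_norm !section_inner//.
have := kn _ _ Dy Dy Uy Vy; have := kn _ _ Dx Dy Ux' Vy.
rewrite !ltr_norml => /andP[a1 a2] /andP[b1 b2].
have e20 : 0 <= e ^+ 2 by exact: sqr_ge0.
lra.
Unshelve. all: by end_near. Qed.

Lemma rkhs_eval_continuous (u : H) x (e : R) : D x -> 0 < e ->
  \forall y \near x, D y -> `|ev u y - ev u x| < e.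
Proof.
move=> Dx e0.
have u1 : 0 < `|u| + 1 by rewrite ltr_wpDl.
have e'0 : 0 < e / (2 * (`|u| + 1)) by rewrite divr_gt0// mulr_gt0.
near=> y => Dy.
rewrite -!rkhs_reproducing// -innerBr.
apply: le_lt_trans (Cauchy_Schwarz _ _) _.
apply: (@le_lt_trans _ _ ((`|u| + 1) * (e / (2 * (`|u| + 1))))).
  apply: ler_pM => //; first by rewrite lerDl.
  by move: Dy; near: y; exact: section_continuous.
rewrite [ltLHS](_ : _ = e / 2); last by field; rewrite gt_eqF.
by rewrite ltr_pdivrMr// ltr_pMr// ltr1n.
Unshelve. all: by end_near. Qed.

Lemma rkhs_eval_trace_open (u : H) (a : R) : exists V : set 'rV[R]_m, open V /\
  forall x, D x -> (a < ev u x <-> V x).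
Proof.
exists ([set x | D x -> a < ev u x]°); split; first exact: open_interior.
move=> x Dx; split; last by move=> /interior_subset /(_ Dx).
move=> aux; rewrite /interior /=.
have e0 : 0 < ev u x - a by rewrite subr_gt0.
near=> y => /= Dy.
have : `|ev u y - ev u x| < ev u x - a.
  by move: Dy; near: y; exact: rkhs_eval_continuous.
by rewrite ltr_norml => /andP[h _]; lra.
Unshelve. all: by end_near. Qed.

(** One point of D is chosen in each ball with rational centre and radius
    1 / (j + 1) that meets D.  These points are dense in D, and an element orthogonal
    to their sections vanishes there, hence on D by continuity. *)
Lemma rkhs_countable_total : exists x : nat -> H,
  forall u : H, (forall n, inner u (x n) = 0) -> u = 0.
Proof.
pose Q (i : 'rV[rat]_m * nat) y := D y /\ ball (map_mx ratr i.1 : 'rV[R]_m) (i.2.+1%:R^-1) y.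
pose v (i : 'rV[rat]_m * nat) : H :=
  if pselect (exists y, Q i y) is left h then sec (projT1 (cid h)) else 0.
exists (fun n => if unpickle n is Some i then v i else 0) => u uv.
apply: (@rkhs_eval_inj _ _ _ _ H) => y Dy.
have -> : ev 0 y = 0.
  by rewrite -rkhs_reproducing// inner0l.
apply/eqP; apply/negPn/negP => uy.
have uy0 : 0 < `|ev u y| by rewrite normr_gt0.
have /nbhs_ballP[del /= del0 hdel] := rkhs_eval_continuous u Dy uy0.
have [N /(_ N (leqnn _)) hN] := eps_inv_ex (divr_gt0 del0 (ltr0n _ 2)).
have N0 : 0 < N.+1%:R^-1 :> R by rewrite invr_gt0.
have /choice[c cP] : forall j : 'I_m, exists q : rat, `|ratr q - y 0 j| < N.+1%:R^-1 :> R.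
  move=> j; have [|q] := @rat_in_itvoo R (y 0 j - N.+1%:R^-1) (y 0 j + N.+1%:R^-1).
    by rewrite ltrBlDr -addrA ltrDl addr_gt0.
  rewrite in_itv/= => /andP[q1 q2]; exists q.
  by rewrite ltr_norml; apply/andP; split; move: q1 q2; move: (N.+1%:R^-1) => r; lra.
pose i : 'rV[rat]_m * nat := (\row_j c j, N).
have Qy : Q i y.
  split=> //; split=> [|a b]; first exact: N0.
  by rewrite !mxE (ord1 a); exact: cP.
have := uv (pickle i); rewrite pickleK /v.
case: pselect => [h|]; last by case; exists y.
case: cid => x /= [Dx bx]; rewrite rkhs_reproducing// => ux.
have : `|ev u x - ev u y| < `|ev u y|.
  apply: hdel => //; apply: le_ball (_ : N.+1%:R^-1 + N.+1%:R^-1 <= del) _ _.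
    by rewrite [leRHS]splitr lerD.
  by apply: ball_triangle bx; apply: ball_sym; exact: Qy.2.
by rewrite ux sub0r normrN ltxx.
Qed.

Lemma rkhs_parseval : exists e : nat -> H, parseval e.
Proof.
have [x xt] := rkhs_countable_total.
pose e := gram_schmidt x.
have eo : quasi_orthonormal e by exact: gram_schmidt_quasi.
exists e; split=> // v.
have [|D1 dD] := @diag_op_ex _ _ _ eo (fun=> 1) 1; first by move=> j; rewrite normr1.
have Dv : D1 v = v.
  apply/eqP; rewrite eq_sym -subr_eq0; apply/eqP; apply: xt => n.
  rewrite (gram_schmidt_span x n) inner_sumr big1// => j _.
  by rewrite innerZr innerBl (diag_op_coef eo dD) mul1r subrr mulr0.
have := @diag_op_norm_cvg _ _ _ eo _ _ dD v; rewrite Dv.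
by under eq_fun do under eq_bigr do rewrite mul1r.
Qed.

End RkhsFacts.

(** * Centred kernel features *)

Section Features.
Context d (T : measurableType d) (R : realType) (P : probability T R).
Context d0 (B0 : measurableType d0) (D0 : set B0).
Local Notation Z := (trace_space D0).
Variables (Z0 : T -> B0) (mZ0 : measurable_fun [set: T] Z0) (DZ0 : forall w, D0 (Z0 w)).

Section one_feature.
Variables (m : nat) (D : set 'rV[R]_m) (k : 'rV[R]_m -> 'rV[R]_m -> R) (H : rkhs D k).
Hypothesis hk : bounded_continuous_kernel D k.
Variables (a : B0 -> 'rV[R]_m) (ma : measurable_fun [set: B0] (a : B0 -> borel R m)).
Hypothesis Da : forall z, D0 z -> D (a z).

(** Zero outside D0, where sections of the kernel have no meaning. *)
Definition feature (mu : H) (z : Z) : H :=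
  if `[< D0 z >] then rkhs_section H (a z) - mu else 0.

Lemma featureE mu z : D0 z -> feature mu z = rkhs_section H (a z) - mu.
Proof. by move=> Dz; rewrite /feature asboolT. Qed.

Lemma feature_weakly_measurable mu : weakly_measurable (feature mu).
Proof.
move=> u; apply: (measurability _ (RGenOInfty.measurableE R)) => /= _ [_ [c ->] <-].
rewrite setTI; apply: sub_sigma_algebra.
have [V [oV VP]] := rkhs_eval_trace_open hk u (c + inner mu u).
exists (a @^-1` V); split.
  rewrite -[X in measurable X]setTI; apply: ma => //.
  exact: sub_sigma_algebra.
move=> z Dz /=; rewrite in_itv/= andbT featureE// innerBl innerC rkhs_reproducing; last exact: Da.
by rewrite ltrBrDr; apply: VP; exact: Da.
Qed.

Lemma feature_bounded mu : exists2 M : R, 0 < M & forall z, `|feature mu z| <= M.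
Proof.
have [M M0 sM] := section_bounded H hk.
exists (M + `|mu|); first by rewrite ltr_wpDr.
move=> z; rewrite /feature; case: asboolP => [Dz|_].
  by apply: le_trans (ler_normB _ _) _; rewrite lerD2r sM//; exact: Da.
by rewrite normr0 addr_ge0// ltW.
Qed.

Let mZ0' : measurable_fun [set: T] (Z0 : T -> Z) := trace_measurable_fun mZ0 DZ0.

Definition centred_feature := feature (mean_element P H (a \o Z0)).

Lemma centred_feature_mean u : Ex P (fun w => inner (centred_feature (Z0 w)) u) = 0.
Proof.
have [M M0 fM] := feature_bounded 0.
have m0 u' : measurable_fun [set: T] (fun w => inner (rkhs_section H (a (Z0 w))) u').
  rewrite (_ : (fun w => _) = (fun z : Z => inner (feature 0 z) u') \o (Z0 : T -> Z)).
    by apply: measurableT_comp => //; exact: feature_weakly_measurable.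
  by apply/funext => w /=; rewrite featureE// subr0.
have b0 w : `|rkhs_section H (a (Z0 w))| <= M.
  by have := fM (Z0 w); rewrite featureE// subr0.
rewrite (_ : (fun w => _) = (fun w => inner (rkhs_section H (a (Z0 w))) u -
   inner (mean_element P H (a \o Z0)) u)); last first.
  by apply/funext => w; rewrite /centred_feature featureE// innerBl.
rewrite ExB; [|exact: weak_bmf m0 b0|exact: bmf_cst].
by rewrite Ex_cst (hexpectationP P (Z := fun w => rkhs_section H (a (Z0 w))) u m0 b0) subrr.
Qed.

End one_feature.

Section two_features.
Variables (m1 : nat) (D1 : set 'rV[R]_m1) (k1 : 'rV[R]_m1 -> 'rV[R]_m1 -> R) (H : rkhs D1 k1).
Variables (m2 : nat) (D2 : set 'rV[R]_m2) (k2 : 'rV[R]_m2 -> 'rV[R]_m2 -> R) (K : rkhs D2 k2).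
Hypotheses (hk1 : bounded_continuous_kernel D1 k1) (hk2 : bounded_continuous_kernel D2 k2).
Variables (a : B0 -> 'rV[R]_m1) (ma : measurable_fun [set: B0] (a : B0 -> borel R m1)).
Variables (b : B0 -> 'rV[R]_m2) (mb : measurable_fun [set: B0] (b : B0 -> borel R m2)).
Hypotheses (Da : forall z, D0 z -> D1 (a z)) (Db : forall z, D0 z -> D2 (b z)).

Let xi : Z -> H := centred_feature H a.
Let zeta : Z -> K := centred_feature K b.
Let mZ0' : measurable_fun [set: T] (Z0 : T -> Z) := trace_measurable_fun mZ0 DZ0.

Let mxi : weakly_measurable xi := feature_weakly_measurable hk1 ma Da _.
Let mzeta : weakly_measurable zeta := feature_weakly_measurable hk2 mb Db _.

Local Notation S := (cov_op P H K (a \o Z0) (b \o Z0)).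

Lemma cov_bmf g u : bmf (fun w => inner (zeta (Z0 w)) g * inner (xi (Z0 w)) u).
Proof.
have [M _ xM] := feature_bounded hk1 Da (mean_element P H (a \o Z0)).
have [N _ zN] := feature_bounded hk2 Db (mean_element P K (b \o Z0)).
apply: bmfM.
  exact: (bmf_comp mZ0' (weak_bmf g mzeta zN)).
exact: (bmf_comp mZ0' (weak_bmf u mxi xM)).
Qed.

Lemma cov_opE g u :
  inner (S g) u = Ex P (fun w => inner (zeta (Z0 w)) g * inner (xi (Z0 w)) u).
Proof.
have [M M0 xM] := feature_bounded hk1 Da (mean_element P H (a \o Z0)).
have [N N0 zN] := feature_bounded hk2 Db (mean_element P K (b \o Z0)).
pose V w : H := inner (zeta (Z0 w)) g *: xi (Z0 w).
have -> : S g = hexpectation P V.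
  rewrite /cov_op /op_expectation; congr hexpectation; apply/funext => w.
  by rewrite /V /xi /zeta /centred_feature !featureE.
rewrite (@hexpectationP _ _ _ P H V (N * `|g| * M)).
- by congr Ex; apply/funext => w; rewrite innerZl.
- move=> u'; rewrite (_ : (fun w => _) =
    (fun w => inner (zeta (Z0 w)) g * inner (xi (Z0 w)) u')).
    exact: (cov_bmf g u').1.
  by apply/funext => w; rewrite innerZl.
- move=> w; rewrite normrZ; apply: ler_pM; [by []|by []| |exact: xM].
  by apply: le_trans (Cauchy_Schwarz _ _) _; rewrite ler_wpM2r//; exact: zN.
Qed.

Lemma cov_op_bounded : bounded_operator S.
Proof.
have [M M0 xM] := feature_bounded hk1 Da (mean_element P H (a \o Z0)).
have [N N0 zN] := feature_bounded hk2 Db (mean_element P K (b \o Z0)).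
split.
  move=> c g g'; apply: inner_inj => u; rewrite innerDl innerZl !cov_opE.
  rewrite -ExZ; last exact: cov_bmf.
  rewrite -ExD; [|by apply: bmfZ; exact: cov_bmf|exact: cov_bmf].
  by congr Ex; apply/funext => w; rewrite innerDr innerZr; ring.
exists (N * M) => g; have [->|Sg0] := eqVneq (S g) 0.
  by rewrite normr0 !mulr_ge0// ltW.
have p : 0 < `|S g| by rewrite normr_gt0.
rewrite -(ler_pM2r p) -expr2 -inner_norm cov_opE.
rewrite -[leRHS](Ex_cst P); apply: Ex_le; [exact: cov_bmf|exact: bmf_cst|].
move=> w; apply: le_trans (ler_norm _) _; rewrite normrM.
rewrite [leRHS](_ : _ = (N * `|g|) * (M * `|S g|)); last by ring.
apply: ler_pM; [by []|by []| |].
  by apply: le_trans (Cauchy_Schwarz _ _) _; rewrite ler_wpM2r//; exact: zN.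
by apply: le_trans (Cauchy_Schwarz _ _) _; rewrite ler_wpM2r//; exact: xM.
Qed.

Variables (Zs : nat -> T -> B0).
Hypothesis DZs : forall i w, D0 (Zs i w).

Lemma sample_cov_opE n w g : (0 < n)%N ->
  sample_cov_op H K n (fun i => a (Zs i w)) (fun i => b (Zs i w)) g =
  sample_cov (Zs : nat -> T -> Z) xi zeta n w g.
Proof.
move=> n0; have nR : n%:R != 0 :> R by rewrite pnatr_eq0 -lt0n.
rewrite /sample_cov_op /sample_cov.
set mx := sample_mean_element H n _; set my := sample_mean_element K n _.
set mux := mean_element P H (a \o Z0); set muy := mean_element P K (b \o Z0).
have avgc (L : hilbert R) (h : nat -> L) (c : L) :
    n%:R^-1 *: \sum_(i < n) (h i - c) = n%:R^-1 *: \sum_(i < n) h i - c.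
  rewrite sumrB sumr_const card_ord scalerBr; congr (_ - _).
  by rewrite -[c *+ n]scaler_nat scalerA mulVf// scale1r.
have xE : avg (Zs : nat -> T -> Z) n xi w = mx - mux.
  rewrite /avg /mx /sample_mean_element -(avgc _ (fun i => rkhs_section H (a (Zs i w)))); congr (_ *: _).
  by apply: eq_bigr => i _; rewrite /xi /centred_feature featureE.
have yE : avg (Zs : nat -> T -> Z) n zeta w = my - muy.
  rewrite /avg /my /sample_mean_element -(avgc _ (fun i => rkhs_section K (b (Zs i w)))); congr (_ *: _).
  by apply: eq_bigr => i _; rewrite /zeta /centred_feature featureE.
rewrite xE yE; set x := mx - mux; set y := my - muy.
pose xs i := xi (Zs i w); pose ys i := zeta (Zs i w).
have -> : \sum_(i < n) tensor (rkhs_section H (a (Zs i w)) - mx)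
     (rkhs_section K (b (Zs i w)) - my) g =
   \sum_(i < n) (inner (ys i) g *: xs i - inner y g *: xs i - inner (ys i) g *: x
      + inner y g *: x).
  apply: eq_bigr => i _; rewrite /tensor.
  have -> : rkhs_section H (a (Zs i w)) - mx = xs i - x.
    by rewrite /xs /x /xi /centred_feature featureE// opprB addrA subrK.
  have -> : rkhs_section K (b (Zs i w)) - my = ys i - y.
    by rewrite /ys /y /zeta /centred_feature featureE// opprB addrA subrK.
  rewrite innerBl; move: (inner (ys i) g) (inner y g) (xs i) x => s1 s2 v1 v2.
  by apply: inner_inj => z; rewrite !innerE; ring.
rewrite big_split/= !sumrB -!scaler_sumr -scaler_suml sumr_const card_ord.
have hx : \sum_(i < n) xs i = n%:R *: x.
  by rewrite /x -xE /avg scalerA mulfV// scale1r.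
have hy : \sum_(i < n) inner (ys i) g = n%:R * inner y g.
  by rewrite -inner_suml /y -yE /avg innerZl mulrA mulfV// mul1r.
rewrite hx hy; clearbody x y; rewrite -[x *+ n]scaler_nat /avg !scalerDr !scalerN !scalerA.
rewrite -!addrA; congr (_ + _).
have e1 : n%:R^-1 * inner y g * n%:R = inner y g by field.
have e2 : n%:R^-1 * n%:R * inner y g = inner y g by field.
by rewrite !mulrA e1 e2 addNr addr0.
Qed.

End two_features.
End Features.

(** * Probability bounds for the sample covariance operators *)

(** Exchanging the sums, sum_k <A f_k, e_j>^2 = sum_k <A e_j, f_k>^2 <= |A e_j|^2
    by Bessel's inequality. *)
Lemma spectral_trace_le (R : realType) (H : hilbert R) (S A : H -> H) (lam : nat -> R)
    (e f : nat -> H) (tau : R) : spectral_decomposition S lam e ->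
  self_adjoint A -> quasi_orthonormal f ->
  (forall n, \sum_(j < n) lam j * `|A (e j)| ^+ 2 <= tau) ->
  forall N, \sum_(k < N) inner (S (A (f k))) (A (f k)) <= tau.
Proof.
move=> sd sA fo tauP N.
have lam0 : forall j, 0 <= lam j by case: sd.
have eo := spectral_quasi sd; have dS := spectral_diag_op sd.
have l1 : \sum_(k < N) \sum_(j < n) lam j * (inner (A (f k)) (e j) * inner (A (f k)) (e j))
    @[n --> \oo] --> \sum_(k < N) inner (S (A (f k))) (A (f k)).
  by apply: cvg_finite_sum => k; exact: (@diag_op_inner _ _ _ _ _ dS).
apply: (ler_cvg_to l1 (cvg_cst tau)); apply: nearW => n.
rewrite exchange_big/=; apply: le_trans (tauP n); apply: ler_sum => j _.
rewrite -mulr_sumr ler_wpM2l//.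
rewrite (eq_bigr (fun k : 'I_N => inner (A (e j)) (f k) ^+ 2)); last first.
  by move=> k _; rewrite sA -expr2 innerC.
exact: bessel_seq.
Qed.

Section SampleEvents.
Context d (T : measurableType d) (R : realType) (P : probability T R).
Variables (p q : nat) (OmegaX : set 'rV[R]_p) (OmegaY : set 'rV[R]_q).
Variables (X : T -> 'rV[R]_p) (Y : T -> 'rV[R]_q).
Hypotheses (hX : random_vector OmegaX X) (hY : random_vector OmegaY Y).
Variables (Xs : nat -> T -> 'rV[R]_p) (Ys : nat -> T -> 'rV[R]_q).
Hypotheses (hXs : forall i, random_vector OmegaX (Xs i))
  (hYs : forall i, random_vector OmegaY (Ys i)).
Hypothesis hiid : iid_copies P X Y Xs Ys.

Local Notation B0 := (borel R p * borel R q)%type.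
Definition sample_domain : set B0 := [set z | OmegaX z.1 /\ OmegaY z.2].
Local Notation Z := (trace_space sample_domain).
Definition pair0 (w : T) : B0 := (X w, Y w).
Definition pairs (i : nat) (w : T) : B0 := (Xs i w, Ys i w).

Lemma pair0_measurable : measurable_fun [set: T] pair0.
Proof. by apply: measurable_fun_pair; [exact: hX.1 | exact: hY.1]. Qed.

Lemma pairs_measurable i : measurable_fun [set: T] (pairs i).
Proof. by apply: measurable_fun_pair; [exact: (hXs i).1 | exact: (hYs i).1]. Qed.

Lemma pair0_domain w : sample_domain (pair0 w).
Proof. by split; [exact: hX.2 | exact: hY.2]. Qed.

Lemma pairs_domain i w : sample_domain (pairs i w).
Proof. by split; [exact: (hXs i).2 | exact: (hYs i).2]. Qed.

Lemma pairs_law i (C : set Z) : measurable C ->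
  P ((pairs i : T -> Z) @^-1` C) = P ((pair0 : T -> Z) @^-1` C).
Proof.
move=> /trace_measurable[C' [mC' CC']].
have -> : (pairs i : T -> Z) @^-1` C = [set w | C' (Xs i w, Ys i w)].
  by apply/seteqP; split=> w /=; move/(CC' _ (pairs_domain i w)).
have -> : (pair0 : T -> Z) @^-1` C = [set w | C' (X w, Y w)].
  by apply/seteqP; split=> w /=; move/(CC' _ (pair0_domain w)).
exact: hiid.1.
Qed.

(** The product formula for the first max(i, j) + 1 pairs, with the whole space in
    all positions other than i and j. *)
Lemma pairs_independent i j (C D : set Z) : i != j -> measurable C -> measurable D ->
  P ((pairs i : T -> Z) @^-1` C `&` (pairs j : T -> Z) @^-1` D) =
  (P ((pairs i : T -> Z) @^-1` C) * P ((pairs j : T -> Z) @^-1` D))%E.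
Proof.
move=> ij mC mD.
have [C' [mC' CC']] := trace_measurable mC; have [D' [mD' DD']] := trace_measurable mD.
have eC : (pairs i : T -> Z) @^-1` C = [set w | C' (Xs i w, Ys i w)].
  by apply/seteqP; split=> w /=; move/(CC' _ (pairs_domain i w)).
have eD : (pairs j : T -> Z) @^-1` D = [set w | D' (Xs j w, Ys j w)].
  by apply/seteqP; split=> w /=; move/(DD' _ (pairs_domain j w)).
rewrite eC eD.
pose n := (maxn i j).+1.
have lin : (i < n)%N by rewrite ltnS leq_maxl.
have ljn : (j < n)%N by rewrite ltnS leq_maxr.
pose F (k : 'I_n) : set B0 := if k == i :> nat then C' else if k == j :> nat then D' else setT.
have mF k : measurable (F k) by rewrite /F; case: ifP => // _; case: ifP.
have := hiid.2 n F mF.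
rewrite (bigD1 (Ordinal lin))//= (bigD1 (Ordinal ljn))/=; last first.
  by apply/eqP => /(congr1 val)/= ji; move: ij; rewrite ji eqxx.
rewrite {2 3}/F /= !eqxx (eq_sym j) (negPf ij) big1 ?mule1; last first.
  move=> k /andP[/negPf ki /negPf kj]; rewrite /F.
  have -> : (k == i :> nat) = false by rewrite -ki; apply/idP/idP => /eqP h; apply/eqP; [exact: val_inj|rewrite h].
  have -> : (k == j :> nat) = false by rewrite -kj; apply/idP/idP => /eqP h; apply/eqP; [exact: val_inj|rewrite h].
  have -> : [set w | [set: B0] (Xs k w, Ys k w)] = [set: T] by apply/seteqP; split.
  exact: probability_setT.
move=> <-.
congr (P _); apply/seteqP; split=> w /=.
  move=> [hC hD] k; rewrite /F; case: eqP => [->//|_]; case: eqP => [->//|//].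
move=> h; split.
  by have := h (Ordinal lin); rewrite /F /= eqxx.
by have := h (Ordinal ljn); rewrite /F /= eqxx (eq_sym j) (negPf ij).
Qed.

Variables (kX : 'rV[R]_p -> 'rV[R]_p -> R) (HX : rkhs OmegaX kX).
Hypothesis hkX : bounded_continuous_kernel OmegaX kX.

Let fstX : B0 -> 'rV[R]_p := fst.

Lemma fstX_measurable : measurable_fun [set: B0] (fstX : B0 -> borel R p).
Proof. exact: measurable_fst. Qed.

Lemma fstX_domain z : sample_domain z -> OmegaX (fstX z).
Proof. by case. Qed.

Section second_variable.
Variables (m : nat) (D : set 'rV[R]_m) (k : 'rV[R]_m -> 'rV[R]_m -> R) (K : rkhs D k).
Hypothesis hk : bounded_continuous_kernel D k.
Variables (b : B0 -> 'rV[R]_m) (mb : measurable_fun [set: B0] (b : B0 -> borel R m)).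
Hypothesis Db : forall z, sample_domain z -> D (b z).

(** [cov_concentration] at the level t = (M^2 + 1) tau / (n delta). *)
Lemma covariance_event (lam : nat -> R) (e : nat -> HX) (delta : R) :
  spectral_decomposition (cov_op P HX HX X X) lam e -> 0 < delta ->
  exists2 C : R, 0 < C & forall (A : HX -> HX) (tau : R) n,
    linear A -> self_adjoint A -> 0 < tau -> (0 < n)%N ->
    (forall N, \sum_(j < N) lam j * `|A (e j)| ^+ 2 <= tau) ->
    exists E, [/\ measurable E, (P E <= delta%:E)%E & forall w, ~ E w -> forall g,
      `|A (sample_cov_op HX K n (Xs ^~ w) (fun i => b (Xs i w, Ys i w)) g -
           cov_op P HX K X (b \o pair0) g)| <= C * Num.sqrt (tau / n%:R) * `|g|].
Proof.
move=> sd delta0.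
have m0 := pair0_measurable; have D0 := pair0_domain.
have mZ0 : measurable_fun [set: T] (pair0 : T -> Z) by exact: trace_measurable_fun.
have mZs i : measurable_fun [set: T] (pairs i : T -> Z).
  by apply: trace_measurable_fun (pairs_measurable i) _ => w; exact: pairs_domain.
pose xi : Z -> HX := centred_feature P pair0 HX fstX.
pose zeta : Z -> K := centred_feature P pair0 K b.
have [M1 M10 xM] := feature_bounded hkX fstX_domain (mean_element P HX (fstX \o pair0)).
have [M2 M20 zM] := feature_bounded hk Db (mean_element P K (b \o pair0)).
pose M := M1 + M2.
have M0 : 0 < M by rewrite addr_gt0.
have xiM z : `|xi z| <= M by apply: le_trans (xM z) _; rewrite lerDl ltW.
have zetaM z : `|zeta z| <= M by apply: le_trans (zM z) _; rewrite lerDr ltW.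
have mxi : weakly_measurable xi := feature_weakly_measurable hkX fstX_measurable fstX_domain _.
have mzeta : weakly_measurable zeta := feature_weakly_measurable hk mb Db _.
have xi0 := centred_feature_mean P m0 D0 hkX fstX_measurable fstX_domain (H := HX).
have bS := cov_op_bounded P m0 D0 HX K hkX hk fstX_measurable mb fstX_domain Db.
have SE := cov_opE P m0 D0 (H := HX) (K := K) hkX hk fstX_measurable mb fstX_domain Db.
have SXE := cov_opE P m0 D0 (H := HX) (K := HX) hkX hkX fstX_measurable fstX_measurable fstX_domain fstX_domain.
have [f pf] := rkhs_parseval HX hkX.
have [e' pe] := rkhs_parseval K hk.
pose c := (M ^+ 2 + 1) / delta.
have c0 : 0 < c by rewrite divr_gt0// addr_gt0// exprn_gt0.
exists (Num.sqrt c * (1 + M)).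
  by rewrite mulr_gt0 ?sqrtr_gt0// addr_gt0.
move=> A tau n lA sA tau0 n0 tauP.
have nR : 0 < n%:R :> R by rewrite ltr0n.
have Atau N : \sum_(k < N) Ex P (fun w => inner (xi (pair0 w)) (A (f k)) ^+ 2) <= tau.
  apply: le_trans (spectral_trace_le sd sA pf.1 tauP N).
  by apply: ler_sum => i _; rewrite SXE.
have t0 : 0 < c * (tau / n%:R) by rewrite mulr_gt0// divr_gt0.
have [E [mE PE EP]] := cov_concentration mZs mZ0 pairs_law pairs_independent mxi mzeta
  xiM zetaM xi0 bS SE pf pe lA sA Atau n0 t0.
exists E; split=> //.
  apply: le_trans PE _; rewrite lee_fin /c le_eqVlt; apply/orP; left; apply/eqP.
  have : 0 < M ^+ 2 + 1 by rewrite addr_gt0// exprn_gt0.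
  move: (M ^+ 2 + 1) => z z0; field.
  by rewrite !(gt_eqF z0, gt_eqF delta0, gt_eqF tau0, gt_eqF nR).
move=> w nE g; have := EP w nE g.
rewrite -(sample_cov_opE P pair0 HX fstX b pairs_domain w g n0).
have -> : Num.sqrt (c * (tau / n%:R)) * (1 + M) = Num.sqrt c * (1 + M) * Num.sqrt (tau / n%:R).
  by rewrite sqrtrM ?(ltW c0)// mulrAC.
exact.
Qed.

End second_variable.
End SampleEvents.

(** * Sample covariances, resolvents and the source condition *)

Section SampleCovariance.
Variables (R : realType) (m1 : nat) (D1 : set 'rV[R]_m1) (k1 : 'rV[R]_m1 -> 'rV[R]_m1 -> R).
Variables (H : rkhs D1 k1) (m2 : nat) (D2 : set 'rV[R]_m2) (k2 : 'rV[R]_m2 -> 'rV[R]_m2 -> R).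
Variables (K : rkhs D2 k2) (n : nat) (x : nat -> 'rV[R]_m1) (y : nat -> 'rV[R]_m2).

Let phi (i : 'I_n) : H := rkhs_section H (x i) - sample_mean_element H n x.
Let psi (i : 'I_n) : K := rkhs_section K (y i) - sample_mean_element K n y.

Lemma sample_cov_op_span g : exists c : 'I_n -> R,
  sample_cov_op H K n x y g = \sum_i c i *: phi i.
Proof.
exists (fun i => n%:R^-1 * inner (psi i) g); rewrite /sample_cov_op scaler_sumr.
by apply: eq_bigr => i _; rewrite /tensor scalerA.
Qed.

Lemma sample_cov_op_bounded : bounded_operator (sample_cov_op H K n x y).
Proof.
split.
  move=> a u v; rewrite /sample_cov_op scalerA (mulrC a) -scalerA -scalerDr; congr (_ *: _).
  rewrite scaler_sumr -big_split/=; apply: eq_bigr => i _.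
  by rewrite /tensor innerDr innerZr scalerDl scalerA.
exists (n%:R^-1 * \sum_i (`|psi i| * `|phi i|)) => u.
rewrite /sample_cov_op normrZ ger0_norm ?invr_ge0// -mulrA ler_wpM2l ?invr_ge0//.
apply: le_trans (ler_norm_sum _ _ _) _; rewrite mulr_suml; apply: ler_sum => i _.
rewrite /tensor normrZ mulrAC ler_wpM2r//; exact: Cauchy_Schwarz.
Qed.
End SampleCovariance.

Section SampleVariance.
Variables (R : realType) (m : nat) (D : set 'rV[R]_m) (k : 'rV[R]_m -> 'rV[R]_m -> R).
Variables (H : rkhs D k) (n : nat) (x : nat -> 'rV[R]_m).

Lemma sample_variance_self_adjoint : self_adjoint (sample_cov_op H H n x x).
Proof.
move=> u v; rewrite /sample_cov_op innerZl innerZr; congr (_ * _).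
rewrite inner_suml inner_sumr; apply: eq_bigr => i _.
by rewrite /tensor innerZl innerZr mulrC (innerC u); congr (_ * _).
Qed.

Lemma sample_variance_ge0 u : 0 <= inner (sample_cov_op H H n x x u) u.
Proof.
rewrite /sample_cov_op innerZl mulr_ge0 ?invr_ge0// inner_suml.
by apply: sumr_ge0 => i _; rewrite /tensor innerZl -expr2 sqr_ge0.
Qed.
End SampleVariance.

Section ResolventFacts.
Variables (R : realType) (H : hilbert R) (S : H -> H).
Hypotheses (bS : bounded_operator S) (sS : self_adjoint S) (S0 : forall u, 0 <= inner (S u) u).
Variables (eps : R) (eps0 : 0 < eps).

Definition resolvent : H -> H := op_inv (fun f => S f + eps *: f).

Let Se f := S f + eps *: f.

Lemma shift_bounded : bounded_operator Se.
Proof.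
split; first by move=> a u v; rewrite /Se bS.1 !scalerDr !scalerA (mulrC a) addrACA.
have [M M0 SM] := bounded_pos bS; exists (M + eps) => u.
apply: le_trans (ler_normD _ _) _; rewrite normrZ (ger0_norm (ltW eps0)) mulrDl.
by rewrite lerD2r.
Qed.

Lemma shift_self_adjoint : self_adjoint Se.
Proof. by move=> u v; rewrite /Se !innerE sS. Qed.

Lemma shift_coercive u : eps * `|u| ^+ 2 <= inner (Se u) u.
Proof. by rewrite /Se innerDl innerZl inner_norm lerDr. Qed.

Lemma resolventK f : S (resolvent f) + eps *: resolvent f = f.
Proof. exact: (coercive_op_invP shift_bounded shift_self_adjoint eps0 shift_coercive). Qed.

Lemma resolventKV f : resolvent (S f + eps *: f) = f.
Proof.
apply: (coercive_inj shift_bounded.1 eps0 shift_coercive).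
exact: resolventK.
Qed.

Lemma resolvent_linear : linear resolvent.
Proof.
move=> a u v; apply: (coercive_inj shift_bounded.1 eps0 shift_coercive).
by rewrite shift_bounded.1 /Se !resolventK.
Qed.

Lemma resolvent_self_adjoint : self_adjoint resolvent.
Proof.
move=> u v; rewrite -{2}(resolventK u) -/(Se _) shift_self_adjoint /Se.
by rewrite resolventK.
Qed.

Lemma resolvent_eigen l u : 0 <= l -> S u = l *: u -> resolvent u = (l + eps)^-1 *: u.
Proof.
move=> l0 Su; have le0 : l + eps != 0 by rewrite gt_eqF// ltr_wpDl.
rewrite -[in LHS](scale1r u) -(mulVf le0) -scalerA (linZ resolvent_linear) scalerDl -Su.
by rewrite resolventKV.
Qed.
End ResolventFacts.

Section SourceCondition.
Variables (R : realType) (H K : hilbert R) (S : H -> H) (M beta : R).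
Hypotheses (bS : bounded_operator S) (sS : self_adjoint S) (S0 : forall u, 0 <= inner (S u) u).
Hypotheses (SM : forall u, `|S u| <= M * `|u|) (M1 : 1 <= M) (beta0 : 0 < beta).
Variables (lam0 : nat -> R) (e0 : nat -> H) (sd0 : spectral_decomposition S lam0 e0).
Variables (SXY S1 : K -> H) (bS1 : bounded_operator S1).
Hypothesis source : forall g, SXY g = op_pow S (1 + beta) (S1 g).

(** If D = S^beta in the eigenbasis attached to [op_pow], then S D = S^(1 + beta),
    so that Rop = D S1 solves S Rop = SXY and has its range orthogonal to ker S.
    The operator eps (S + eps)^-1 D is diagonal with the coefficients bounded in
    [powR_bias]. *)
Lemma source_condition : exists Rop : K -> H,
  [/\ bounded_operator Rop, forall g, S (Rop g) = SXY g,
      forall g z, S z = 0 -> inner (Rop g) z = 0 &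
      exists2 Kb, 0 < Kb & forall eps, 0 < eps -> forall g,
        `|eps *: resolvent S eps (Rop g)| <= Kb * eps `^ (Num.min beta 1) * `|g|].
Proof.
have M0 : 0 <= M by exact: le_trans M1.
have s0 : 0 <= 1 + beta by rewrite addr_ge0// ltW.
have [lam [e [sd dP]]] := op_powP s0 SM sd0.
have eo := spectral_quasi sd; have dS := spectral_diag_op sd.
have lam_ge0 : forall j, 0 <= lam j by case: sd.
have lamM j : lam j <= M := spectral_le j sd SM.
have lMb j : `|lam j `^ beta| <= M `^ beta.
  rewrite ger0_norm ?powR_ge0//.
  by apply: ge0_ler_powR; rewrite ?nnegrE// ltW.
have [D dD] := diag_op_ex eo lMb.
have SD u : S (D u) = op_pow S (1 + beta) u.
  have h : diag_op e (fun j => lam j `^ (1 + beta)) (S \o D).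
    apply: diag_op_ext (@diag_op_comp _ _ _ eo _ _ _ _ dS dD) => j.
    have := @mulr_powRB1 R (lam j) (1 + beta) (lam_ge0 j).
    by rewrite [1 + beta - 1]addrC addKr; apply; rewrite addr_gt0.
  by rewrite -(diag_op_unique h dP).
have Dz z : S z = 0 -> D z = 0.
  move=> Sz; apply: (cvg_unique _ (@dD z)) => //.
  apply: cvg_near_cst; apply: nearW => n; apply: big1 => j _.
  rewrite diag_term; have /eqP := diag_op_coef eo dS z j.
  rewrite Sz inner0l eq_sym mulf_eq0 => /orP[/eqP ->|/eqP ->]; last by rewrite mulr0 scale0r.
  by rewrite powR0 ?gt_eqF// mul0r scale0r.
have [C C0 S1C] := bounded_pos bS1.
exists (D \o S1); split.
- split; first by move=> a u v; rewrite /= bS1.1 (diag_op_linear dD).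
  exists (M `^ beta * C) => u; apply: le_trans (diag_op_norm eo dD _ lMb) _.
  by rewrite -mulrA ler_wpM2l ?powR_ge0.
- by move=> g; rewrite /= SD source.
- by move=> g z /Dz h; rewrite /= (diag_op_self_adjoint dD) h inner0r.
exists (M `^ beta * C) => [|eps eps0 g].
  by rewrite mulr_gt0// powR_gt0// (lt_le_trans _ M1).
pose w j := eps * lam j `^ beta / (lam j + eps).
have le0 j : 0 < lam j + eps by rewrite ltr_wpDl.
have w0 j : 0 <= w j.
  by rewrite /w divr_ge0 ?(ltW (le0 j))// mulr_ge0 ?powR_ge0// ltW.
have wM j : `|w j| <= M `^ beta * eps `^ (Num.min beta 1).
  by rewrite ger0_norm//; exact: powR_bias.
have [W dW] := diag_op_ex eo wM.
have SW u : S (W u) + eps *: W u = eps *: D u.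
  have h1 := diag_op_add (@diag_op_comp _ _ _ eo _ _ _ _ dS dW) (diag_op_scale (a := eps) dW).
  have h2 := diag_op_scale (a := eps) dD.
  have h3 := diag_op_ext _ h1.
  have {}h3 : diag_op e (fun j => eps * lam j `^ beta) (fun u => (S \o W) u + eps *: W u).
    by apply: h3 => j; rewrite /w; field; rewrite gt_eqF.
  by have /(congr1 (fun F => F u)) := diag_op_unique h3 h2.
have -> : eps *: resolvent S eps ((D \o S1) g) = W (S1 g).
  rewrite -(linZ (resolvent_linear bS sS S0 eps0)) /= -SW.
  exact: resolventKV.
apply: le_trans (diag_op_norm eo dW _ wM) _.
rewrite [leRHS](_ : _ = M `^ beta * eps `^ (Num.min beta 1) * (C * `|g|)); last by ring.
by rewrite ler_wpM2l// mulr_ge0 ?powR_ge0.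
Qed.

End SourceCondition.

(** * The rate of convergence *)

Lemma powR_half_inv (R : realType) n : (0 < n)%N ->
  n%:R `^ (- (1 / 2)) = Num.sqrt (n%:R^-1) :> R.
Proof. by move=> n0; rewrite powRN div1r powR12_sqrt// sqrtrV. Qed.

(** Uses nn <= nn rho, and the identity nn^2 rho / eps =
    n^-1 eps^(-(3 alpha + 1) / (2 alpha)). *)
Lemma error_le_rate (R : realType) (alpha beta c1 c2 G Kb nn rho b : R) (eps : nat -> R) n :
  1 < alpha -> 0 <= c1 -> 0 <= c2 -> 0 <= G -> 0 <= Kb -> (0 < n)%N ->
  0 < eps n -> eps n <= 1 ->
  nn = Num.sqrt (n%:R^-1) ->
  rho = eps n `^ (- ((alpha + 1) / (2 * alpha))) ->
  b = Num.min beta 1 ->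
  c1 * nn + ((1 + c1 * nn / eps n) * (c2 * (nn * rho) * G) + Kb * eps n `^ b) <=
  (c1 + c2 * G + c1 * c2 * G + Kb) * rate alpha beta eps n.
Proof.
move=> a1 c10 c20 G0 Kb0 n0 e0 e1 nnE rhoE bE.
have a0 : 0 < alpha by exact: lt_trans a1.
have nn0 : 0 <= nn by rewrite nnE sqrtr_ge0.
have rho1 : 1 <= rho.
  rewrite rhoE powRN -[leLHS]invr1 lef_pV2 ?posrE ?powR_gt0//.
  have p0 : 0 <= (alpha + 1) / (2 * alpha) by rewrite divr_ge0 ?mulr_ge0 ?addr_ge0// ltW.
  apply: (@le_trans _ _ (1 `^ ((alpha + 1) / (2 * alpha)))); last by rewrite powR1.
  by apply: ge0_ler_powR; rewrite ?nnegrE// ltW.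
have t3E : n%:R^-1 * eps n `^ (- ((3 * alpha + 1) / (2 * alpha))) = nn * (nn * rho) / eps n.
  rewrite mulrA -expr2 nnE rhoE sqr_sqrtr ?invr_ge0//.
  rewrite -(powR_inv1 (ltW e0)) -mulrA -powRD ?(gt_eqF e0) ?implybT//; congr (_ * _ `^ _).
  by field; rewrite gt_eqF.
rewrite /rate powR_half_inv// t3E -nnE -rhoE -bE.
set t1 := nn * _ `^ (b - 1); set t2 := _ `^ b.
have t10 : 0 <= t1 by rewrite mulr_ge0// powR_ge0.
have t20 : 0 <= t2 by rewrite powR_ge0.
set t3 := nn * (nn * rho) / eps n; set t4 := nn * rho.
have rho0 : 0 <= rho by exact: le_trans rho1.
have t40 : 0 <= t4 by rewrite mulr_ge0.
have t30 : 0 <= t3 by rewrite divr_ge0 ?(ltW e0)// mulr_ge0.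
have nt4 : nn <= t4 by rewrite /t4 ler_peMr.
have -> : c1 * nn + ((1 + c1 * nn / eps n) * (c2 * t4 * G) + Kb * t2) =
    c1 * nn + (c2 * G) * t4 + (c1 * c2 * G) * t3 + Kb * t2.
  by rewrite /t3 /t4; ring.
have g1 : 0 <= c2 * G by rewrite mulr_ge0.
have g2 : 0 <= c1 * c2 * G by rewrite !mulr_ge0.
rewrite !mulrDl; apply: lerD; first apply: lerD; first apply: lerD;
  apply: ler_wpM2l => //.
all: by clearbody t1 t2 t3 t4; clear -t10 t20 t30 t40 nt4; lra.
Qed.

Lemma decay_upper (R : realType) (lam alpha C : R) k : lam / (k.+1%:R `^ (- alpha)) <= C ->
  lam <= C * k.+1%:R `^ (- alpha).
Proof. by rewrite ler_pdivrMr// powR_gt0. Qed.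

Lemma measure_union4 d (T : measurableType d) (R : realType) (P : probability T R)
    (E1 E2 E3 E4 : set T) (delta : R) :
  [/\ measurable E1, measurable E2, measurable E3 & measurable E4] ->
  [/\ (P E1 <= (delta / 4)%:E)%E, (P E2 <= (delta / 4)%:E)%E,
      (P E3 <= (delta / 4)%:E)%E & (P E4 <= (delta / 4)%:E)%E] ->
  measurable (E1 `|` E2 `|` (E3 `|` E4)) /\ (P (E1 `|` E2 `|` (E3 `|` E4)) <= delta%:E)%E.
Proof.
move=> [m1 m2 m3 m4] [p1 p2 p3 p4].
have m12 := measurableU _ _ m1 m2; have m34 := measurableU _ _ m3 m4.
split; first exact: measurableU.
have -> : delta = (delta / 4 + delta / 4) + (delta / 4 + delta / 4) by field.
apply: le_trans (measureU2 P m12 m34) _; rewrite EFinD; apply: leeD.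
  by apply: le_trans (measureU2 P m1 m2) _; rewrite EFinD; exact: leeD.
by apply: le_trans (measureU2 P m3 m4) _; rewrite EFinD; exact: leeD.
Qed.

Theorem corollary4p4
  (R : realType) (disp : measure_display) (T : measurableType disp)
  (P : probability T R) (p q : nat)
  (OmegaX : set 'rV[R]_p) (OmegaY : set 'rV[R]_q)
  (X : T -> 'rV[R]_p) (Y : T -> 'rV[R]_q)
  (hX : random_vector OmegaX X) (hY : random_vector OmegaY Y)
  (kX : 'rV[R]_p -> 'rV[R]_p -> R) (kY : 'rV[R]_q -> 'rV[R]_q -> R)
  (hkX : pd_kernel OmegaX kX) (hkY : pd_kernel OmegaY kY)
  (HX : rkhs OmegaX kX) (HY : rkhs OmegaY kY)
  (Xs : nat -> T -> 'rV[R]_p) (Ys : nat -> T -> 'rV[R]_q)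
  (hXs : forall i, random_vector OmegaX (Xs i))
  (hYs : forall i, random_vector OmegaY (Ys i))
  (hiid : iid_copies P X Y Xs Ys)
  (d : nat) (alpha beta : R) (eps : nat -> R) :
  let SXX : HX -> HX := cov_op P HX HX X X in
  let SXY : HY -> HX := cov_op P HX HY X Y in
  let RXY : HY -> HX := fun g => mp_inv SXX (SXY g) in
  let RXY' : HY -> HX := fun g => mp_inv (op_sqrt SXX) (SXY g) in
  let M' : HX -> HX := fun f => RXY' (adjoint RXY' f) in
  let hSXX n w : HX -> HX := sample_cov_op HX HX n (Xs ^~ w) (Xs ^~ w) in
  let hSXY n w : HY -> HX := sample_cov_op HX HY n (Xs ^~ w) (Ys ^~ w) in
  let hInvSqrt n w : HX -> HX :=
    op_inv (op_sqrt (fun f => hSXX n w f + eps n *: f)) in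
  let hRXY' n w : HY -> HX := fun g => hInvSqrt n w (hSXY n w g) in
  let hM' n w : HX -> HX := fun f => hRXY' n w (adjoint (hRXY' n w) f) in
  forall
  (A1X : dense_in_L2_mod_constants P HX X)
  (A1Y : dense_in_L2_mod_constants P HY Y)
  (A2X : bounded_continuous_kernel OmegaX kX)
  (A2Y : bounded_continuous_kernel OmegaY kY)
  (A3 : range SXY `<=` range SXX)
  (A4 : bounded_operator RXY)
  (A5 : dominated_conditionals P X Y OmegaY)
  (A6 : minimal_sufficient_predictors P HX X Y d)
  (A7 : has_rank RXY d)
  (A8 : has_rank RXY' d)
  (halpha : 1 < alpha)
  (A9 : polynomial_eigenvalue_decay SXX alpha)
  (hbeta : 0 < beta)
  (A10 : exists S : HY -> HX, bounded_operator S /\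
           forall g, SXY g = op_pow SXX (1 + beta) (S g))
  (heps : forall n, 0 < eps n)
  (heps0 : eps n @[n --> \oo] --> 0)
  (hdistinct : distinct_nonzero_eigenvalues M')
  (psi : 'I_d -> HX) (hpsi : first_eigenfunctions M' psi)
  (psih : nat -> T -> 'I_d -> HX)
  (hpsih : forall n w, (0 < n)%N -> first_eigenfunctions (hM' n w) (psih n w)),
  forall j : 'I_d,
    let s' n w : R := Num.sg (inner (psih n w j) (psi j)) in
    let etah n w : HX := hInvSqrt n w (psih n w j) in
    let eta : HX := mp_inv (op_sqrt SXX) (psi j) in
    bigOp P (fun n w => `|etah n w - s' n w *: eta|) (rate alpha beta eps).
Proof.
move=> SXX SXY RXY RXY' M' hSXX hSXY hInvSqrt hRXY' hM' _ _ A2X A2Y _ _ _ _ _ A8 halpha A9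
  hbeta [S1 [bS1 source]] heps heps0 hdistinct psi hpsi psih hpsih j s' etah eta.
have m0 := pair0_measurable hX hY; have D0 := pair0_domain hX hY.
have mfst := @fstX_measurable R p q.
have msnd : measurable_fun [set: (borel R p * borel R q)%type]
   ((snd : borel R p * borel R q -> 'rV[R]_q) : _ -> borel R q) by exact: measurable_snd.
have dfst := @fstX_domain R p q OmegaX OmegaY.
have dsnd z : sample_domain OmegaX OmegaY z -> OmegaY z.2 by case.
have bS : bounded_operator SXX := cov_op_bounded P m0 D0 HX HX A2X A2X mfst mfst dfst dfst.
have SXXE := cov_opE P m0 D0 (H := HX) (K := HX) A2X A2X mfst mfst dfst dfst.
have bSXY : bounded_operator SXY := cov_op_bounded P m0 D0 HX HY A2X A2Y mfst msnd dfst dsnd.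
have sS : self_adjoint SXX.
  move=> u v; rewrite [RHS]innerC; apply: etrans (SXXE u v) _.
  apply: etrans _ (esym (SXXE v u)); congr Ex; apply/funext => w; exact: mulrC.
have S0 u : 0 <= inner (SXX u) u.
  rewrite [inner _ _](SXXE u u); apply: Ex_ge0 => w; rewrite -expr2; exact: sqr_ge0.
have [M M0 SM'] := bounded_pos bS.
have M1 : 1 <= M + 1 by rewrite lerDr ltW.
have SM u : `|SXX u| <= (M + 1) * `|u|.
  by apply: le_trans (SM' u) _; rewrite ler_wpM2r// lerDl.
have [lam [e [sd _ lam0 [C0 lamC]]]] := A9.
have [Rop [bR SR Rperp [Kb Kb0 bias]]] :=
  source_condition bS sS S0 SM M1 hbeta sd bS1 source.
have SB : is_sqrt SXX (op_sqrt SXX) by apply: op_sqrtP; exact: spectral_sqrt SM sd.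
set B := op_sqrt SXX in SB RXY' M' A8 hdistinct hpsi eta *.
have [bB sB B0 BB] := SB.
have BRop g : mp_inv B (SXY g) = B (Rop g).
  apply: mp_inv_eq; [exact: bB.1 | by rewrite BB SR|].
  by move=> z Bz; rewrite sB Bz inner0r.
have RXY'E : RXY' = B \o Rop by apply/funext => g; exact: BRop.
pose Top := B \o Rop.
have M'E : M' = Top \o adjoint Top by rewrite /M' RXY'E.
rewrite RXY'E in A8; rewrite M'E in hdistinct hpsi.
have [lamp [psio Mpsi lamo top]] := hpsi.
have etaE : eta = pop_eta B Rop psi lamp j.
  apply: mp_inv_eq; first exact: bB.1.
    exact: (pop_eta_sqrt SB bR psio Mpsi lamo top A8).
  move=> z Bz; rewrite /pop_eta innerZl Rperp ?mulr0//.
  by rewrite -BB Bz (lin0 bB.1).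
have Re g : exists c : nat -> R, \sum_(k < n) c k *: e k @[n --> \oo] --> Rop g.
  exists (fun k => inner (Rop g) (e k)); apply: (spectral_span sd) => z Sz.
  exact: Rperp.
have Se k : SXX (e k) = lam k *: e k.
  exact: (diag_op_vec (spectral_quasi sd) (spectral_diag_op sd)).
have [K [kappa [K0 kappa0 det]]] := deterministic_bound bS sS SB bSXY bR SR
  psio Mpsi lamo top A8 hdistinct lam0 Se (fun k => spectral_norm1 k sd) Re j.
have [rho rho0 Rrho] := bounded_pos bR.
have C00 : 0 <= C0.
  by apply: le_trans (lamC 0%N).1; rewrite divr_ge0 ?powR_ge0// ltW.
have [Kt Kt0 trace] := trace_sum_bound halpha C00 (fun k => ltW (lam0 k))
  (fun k => decay_upper (lamC k).1).
pose tau1 := (M + 2) ^+ 2 * Kt.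
have tau10 : 0 < tau1 by rewrite mulr_gt0// exprn_gt0// addr_gt0.
have trace1 N : \sum_(k < N) lam k * `|id (e k)| ^+ 2 <= tau1.
  apply: (@le_trans _ _ ((M + 2) ^+ 2 * \sum_(k < N) lam k / (lam k + 1) ^+ 2)).
    rewrite mulr_sumr; apply: ler_sum => k _.
    rewrite (spectral_norm1 k sd) expr1n mulr1.
    have l1 : 0 < lam k + 1 by rewrite addr_gt0.
    rewrite mulrA ler_pdivlMr ?exprn_gt0// mulrC; apply: ler_wpM2r; first exact: ltW.
    rewrite ler_pXn2r ?nnegrE ?(ltW l1)// ?addr_ge0 ?(ltW M0)//.
    by have := spectral_le k sd SM; lra.
  rewrite /tau1 ler_wpM2l ?sqr_ge0//.
  by have := trace 1 N ltr01 (lexx _); rewrite powR1 expr1n mulr1.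
pose rh n := eps n `^ (- ((alpha + 1) / (2 * alpha))).
have rh0 n : 0 < rh n by rewrite powR_gt0.
have trace2 n : eps n <= 1 -> forall N,
    \sum_(k < N) lam k * `|resolvent SXX (eps n) (e k)| ^+ 2 <= Kt * rh n ^+ 2.
  move=> en1 N; apply: le_trans (trace (eps n) N (heps n) en1).
  apply: ler_sum => k _.
  rewrite (resolvent_eigen bS sS S0 (heps n) (ltW (lam0 k)) (Se k)).
  have le0 : 0 < lam k + eps n by rewrite addr_gt0.
  by rewrite normrZ (spectral_norm1 k sd) mulr1 normfV ger0_norm ?(ltW le0)// exprVn.
move=> delta delta0.
have delta40 : 0 < delta / 4 by rewrite divr_gt0.
have [CX CX0 evX] := covariance_event hX hY hXs hYs hiid A2X HX A2X mfst dfst sd delta40.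
have [CY CY0 evY] := covariance_event hX hY hXs hYs hiid A2X HY A2Y msnd dsnd sd delta40.
pose C := CX + CY.
have C_0 : 0 < C by rewrite addr_gt0.
pose c1 := C * Num.sqrt tau1; pose c2 := C * Num.sqrt Kt.
have c10 : 0 < c1 by rewrite mulr_gt0 ?sqrtr_gt0.
have c20 : 0 < c2 by rewrite mulr_gt0 ?sqrtr_gt0.
pose G := 1 + rho + Kb.
have G0 : 0 < G by rewrite !addr_gt0.
pose Kfin := K * (c1 + c2 * G + c1 * c2 * G + Kb).
have g1 : 0 < c2 * G by rewrite mulr_gt0.
have g2 : 0 < c1 * c2 * G := mulr_gt0 (mulr_gt0 c10 c20) G0.
exists Kfin; first exact: mulr_gt0 K0 (addr_gt0 (addr_gt0 (addr_gt0 c10 g1) g2) Kb0).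
pose nn n : R := Num.sqrt (n%:R^-1).
have nnlim : \forall n \near \oo, c1 * nn n <= kappa.
  have k2 : 0 < (kappa / c1) ^+ 2 by rewrite exprn_gt0// divr_gt0.
  have [N hN] := eps_inv_ex k2; exists N.+1 => // n /= Nn.
  rewrite mulrC -ler_pdivlMr// /nn.
  rewrite -(ger0_norm (ltW (divr_gt0 kappa0 c10))) -sqrtr_sqr.
  apply: ler_wsqrtr; have := hN n.-1; rewrite prednK ?(leq_trans _ Nn)//.
  by apply; rewrite -ltnS prednK// (leq_trans _ Nn).
have epslim (x : R) : 0 < x -> \forall n \near \oo, eps n <= x.
  move=> x0; move/cvgrPdist_lt : heps0 => /(_ x x0) [N _ hN]; exists N => // n Nn.
  by have := hN n Nn; rewrite /= sub0r normrN ger0_norm ?(ltW (heps n))// => /ltW.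
near=> n.
have n0 : (0 < n)%N by near: n; exists 1%N.
have en1 : eps n <= 1 by near: n; exact: epslim.
have enk : eps n <= kappa by near: n; exact: epslim.
have nnk : c1 * nn n <= kappa by near: n.
have e0 := heps n.
have t20 : 0 < Kt * rh n ^+ 2 by rewrite mulr_gt0// exprn_gt0.
have lid (L : hilbert R) : linear (@id L) by [].
have sid : self_adjoint (@id HX) by [].
have lA := resolvent_linear bS sS S0 e0.
have sA := resolvent_self_adjoint bS sS S0 e0.
have [E1 [mE1 PE1 hE1]] := evX id tau1 n (lid HX) sid tau10 n0 trace1.
have [E2 [mE2 PE2 hE2]] := evY id tau1 n (lid HX) sid tau10 n0 trace1.
have [E3 [mE3 PE3 hE3]] := evX _ _ n lA sA t20 n0 (trace2 n en1).
have [E4 [mE4 PE4 hE4]] := evY _ _ n lA sA t20 n0 (trace2 n en1).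
have [mE PE] := measure_union4 (And4 mE1 mE2 mE3 mE4) (And4 PE1 PE2 PE3 PE4).
exists (E1 `|` E2 `|` (E3 `|` E4)); split=> // w /= hw; apply: contrapT => nE.
have nE1 : ~ E1 w by move=> h; apply: nE; left; left.
have nE2 : ~ E2 w by move=> h; apply: nE; left; right.
have nE3 : ~ E3 w by move=> h; apply: nE; right; left.
have nE4 : ~ E4 w by move=> h; apply: nE; right; right.
move: hw; apply/negP; rewrite -leNgt normr_id.
have q1 : Num.sqrt (tau1 / n%:R) = Num.sqrt tau1 * nn n by rewrite sqrtrM// ltW.
have q2 : Num.sqrt (Kt * rh n ^+ 2 / n%:R) = Num.sqrt Kt * (nn n * rh n).
  rewrite sqrtrM ?(ltW t20)// sqrtrM ?(ltW Kt0)// sqrtr_sqr ger0_norm ?(ltW (rh0 n))//.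
  by rewrite -mulrA (mulrC (rh n)).
have nn0 : 0 <= nn n by exact: sqrtr_ge0.
(* D1 bounds the sampling errors, E the same errors behind the resolvent, and b0
   the bias *)
pose D1 := c1 * nn n; pose E := c2 * (nn n * rh n); pose b0 := Kb * eps n `^ (Num.min beta 1).
have D10 : 0 <= D1 by rewrite mulr_ge0// ltW.
have E_0 : 0 <= E by rewrite !mulr_ge0// ltW.
have b00 : 0 <= b0 by rewrite mulr_ge0 ?powR_ge0// ltW.
have CXC : CX <= C by rewrite lerDl ltW.
have CYC : CY <= C by rewrite lerDr ltW.
have up (c x y z : R) : 0 <= x -> 0 <= y -> c <= C -> z <= c * x * y -> z <= C * x * y.
  move=> x0 y0 cC h; apply: le_trans h _.
  by apply: ler_wpM2r => //; apply: ler_wpM2r.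
have b1 f : `|hSXX n w f - SXX f| <= D1 * `|f|.
  have := hE1 w nE1 f; rewrite q1 /D1 /c1 => h.
  by rewrite -(mulrA C); apply: (up CX) => //; rewrite mulr_ge0// sqrtr_ge0.
have b2 g : `|hSXY n w g - SXY g| <= D1 * `|g|.
  have := hE2 w nE2 g; rewrite q1 /D1 /c1 => h.
  by rewrite -(mulrA C); apply: (up CY) => //; rewrite mulr_ge0// sqrtr_ge0.
have b3 f : `|resolvent SXX (eps n) (hSXX n w f - SXX f)| <= E * `|f|.
  have := hE3 w nE3 f; rewrite q2 /E /c2 => h.
  by rewrite -(mulrA C); apply: (up CX) => //; rewrite !mulr_ge0// ?sqrtr_ge0// ltW.
have b4 g : `|resolvent SXX (eps n) (hSXY n w g - SXY g)| <= E * `|g|.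
  have := hE4 w nE4 g; rewrite q2 /E /c2 => h.
  by rewrite -(mulrA C); apply: (up CY) => //; rewrite !mulr_ge0// ?sqrtr_ge0// ltW.
have b5 g : `|eps n *: resolvent SXX (eps n) (Rop g)| <= b0 * `|g| := bias _ e0 g.
have bSh : bounded_operator (hSXX n w) by exact: sample_cov_op_bounded.
have sSh : self_adjoint (hSXX n w) by exact: sample_variance_self_adjoint.
have Sh0 u : 0 <= inner (hSXX n w u) u by exact: sample_variance_ge0.
have bSXYh : bounded_operator (hSXY n w) by exact: sample_cov_op_bounded.
pose D2 := (1 + D1 / eps n) * (E * (1 + rho + b0)) + b0.
have D20 : 0 <= D2.
  by rewrite addr_ge0// mulr_ge0// ?addr_ge0 ?divr_ge0 ?mulr_ge0// ?addr_ge0// ltW.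
have [_ CQQ] := inv_sqrt_facts (shift_bounded bSh e0) (@shift_self_adjoint _ _ _ sSh (eps n)) e0
  (@shift_coercive _ _ _ Sh0 (eps n)).
have b6 g : `|hInvSqrt n w (hInvSqrt n w (hSXY n w g)) - Rop g| <= D2 * `|g|.
  apply: (resolvent_bound e0 D10 E_0 bSh.1 bS.1 lA Sh0 _ _ SR b1 b3 b4 Rrho b5).
  - exact: resolventKV.
  - exact: resolventK.
  - exact: CQQ.
have span g : exists c : 'I_n -> R, hSXY n w g =
    \sum_i c i *: (rkhs_section HX (Xs i w) - sample_mean_element HX n (Xs ^~ w)).
  exact: sample_cov_op_span.
have final := det (eps n) D1 D2 (hSXX n w) (hSXY n w) n _ (psih n w) e0 enk D10 nnk D20
  bSh sSh Sh0 bSXYh span (And3 b1 b2 b6) (hpsih n w n0).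
rewrite etaE; apply: le_trans final _.
rewrite /Kfin -mulrA ler_wpM2l ?(ltW K0)//.
apply: le_trans _ (error_le_rate halpha (ltW c10) (ltW c20) (ltW G0) (ltW Kb0) n0 e0 en1
  erefl erefl erefl).
apply: lerD => //; apply: lerD => //; apply: ler_wpM2l.
  by rewrite addr_ge0// divr_ge0// ltW.
apply: ler_wpM2l => //; rewrite /G lerD2l /b0.
rewrite -[leRHS]mulr1; apply: ler_wpM2l; first exact: ltW.
have eb : 0 <= Num.min beta 1 by rewrite le_min ler01 ltW.
apply: (@le_trans _ _ (1 `^ Num.min beta 1)); last by rewrite powR1.
by apply: ge0_ler_powR; rewrite ?nnegrE// ltW.
Unshelve. all: by end_near. Qed.
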